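(* Let $1<p<2$, $\varsigma\in M^p(\mathbb{Z}^n\times\mathbb{T}^n)$ and $g_1,g_2\in M^1(\mathbb{Z}^n)$. Then, for fixed $\varsigma\in M^p(\mathbb{Z}^n\times\mathbb{T}^n)$, the operator $\mathfrak{L}^{g_1,g_2}_\varsigma$ can be uniquely extended to a bounded linear operator on $\ell^2(\mathbb{Z}^n)$ such that $$\|\mathfrak{L}^{g_1,g_2}_\varsigma\|_{\mathcal{B}(\ell^2(\mathbb{Z}^n))}\le\|\varsigma\|_{M^p(\mathbb{Z}^n\times\mathbb{T}^n)}\,\|g_1\|_{M^1(\mathbb{Z}^n)}\,\|g_2\|_{M^1(\mathbb{Z}^n)}.$$
   Context: $\mathbb{T}^n$ is the torus with normalized Haar measure $dw$; $\mathbb{Z}^n\times\mathbb{T}^n$ carries the product of counting measure and $dw$. $T_mf(k)=f(k-m)$, $M_wf(k)=e^{2\pi i w\cdot k}f(k)$, and the short-time Fourier transform is $V_gf(m,w)=\langle f,M_wT_mg\rangle=\sum_{k\in\mathbb{Z}^n}f(k)\overline{g(k-m)}e^{-2\pi i w\cdot k}$. $\mathcal{S}(\mathbb{Z}^n)$ is the space of rapidly decreasing functions on $\mathbb{Z}^n$, $\mathcal{S}'(\mathbb{Z}^n)$ its dual (tempered distributions); $\mathcal{S}(\mathbb{Z}^n\times\mathbb{T}^n)$ and $\mathcal{S}'(\mathbb{Z}^n\times\mathbb{T}^n)$ are the Schwartz functions and tempered distributions on the group $\mathbb{Z}^n\times\mathbb{T}^n$. Modulation spaces: fix a non-zero window $g\in\mathcal{S}(\mathbb{Z}^n)$;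 for $1\le p\le\infty$, $M^p(\mathbb{Z}^n)=\{f\in\mathcal{S}'(\mathbb{Z}^n): V_gf\in L^p(\mathbb{Z}^n\times\mathbb{T}^n)\}$ with $\|f\|_{M^p(\mathbb{Z}^n)}=\|V_gf\|_{L^p}$. Similarly, fix a non-zero $g\in\mathcal{S}(\mathbb{Z}^n\times\mathbb{T}^n)$ and set $$V_gF(m,\omega,\xi,k)=\sum_{j\in\mathbb{Z}^n}\int_{\mathbb{T}^n}e^{-2\pi i j\xi}e^{-2\pi i\eta k}F(j,\eta)\overline{g(j-m,\eta-\omega)}\,d\eta,\quad m,k\in\mathbb{Z}^n,\ \omega,\xi\in\mathbb{T}^n;$$ $M^p(\mathbb{Z}^n\times\mathbb{T}^n)$ is the space of $F\in\mathcal{S}'(\mathbb{Z}^n\times\mathbb{T}^n)$ with $\|F\|_{M^p(\mathbb{Z}^n\times\mathbb{T}^n)}=\|V_gF\|_{L^p((\mathbb{Z}^n\times\mathbb{T}^n)\times(\mathbb{T}^n\times\mathbb{Z}^n))}<\infty$. Different windows give equivalent norms. Localization operator: $\mathfrak{L}^{g_1,g_2}_\varsigma f(k)=\sum_{m\in\mathbb{Z}^n}\int_{\mathbb{T}^n}\varsigma(m,w)V_{g_1}f(m,w)\,M_wT_mg_2(k)\,dw$, or in the weak sense $$\langle\mathfrak{L}^{g_1,g_2}_\varsigma f,h\rangle_{\ell^2(\mathbb{Z}^n)}=\sum_{m\in\mathbb{Z}^n}\int_{\mathbb{T}^n}\varsigma(m,w)\,V_{g_1}f(m,w)\,\overline{V_{g_2}h(m,w)}\,dw,\qquad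 f,h\in\ell^2(\mathbb{Z}^n).$$ $\mathcal{B}(X)$ denotes the bounded linear operators on $X$ with operator norm.
   Formalization: The norm bound carries the extra factor 1/(‖g‖₂²‖G‖₂), where g and G are the fixed windows of the two modulation norms; with constant 1 it fails for small windows (rescaling shrinks only the right side). For L²-normalized windows the factor is 1. *)

(* Defs.v *)
From HB Require Import structures.
From mathcomp Require Import all_boot all_order all_algebra.
From mathcomp Require Import complex.
From mathcomp Require Import all_classical all_reals all_analysis.

Set Implicit Arguments.
Unset Strict Implicit.
Unset Printing Implicit Defensive.

Import Order.TTheory GRing.Theory Num.Theory.
Import numFieldNormedType.Exports.

Local Open Scope classical_set_scope.
Local Open Scope ring_scope.
Local Open Scope complex_scope.

Definition Zn (n : nat) : Type := 'rV[int]_n.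

HB.instance Definition _ n := GRing.Zmodule.on (Zn n).
HB.instance Definition _ n := Countable.on (Zn n).
HB.instance Definition _ n := isPointed.Build (Zn n) (0 : 'rV[int]_n).
HB.instance Definition _ n := @isMeasurable.Build default_measure_display
  (Zn n) discrete_measurable discrete_measurable0
  discrete_measurableC discrete_measurableU.

Definition countZ (R : realType) (n : nat) : set (Zn n) -> \bar R := counting.

HB.instance Definition _ (R : realType) (n : nat) :=
  Measure.copy (@countZ R n) (@counting (Zn n) R).

Lemma sigma_finite_countZ (R : realType) (n : nat) :
  sigma_finite [set: Zn n] (@countZ R n).
Proof.
exists (fun k => [set x : Zn n | pickle x = k]).
  by apply/seteqP; split=> // x _; exists (pickle x).
move=> k; split=> //; rewrite /countZ /counting asboolT ?ltry//.
apply: (@sub_finite_set _ _ [set x : Zn n | unpickle k = Some x]).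
  by move=> x /= <-; rewrite pickleK.
case E: (unpickle k) => [y|].
  by apply: (@sub_finite_set _ _ [set y]) => // x /= [->].
by apply: (@sub_finite_set _ _ set0) => // x.
Qed.

HB.instance Definition _ (R : realType) (n : nat) :=
  Measure_isSigmaFinite.Build _ _ _ (@countZ R n) (sigma_finite_countZ R n).

(* T^n = R^n / Z^n: functions on T^n are functions on R^n that are 1-periodic
   in each coordinate, and integrals over T^n are taken over the cube
   [0, 1]^n. *)
Definition torus (R : realType) (n : nat) : Type := 'rV[R]_n.

Section torus_measurable.
Variables (R : realType) (n : nat).

Definition torus_coord (i : 'I_n) (x : torus R n) : measurableTypeR R :=
  (x : 'rV[R]_n) ord0 i.

HB.instance Definition _ := GRing.Zmodule.on (torus R n).
HB.instance Definition _ := Choice.on (torus R n).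
HB.instance Definition _ := isPointed.Build (torus R n) (0 : 'rV[R]_n).

Let torus_set0 : g_sigma_preimage torus_coord set0.
Proof. exact: sigma_algebra0. Qed.

Let torus_setC A :
  g_sigma_preimage torus_coord A -> g_sigma_preimage torus_coord (~` A).
Proof. exact: sigma_algebraC. Qed.

Let torus_bigcup (F : (set (torus R n))^nat) :
  (forall i, g_sigma_preimage torus_coord (F i)) ->
  g_sigma_preimage torus_coord (\bigcup_i (F i)).
Proof. exact: sigma_algebra_bigcup. Qed.

HB.instance Definition _ := @isMeasurable.Build default_measure_display
  (torus R n) (g_sigma_preimage torus_coord)
  torus_set0 torus_setC torus_bigcup.

End torus_measurable.

Section haar.
Variable R : realType.

Definition torus_cons (n : nat) (xw : measurableTypeR R * torus R n) :
    torus R n.+1 :=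
  \row_i if unlift ord0 i is Some j then (xw.2 : 'rV[R]_n) ord0 j else xw.1.

Lemma measurable_torus_coord n (i : 'I_n) :
  measurable_fun [set: torus R n] (@torus_coord R n i).
Proof.
move=> _ Y mY; rewrite setTI; apply: sub_sigma_algebra => /=.
rewrite -bigcup_seq/=; exists i => /=; first by rewrite mem_index_enum.
by exists Y => //; rewrite setTI.
Qed.

Lemma measurable_torus_cons (n : nat) :
  measurable_fun [set: measurableTypeR R * torus R n] (@torus_cons n).
Proof.
move=> _ A mA; rewrite setTI; move: A mA.
apply: smallest_sub.
  split=> /=.
  - by rewrite preimage_set0; exact: measurable0.
  - by move=> A mA; rewrite setTD preimage_setC; exact: measurableC.
  - by move=> F mF; rewrite preimage_bigcup; exact: bigcupT_measurable.
rewrite -bigcup_mkord_ord; apply: bigcup_sub => i Ii A [B mB <-] /=.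
rewrite setTI; set j := inord i.
have cE : @torus_coord R n.+1 j \o @torus_cons n =
    fun xw => if unlift ord0 j is Some l then torus_coord l xw.2 else xw.1.
  by apply/funext => xw /=; rewrite /torus_coord /torus_cons mxE.
rewrite -comp_preimage cE -[X in measurable X]setTI.
suff: measurable_fun [set: measurableTypeR R * torus R n]
    (fun xw => if unlift ord0 j is Some l then torus_coord l xw.2 else xw.1).
  exact.
case: (unlift ord0 j) => [l|]; last exact: measurable_fst.
exact: (measurableT_comp (measurable_torus_coord l) measurable_snd).
Qed.

HB.instance Definition _ (n : nat) :=
  isMeasurableFun.Build _ _ _ _ (@torus_cons n) (@measurable_torus_cons n).

(* normalized Haar measure: the n-fold product of the uniform probability
   on [0, 1] *)
Fixpoint haar (n : nat) : probability (torus R n) R :=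
  if n is n'.+1 then
    distribution (uniform_prob (@ltr01 R) \x haar n')%E (@torus_cons n')
  else dirac (0 : torus R 0).

End haar.

(* The sigma-finite instance of [\x] in the library is shadowed by its instance
   for probability measures, hence the named product measures below. *)
Lemma sigma_finite_product d1 d2 (T1 : measurableType d1)
    (T2 : measurableType d2) (R : realType)
    (m1 : {sigma_finite_measure set T1 -> \bar R})
    (m2 : {sigma_finite_measure set T2 -> \bar R}) :
  sigma_finite [set: T1 * T2] (m1 \x m2)%E.
Proof.
have /sigma_finiteP[F [TF ndF Foo]] := sigma_finiteT m1.
have /sigma_finiteP[G [TG ndG Goo]] := sigma_finiteT m2.
exists (fun n => F n `*` G n).
  rewrite -setXTT TF TG predeqE => -[x y]; split.
    move=> [/= [n _ Fnx] [k _ Gky]]; exists (maxn n k) => //; split.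
    - by move: x Fnx; exact/subsetPset/ndF/leq_maxl.
    - by move: y Gky; exact/subsetPset/ndG/leq_maxr.
  by move=> [n _ []/= ? ?]; split; exists n.
move=> k; have [? ?] := Foo k; have [? ?] := Goo k.
split; first exact: measurableX.
by rewrite product_measure1E// lte_mul_pinfty// ge0_fin_numE.
Qed.

Section phase_space_measures.
Variables (R : realType) (n : nat).

Definition mu_phase : set (Zn n * torus R n)%type -> \bar R :=
  (@countZ R n \x haar R n)%E.

HB.instance Definition _ :=
  Measure.copy mu_phase (@countZ R n \x haar R n)%E.
HB.instance Definition _ := Measure_isSigmaFinite.Build _ _ _ mu_phase
  (sigma_finite_product (@countZ R n) (haar R n)).

Definition mu_dual_phase : set (torus R n * Zn n)%type -> \bar R :=
  (haar R n \x @countZ R n)%E.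

HB.instance Definition _ :=
  Measure.copy mu_dual_phase (haar R n \x @countZ R n)%E.
HB.instance Definition _ := Measure_isSigmaFinite.Build _ _ _ mu_dual_phase
  (sigma_finite_product (haar R n) (@countZ R n)).

Definition mu_phase2 :
    set ((Zn n * torus R n) * (torus R n * Zn n))%type -> \bar R :=
  (mu_phase \x mu_dual_phase)%E.

HB.instance Definition _ :=
  Measure.copy mu_phase2 (mu_phase \x mu_dual_phase)%E.

End phase_space_measures.
Arguments mu_phase : clear implicits.
Arguments mu_dual_phase : clear implicits.
Arguments mu_phase2 : clear implicits.

Section complex_integration.
Context d (T : measurableType d) (R : realType).
Implicit Types (mu : {measure set T -> \bar R}) (f : T -> R[i]).

Definition cmod (z : R[i]) : R := ComplexField.Normc.normc z.

Definition cmeasurable f :=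
  measurable_fun [set: T] (fun x => complex.Re (f x)) /\
  measurable_fun [set: T] (fun x => complex.Im (f x)).

Definition cintegrable mu f :=
  mu.-integrable [set: T] (fun x => (complex.Re (f x))%:E) /\
  mu.-integrable [set: T] (fun x => (complex.Im (f x))%:E).

Definition cintegral mu f : R[i] :=
  (\int[mu]_x complex.Re (f x)) +i* (\int[mu]_x complex.Im (f x)).

Definition cLnorm mu (p : \bar R) f : \bar R :=
  'N[mu]_p[EFin \o (cmod \o f)]%E.

Definition in_Lp mu (p : \bar R) f := cmeasurable f /\ (cLnorm mu p f < +oo)%E.

End complex_integration.

Section tempered.
Variables (R : realType) (n : nat).

Definition weight (k : Zn n) : R :=
  1 + (\sum_i absz ((k : 'rV[int]_n) ord0 i))%:R.

Definition seminormZ (N : nat) (f : Zn n -> R[i]) : \bar R :=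
  ereal_sup [set (weight k ^+ N * cmod (f k))%:E | k in [set: Zn n]].

Definition schwartzZ (f : Zn n -> R[i]) :=
  forall N, (seminormZ N f < +oo)%E.

(* continuous linear functionals on S(Z^n); only the values on S(Z^n) matter *)
Definition temperedZ (u : (Zn n -> R[i]) -> R[i]) :=
  (forall (a : R[i]) f g, schwartzZ f -> schwartzZ g ->
    u (fun k => a * f k + g k) = a * u f + u g) /\
  (exists (N : nat) (C : R), forall f, schwartzZ f ->
    ((cmod (u f))%:E <= C%:E * seminormZ N f)%E).

Definition partials (s : seq 'I_n) (f : 'rV[R]_n -> R) : 'rV[R]_n -> R :=
  foldr (fun i g x => 'D_(delta_mx ord0 i) g x) f s.

Definition smooth (f : 'rV[R]_n -> R) :=
  forall s : seq 'I_n, continuous (partials s f) /\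
    forall x i, derivable (partials s f) x (delta_mx ord0 i).

Definition cpartials (s : seq 'I_n) (f : 'rV[R]_n -> R[i]) (x : 'rV[R]_n) :
    R[i] :=
  partials s (fun y => complex.Re (f y)) x +i* partials s (fun y => complex.Im (f y)) x.

Definition seminormZT (N : nat) (F : Zn n * torus R n -> R[i]) : \bar R :=
  ereal_sup [set r | exists (k : Zn n) (s : seq 'I_n) (x : 'rV[R]_n),
    (size s <= N)%N /\
    r = (weight k ^+ N * cmod (cpartials s (fun y => F (k, y)) x))%:E].

Definition schwartzZT (F : Zn n * torus R n -> R[i]) :=
  [/\ forall k (x : 'rV[R]_n) (i : 'I_n),
        F (k, x + delta_mx ord0 i) = F (k, x),
      forall k, smooth (fun x => complex.Re (F (k, x))),
      forall k, smooth (fun x => complex.Im (F (k, x))) &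
      forall N, (seminormZT N F < +oo)%E].

Definition temperedZT (u : (Zn n * torus R n -> R[i]) -> R[i]) :=
  (forall (a : R[i]) F G, schwartzZT F -> schwartzZT G ->
    u (fun x => a * F x + G x) = a * u F + u G) /\
  (exists (N : nat) (C : R), forall F, schwartzZT F ->
    ((cmod (u F))%:E <= C%:E * seminormZT N F)%E).

(* the function u(k) of which the distribution u on Z^n is the pairing
   f |-> \sum_k u(k) f(k) *)
Definition fun_of_dist (u : (Zn n -> R[i]) -> R[i]) (k : Zn n) : R[i] :=
  u (fun j => (j == k)%:R).

Definition representsZT (u : (Zn n * torus R n -> R[i]) -> R[i])
    (s : Zn n * torus R n -> R[i]) :=
  cmeasurable s /\
  forall F, schwartzZT F ->
    cintegrable (mu_phase R n) (fun x => s x * F x) /\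
    u F = cintegral (mu_phase R n) (fun x => s x * F x).

End tempered.

Section modulation.
Variables (R : realType) (n : nat).

Definition dot (k : Zn n) (w : torus R n) : R :=
  \sum_i (w : 'rV[R]_n) ord0 i *~ (k : 'rV[int]_n) ord0 i.

(* e^{2 pi i t} *)
Definition expi (t : R) : R[i] := cos (2 * pi * t) +i* sin (2 * pi * t).

Definition stft (g f : Zn n -> R[i]) (x : Zn n * torus R n) : R[i] :=
  cintegral (@countZ R n)
    (fun k => f k * (g (k - x.1))^* * expi (- dot k x.2)).

(* V_g u (m, w) = <u, M_w T_m g>, the pairing of a distribution with a test
   function being linear in both arguments *)
Definition dstft (g : Zn n -> R[i]) (u : (Zn n -> R[i]) -> R[i])
    (x : Zn n * torus R n) : R[i] :=
  u (fun k => (g (k - x.1))^* * expi (- dot k x.2)).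

Definition modnormZ (g : Zn n -> R[i]) (p : \bar R)
    (u : (Zn n -> R[i]) -> R[i]) : \bar R :=
  cLnorm (mu_phase R n) p (dstft g u).

Definition modspaceZ (g : Zn n -> R[i]) (p : \bar R)
    (u : (Zn n -> R[i]) -> R[i]) :=
  temperedZ u /\ in_Lp (mu_phase R n) p (dstft g u).

(* the variable is ((m, omega), (xi, k)) *)
Definition dstft2 (G : Zn n * torus R n -> R[i])
    (u : (Zn n * torus R n -> R[i]) -> R[i])
    (z : (Zn n * torus R n) * (torus R n * Zn n)) : R[i] :=
  u (fun y => expi (- dot y.1 z.2.1) * expi (- dot z.2.2 y.2) *
    (G (y.1 - z.1.1, y.2 - z.1.2))^*).

Definition modnormZT (G : Zn n * torus R n -> R[i]) (p : \bar R)
    (u : (Zn n * torus R n -> R[i]) -> R[i]) : \bar R :=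
  cLnorm (mu_phase2 R n) p (dstft2 G u).

Definition modspaceZT (G : Zn n * torus R n -> R[i]) (p : \bar R)
    (u : (Zn n * torus R n -> R[i]) -> R[i]) :=
  temperedZT u /\ in_Lp (mu_phase2 R n) p (dstft2 G u).

(* A modulation norm scales with its window: ||V_{c g} f|| = |c| ||V_g f||. A
   bound of a window-free quantity by ||.||_G ||.||_g ||.||_g therefore holds
   for all windows only with the factor 1 / (||g||_2^2 ||G||_2), which is 1 for
   windows of L^2-norm 1. *)
Definition window_const (g : Zn n -> R[i]) (G : Zn n * torus R n -> R[i]) : R :=
  (fine (cLnorm (@countZ R n) 2%:E g) ^+ 2 *
   fine (cLnorm (mu_phase R n) 2%:E G))^-1.

End modulation.

Section localization.
Variables (R : realType) (n : nat).

Definition norm2 (f : Zn n -> R[i]) : \bar R := cLnorm (@countZ R n) 2%:E f.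

Definition l2 (f : Zn n -> R[i]) := in_Lp (@countZ R n) 2%:E f.

Definition inner2 (f h : Zn n -> R[i]) : R[i] :=
  cintegral (@countZ R n) (fun k => f k * (h k)^*).

(* B(l^2(Z^n)); only the values on l^2(Z^n) matter *)
Definition bounded_on_l2 (A : (Zn n -> R[i]) -> (Zn n -> R[i])) :=
  [/\ forall f, l2 f -> l2 (A f),
      forall (a : R[i]) f g, l2 f -> l2 g ->
        A (fun k => a * f k + g k) = (fun k => a * A f k + A g k) &
      exists C : R, forall f, l2 f -> (norm2 (A f) <= C%:E * norm2 f)%E].

Definition opnorm2 (A : (Zn n -> R[i]) -> (Zn n -> R[i])) : \bar R :=
  ereal_sup [set norm2 (A f) | f in [set f | l2 f /\ (norm2 f <= 1)%E]].

Definition locop_integrand (s : Zn n * torus R n -> R[i])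
    (g1 g2 f : Zn n -> R[i]) (k : Zn n) (x : Zn n * torus R n) : R[i] :=
  s x * stft g1 f x * (expi (dot k x.2) * g2 (k - x.1)).

Definition locop (s : Zn n * torus R n -> R[i]) (g1 g2 f : Zn n -> R[i])
    (k : Zn n) : R[i] :=
  cintegral (mu_phase R n) (locop_integrand s g1 g2 f k).

Definition weak_locop_integrand (s : Zn n * torus R n -> R[i])
    (g1 g2 f h : Zn n -> R[i]) (x : Zn n * torus R n) : R[i] :=
  s x * stft g1 f x * (stft g2 h x)^*.

End localization.

(* Main.v *)
(** Idea.  Write [c(j,l) = sigma(delta_j e_l)].  Expanding the window [G] in its
    Fourier series turns [V_G sigma(m, w, xi, k)] into an absolutely convergent
    series in the orthonormal characters [e_{-j}(xi) e_{-l}(w)], with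
    coefficients [c(j,l) conj(G^(j - m, -l - k))].  Each coefficient is bounded
    by the L^1 norm of its series, so [c] is in l^p, hence in l^2, and every
    series is bounded by [L = ||c||_2 ||G||_2].  Parseval gives
    [L^2 = ||V_G sigma||_2^2 <= L^(2-p) ||V_G sigma||_p^p], that is
    [||c||_2 ||G||_2 <= ||V_G sigma||_p] for [1 <= p <= 2].  The same argument on
    [Z^n] with [p = 1] bounds [||g_i||_2 ||g||_2] by the M^1 norm of [g_i].  By
    Riesz-Fischer [sigma] is therefore a function [s] with [||s||_2 <= ||c||_2],
    and Young's inequality together with [||V_{g_1} f||_2 = ||g_1||_2 ||f||_2]
    shows that the localization operator is bounded on l^2 by
    [||s||_2 ||g_1||_2 ||g_2||_2]. *)

From HB Require Import structures.
Require Import Defs.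
From mathcomp Require Import all_boot all_order all_algebra.
From mathcomp Require Import complex.
From mathcomp Require Import all_classical all_reals all_analysis.
From mathcomp Require Import measurable_realfun.
From mathcomp Require Import zify ring lra.
Set Implicit Arguments.
Unset Strict Implicit.
Unset Printing Implicit Defensive.
Import Order.TTheory GRing.Theory Num.Theory.
Import numFieldNormedType.Exports.
Local Open Scope classical_set_scope.
Local Open Scope ring_scope.
Local Open Scope complex_scope.
Arguments cmod : simpl never.
Arguments cintegral : simpl never.

(** * Complex-valued integration *)

(** Two obstacles shape the proof. First, [sigma], [g1] and [g2] are abstract functionals, so
    expanding their transforms into series needs more than Parseval: Schwartz functions on Z^n x T^n
    have to be identified with rapidly decreasing families of Fourier coefficients, in both
    directions and with seminorm bounds. Decay comes from integration by parts and inversion from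
    Fejer kernels; a continuous functional is then determined by its values on point masses. Second,
    [L^2 <= L^(2-p) N^p] yields [L <= N] only once [L] is known to be finite, so a crude bound on
    [||c||_2] precedes the sharp one. The sharp inequality is proved once, for an abstract
    difference map on a discrete index set and a unimodular orthonormal system, and used on Z^n with
    exponent 1 and on Z^n x Z^n with exponent [p]. Each use leaves the L^2 norm of a window as a
    factor on the left; dividing by it once for [G] and twice for [g] produces exactly
    [window_const]. Uniqueness of the extension is density of finitely supported sequences in
    l^2. *)

Section cmod_theory.
Variable R : realType.
Implicit Types z w : R[i].

Local Notation Re := (@complex.Re R).
Local Notation Im := (@complex.Im R).

Lemma ReM z w : Re (z * w) = Re z * Re w - Im z * Im w.
Proof. by case: z w => [a b] [c d]. Qed.

Lemma ImM z w : Im (z * w) = Re z * Im w + Im z * Re w.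
Proof. by case: z w => [a b] [c d]. Qed.

Lemma ReD z w : Re (z + w) = Re z + Re w.
Proof. by case: z w => [a b] [c d]. Qed.

Lemma ImD z w : Im (z + w) = Im z + Im w.
Proof. by case: z w => [a b] [c d]. Qed.

Lemma ReN z : Re (- z) = - Re z.
Proof. by case: z. Qed.

Lemma ImN z : Im (- z) = - Im z.
Proof. by case: z. Qed.

Lemma Re_conj z : Re (z^*)%R = Re z.
Proof. by case: z. Qed.

Lemma Im_conj z : Im (z^*)%R = - Im z.
Proof. by case: z. Qed.

Definition complexE := (ReM, ImM, ReD, ImD, ReN, ImN, Re_conj, Im_conj).

Lemma complex_ext z w : Re z = Re w -> Im z = Im w -> z = w.
Proof. by case: z w => [a b] [c d] /= -> ->. Qed.

Lemma cmodE z : cmod z = Num.sqrt (Re z ^+ 2 + Im z ^+ 2).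
Proof. by case: z. Qed.

Lemma cmod_sqr z : cmod z ^+ 2 = Re z ^+ 2 + Im z ^+ 2.
Proof. by rewrite cmodE sqr_sqrtr// addr_ge0// sqr_ge0. Qed.

Lemma cmod_ge0 z : 0 <= cmod z.
Proof. by rewrite cmodE sqrtr_ge0. Qed.

Lemma cmod0 : cmod (0 : R[i]) = 0.
Proof. exact: ComplexField.Normc.normc0. Qed.

Lemma cmod1 : cmod (1 : R[i]) = 1.
Proof. exact: ComplexField.Normc.normc1. Qed.

Lemma cmodM z w : cmod (z * w) = cmod z * cmod w.
Proof. exact: ComplexField.Normc.normcM. Qed.

Lemma cmodN z : cmod (- z) = cmod z.
Proof. exact: normcN. Qed.

Lemma cmod_conj z : cmod (z^*)%R = cmod z.
Proof. by rewrite !cmodE Re_conj Im_conj sqrrN. Qed.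

Lemma cmodD z w : cmod (z + w) <= cmod z + cmod w.
Proof. exact: le_normcD. Qed.

Lemma cmodB z w : cmod (z - w) <= cmod z + cmod w.
Proof. by rewrite (le_trans (cmodD _ _))// cmodN. Qed.

Lemma cmodBC z w : cmod (z - w) = cmod (w - z).
Proof. by rewrite -cmodN opprB. Qed.

Lemma cmod_eq0 z : cmod z = 0 -> z = 0.
Proof. exact: ComplexField.Normc.eq0_normc. Qed.

Lemma cmod_gt0 z : z != 0 -> 0 < cmod z.
Proof.
move=> z0; rewrite lt_neqAle cmod_ge0 andbT eq_sym.
by apply: contra z0 => /eqP/cmod_eq0 ->.
Qed.

Lemma Re_le_cmod z : `|Re z| <= cmod z.
Proof.
rewrite -sqrtr_sqr cmodE; apply: ler_wsqrtr.
by rewrite lerDl sqr_ge0.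
Qed.

Lemma Im_le_cmod z : `|Im z| <= cmod z.
Proof.
rewrite -sqrtr_sqr cmodE; apply: ler_wsqrtr.
by rewrite lerDr sqr_ge0.
Qed.

Lemma cmod_real (r : R) : cmod r%:C = `|r|.
Proof. by rewrite cmodE /= expr0n addr0 sqrtr_sqr. Qed.

Lemma cmod_le z : cmod z <= `|Re z| + `|Im z|.
Proof.
have E : z = (Re z)%:C + (Im z)%:C * 'i%C.
  by apply: complex_ext; rewrite !complexE /=; ring.
rewrite {1}E (le_trans (cmodD _ _))// cmodM !cmod_real lerD2l.
by rewrite [cmod 'i%C]cmodE /= expr0n add0r expr1n sqrtr1 mulr1.
Qed.

Lemma mul_conj z : z * (z^*)%R = (cmod z ^+ 2)%:C.
Proof. by apply: complex_ext; rewrite ?cmod_sqr !complexE /=; ring. Qed.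

Lemma mul_conjC z : (z^*)%R * z = (cmod z ^+ 2)%:C.
Proof. by rewrite mulrC mul_conj. Qed.

End cmod_theory.

Section cmeasurable_theory.
Context d (T : measurableType d) (R : realType).
Implicit Types f g : T -> R[i].

Lemma cmeasurableD f g : cmeasurable f -> cmeasurable g ->
  cmeasurable (fun x => f x + g x).
Proof.
move=> [f1 f2] [g1 g2]; split.
  under eq_fun do rewrite ReD; exact: measurable_funD.
under eq_fun do rewrite ImD; exact: measurable_funD.
Qed.

Lemma cmeasurableM f g : cmeasurable f -> cmeasurable g ->
  cmeasurable (fun x => f x * g x).
Proof.
move=> [f1 f2] [g1 g2]; split.
  under eq_fun do rewrite ReM; apply: measurable_funB; exact: measurable_funM.
under eq_fun do rewrite ImM; apply: measurable_funD; exact: measurable_funM.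
Qed.

Lemma cmeasurableN f : cmeasurable f -> cmeasurable (fun x => - f x).
Proof.
move=> [f1 f2]; split.
  under eq_fun do rewrite ReN; exact: measurableT_comp.
under eq_fun do rewrite ImN; exact: measurableT_comp.
Qed.

Lemma cmeasurableB f g : cmeasurable f -> cmeasurable g ->
  cmeasurable (fun x => f x - g x).
Proof. by move=> mf mg; apply: cmeasurableD => //; exact: cmeasurableN. Qed.

Lemma cmeasurable_cst (c : R[i]) : cmeasurable (fun _ : T => c).
Proof. by split; exact: measurable_cst. Qed.

Lemma cmeasurable_conj f : cmeasurable f -> cmeasurable (fun x => (f x)^*%R).
Proof.
move=> [f1 f2]; split.
  under eq_fun do rewrite Re_conj; exact: f1.
under eq_fun do rewrite Im_conj; exact: measurableT_comp.
Qed.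

Lemma cmeasurable_real (h : T -> R) : measurable_fun setT h ->
  cmeasurable (fun x => (h x)%:C).
Proof. by move=> mh; split => //=; exact: measurable_cst. Qed.

Lemma cmeasurable_sum (I : Type) (r : seq I) (P : pred I) (F : I -> T -> R[i]) :
  (forall i, cmeasurable (F i)) ->
  cmeasurable (fun x => \sum_(i <- r | P i) F i x).
Proof.
move=> mF; elim: r => [|i r ih].
  by under eq_fun do rewrite big_nil; exact: cmeasurable_cst.
under eq_fun do rewrite big_cons; case: (P i) => //.
exact: cmeasurableD.
Qed.

Lemma measurable_cmod f : cmeasurable f -> measurable_fun setT (fun x => cmod (f x)).
Proof.
move=> [f1 f2]; under eq_fun do rewrite cmodE.
apply: (measurableT_comp (continuous_measurable_fun (@sqrt_continuous R))).
by apply: measurable_funD; exact: measurable_funX.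
Qed.

Lemma measurable_ecmod f : cmeasurable f ->
  measurable_fun setT (fun x => (cmod (f x))%:E).
Proof. by move=> mf; apply/measurable_EFinP; exact: measurable_cmod. Qed.

Lemma cmeasurable_lim (f_ : nat -> T -> R[i]) f :
  (forall k, cmeasurable (f_ k)) ->
  (forall x, cmod (f_ k x - f x) @[k --> \oo] --> (0 : R)) -> cmeasurable f.
Proof.
move=> mf cf.
(* Both components are additive and dominated by the modulus, so one argument gives convergence of
   the real and of the imaginary parts. *)
have H (p : R[i] -> R) : (forall z, `|p z| <= cmod z) ->
    (forall z w, p (z - w) = p z - p w) -> forall x, p (f_ k x) @[k --> \oo] --> p (f x).
  move=> p1 p2 x; apply/subr_cvg0; apply: norm_cvg0.
  apply: squeeze_cvgr (cf x); last exact: cvg_cst.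
  by apply: nearW => k; rewrite normr_ge0 -p2 p1.
split.
  apply: (@measurable_fun_cvg _ _ _ _ (fun k x => complex.Re (f_ k x))).
    by move=> m; case: (mf m).
  move=> x _; apply: H => [z|z w]; first exact: Re_le_cmod.
  by rewrite !complexE.
apply: (@measurable_fun_cvg _ _ _ _ (fun k x => complex.Im (f_ k x))).
  by move=> m; case: (mf m).
move=> x _; apply: H => [z|z w]; first exact: Im_le_cmod.
by rewrite !complexE.
Qed.

End cmeasurable_theory.

Lemma cmeasurable_comp d1 d2 (T1 : measurableType d1) (T2 : measurableType d2)
    (R : realType) (f : T2 -> R[i]) (h : T1 -> T2) :
  cmeasurable f -> measurable_fun setT h -> cmeasurable (f \o h).
Proof.
by move=> [f1 f2] mh; split; [exact: (measurableT_comp f1)|exact: (measurableT_comp f2)].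
Qed.

Section cintegral_theory.
Context d (T : measurableType d) (R : realType) (mu : {measure set T -> \bar R}).
Implicit Types f g : T -> R[i].

(** The modulus dominates both components and is at most the sum of their absolute values, so
    integrability can be tested on the modulus alone. *)
Lemma cintegrableP f :
  cintegrable mu f <-> cmeasurable f /\ (\int[mu]_x (cmod (f x))%:E < +oo)%E.
Proof.
split.
  move=> [/integrableP[/measurable_EFinP m1 i1] /integrableP[/measurable_EFinP m2 i2]].
  have mf : cmeasurable f by split.
  split=> //.
  apply: (@le_lt_trans _ _ (\int[mu]_x (`|(complex.Re (f x))%:E| + `|(complex.Im (f x))%:E|))%E).
    apply: ge0_le_integral => //.
    - by move=> x _; rewrite lee_fin cmod_ge0.
    - exact: measurable_ecmod.
    - by apply: emeasurable_funD; apply: measurableT_comp => //; exact/measurable_EFinP.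
    - by move=> x _; rewrite lee_fin cmod_le.
  rewrite ge0_integralD//; first exact: lte_add_pinfty.
    by apply: measurableT_comp => //; exact/measurable_EFinP.
  by apply: measurableT_comp => //; exact/measurable_EFinP.
move=> [mf fi].
have ci : mu.-integrable setT (fun x => (cmod (f x))%:E).
  apply/integrableP; split; first exact: measurable_ecmod.
  by under eq_integral do rewrite gee0_abs ?lee_fin ?cmod_ge0//.
case: mf => m1 m2; split.
  apply: le_integrable ci => //; first exact/measurable_EFinP.
  by move=> x _; rewrite !abse_EFin lee_fin [leRHS]ger0_norm ?cmod_ge0// Re_le_cmod.
apply: le_integrable ci => //; first exact/measurable_EFinP.
by move=> x _; rewrite !abse_EFin lee_fin [leRHS]ger0_norm ?cmod_ge0// Im_le_cmod.
Qed.

Lemma cintegrable_cmeasurable f : cintegrable mu f -> cmeasurable f.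
Proof. by case/cintegrableP. Qed.

Lemma cintegrable_cmod f : cintegrable mu f ->
  mu.-integrable setT (fun x => (cmod (f x))%:E).
Proof.
move=> /cintegrableP[mf fi]; apply/integrableP; split; first exact: measurable_ecmod.
by under eq_integral do rewrite gee0_abs ?lee_fin ?cmod_ge0//.
Qed.

Lemma le_cintegrable f (h : T -> R) : cmeasurable f ->
  (forall x, cmod (f x) <= h x) -> mu.-integrable setT (EFin \o h) ->
  cintegrable mu f.
Proof.
move=> mf fh /integrableP[mh ih]; apply/cintegrableP; split=> //.
apply: le_lt_trans ih; apply: ge0_le_integral => //.
- by move=> x _; rewrite lee_fin cmod_ge0.
- exact: measurable_ecmod.
- exact: measurableT_comp.
- by move=> x _; rewrite /= lee_fin (le_trans (fh x))// ler_norm.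
Qed.

Lemma cintegral_ext f g : (forall x, f x = g x) -> cintegral mu f = cintegral mu g.
Proof. by move=> fg; congr cintegral; exact/funext. Qed.

Lemma cintegrableD f g : cintegrable mu f -> cintegrable mu g ->
  cintegrable mu (fun x => f x + g x).
Proof.
move=> [f1 f2] [g1 g2]; split.
  under eq_fun do rewrite ReD EFinD; exact: integrableD.
under eq_fun do rewrite ImD EFinD; exact: integrableD.
Qed.

Lemma cintegralD f g : cintegrable mu f -> cintegrable mu g ->
  cintegral mu (fun x => f x + g x) = cintegral mu f + cintegral mu g.
Proof.
move=> [f1 f2] [g1 g2]; apply: complex_ext; rewrite /cintegral ?ReD ?ImD /=.
  by rewrite -RintegralD//; under eq_Rintegral do rewrite ReD.
by rewrite -RintegralD//; under eq_Rintegral do rewrite ImD.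
Qed.

Lemma cintegrableZ (c : R[i]) f : cintegrable mu f -> cintegrable mu (fun x => c * f x).
Proof.
move=> fi; apply: (@le_cintegrable _ (fun x => cmod c * cmod (f x))).
- apply: cmeasurableM; [exact: cmeasurable_cst|exact: cintegrable_cmeasurable].
- by move=> x; rewrite cmodM.
- by rewrite /comp; under eq_fun do rewrite EFinM; apply: integrableZl => //; exact: cintegrable_cmod.
Qed.

Lemma cintegralZ (c : R[i]) f : cintegrable mu f ->
  cintegral mu (fun x => c * f x) = c * cintegral mu f.
Proof.
move=> [f1 f2].
have Z (r : R) (h : T -> R) : mu.-integrable setT (fun x => (h x)%:E) ->
    mu.-integrable setT (fun x => (r * h x)%:E).
  by move=> hi; under eq_fun do rewrite EFinM; exact: integrableZl.
apply: complex_ext; rewrite /cintegral ?ReM ?ImM /=.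
  under eq_Rintegral do rewrite ReM.
  by rewrite RintegralB ?RintegralZl//; exact: Z.
under eq_Rintegral do rewrite ImM.
by rewrite RintegralD ?RintegralZl//; exact: Z.
Qed.

Lemma cintegrableN f : cintegrable mu f -> cintegrable mu (fun x => - f x).
Proof. by move=> fi; under eq_fun do rewrite -mulN1r; exact: cintegrableZ. Qed.

Lemma cintegralN f : cintegrable mu f ->
  cintegral mu (fun x => - f x) = - cintegral mu f.
Proof.
move=> fi; rewrite -mulN1r -cintegralZ//.
by apply: cintegral_ext => x; rewrite mulN1r.
Qed.

Lemma cintegrableB f g : cintegrable mu f -> cintegrable mu g ->
  cintegrable mu (fun x => f x - g x).
Proof. by move=> fi gi; apply: cintegrableD => //; exact: cintegrableN. Qed.

Lemma cintegralB f g : cintegrable mu f -> cintegrable mu g ->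
  cintegral mu (fun x => f x - g x) = cintegral mu f - cintegral mu g.
Proof.
by move=> fi gi; rewrite cintegralD ?cintegralN//; exact: cintegrableN.
Qed.

Lemma cintegrable0 : cintegrable mu (fun=> 0).
Proof. by split; exact: integrable0. Qed.

Lemma cintegral0 : cintegral mu (fun=> 0) = 0.
Proof.
by apply: complex_ext; rewrite /cintegral /= /Rintegral integral0.
Qed.

Lemma cintegrable_sum (I : Type) (r : seq I) (P : pred I) (F : I -> T -> R[i]) :
  (forall i, cintegrable mu (F i)) ->
  cintegrable mu (fun x => \sum_(i <- r | P i) F i x).
Proof.
move=> mF; elim: r => [|i r ih].
  by under eq_fun do rewrite big_nil; exact: cintegrable0.
under eq_fun do rewrite big_cons; case: (P i) => //.
exact: cintegrableD.
Qed.

Lemma cintegral_sum (I : Type) (r : seq I) (P : pred I) (F : I -> T -> R[i]) :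
  (forall i, cintegrable mu (F i)) ->
  cintegral mu (fun x => \sum_(i <- r | P i) F i x) =
  \sum_(i <- r | P i) cintegral mu (F i).
Proof.
move=> mF; elim: r => [|i r ih].
  by under cintegral_ext do rewrite big_nil; rewrite big_nil cintegral0.
under cintegral_ext do rewrite big_cons; rewrite big_cons; case: (P i) => //.
by rewrite cintegralD// ?ih//; exact: cintegrable_sum.
Qed.

Lemma cintegrable_conj f : cintegrable mu f -> cintegrable mu (fun x => (f x)^*%R).
Proof.
move=> /cintegrableP[mf fi]; apply/cintegrableP; split.
  exact: cmeasurable_conj.
by under eq_integral do rewrite cmod_conj.
Qed.

Lemma cintegral_conj f : cintegrable mu f ->
  cintegral mu (fun x => (f x)^*%R) = (cintegral mu f)^*%R.
Proof.
move=> [f1 f2]; apply: complex_ext; rewrite ?Re_conj ?Im_conj /cintegral /=.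
  by under eq_Rintegral do rewrite Re_conj.
under eq_Rintegral do rewrite Im_conj -mulN1r.
by rewrite RintegralZl// mulN1r.
Qed.

Lemma cintegral_real (h : T -> R) :
  cintegral mu (fun x => (h x)%:C) = (\int[mu]_x h x)%:C.
Proof. by apply: complex_ext; rewrite /cintegral //= /Rintegral integral0. Qed.

(* rotating the integral onto the positive axis *)
Lemma cmod_cintegral_le f : cintegrable mu f ->
  ((cmod (cintegral mu f))%:E <= \int[mu]_x (cmod (f x))%:E)%E.
Proof.
move=> fi; set z := cintegral mu f.
have ci := cintegrable_cmod fi.
have [z0|z0] := eqVneq (cmod z) 0.
  by rewrite z0 integral_ge0// => x _; rewrite lee_fin cmod_ge0.
have zp : 0 < cmod z by rewrite lt_neqAle eq_sym z0 cmod_ge0.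
suff H : cmod z <= \int[mu]_x cmod (f x).
  rewrite -[leRHS]fineK ?lee_fin//; exact: (@integrable_fin_num _ _ _ mu).
rewrite -(ler_pM2l zp) -expr2.
have -> : cmod z ^+ 2 = complex.Re (cintegral mu (fun x => (z^*)%R * f x)).
  by rewrite cintegralZ// -/z mul_conjC.
rewrite -RintegralZl//.
apply: le_Rintegral => //.
- by case: (cintegrableZ (z^*)%R fi).
- by rewrite /comp; under eq_fun do rewrite EFinM; exact: integrableZl.
- move=> x _; rewrite -(cmod_conj z) -cmodM.
  exact: le_trans (ler_norm _) (Re_le_cmod _).
Qed.

(** Convergence of complex values is expressed by [cmod] of a difference tending to 0. The real
    theorem is applied to [cmod (f_ k x - f x)], which is dominated by [2 * h x]. *)
Lemma cdominated (f_ : nat -> T -> R[i]) f (h : T -> R) :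
  (forall k, cmeasurable (f_ k)) ->
  (forall x, cmod (f_ k x - f x) @[k --> \oo] --> (0 : R)) ->
  (forall k x, cmod (f_ k x) <= h x) -> mu.-integrable setT (EFin \o h) ->
  cintegrable mu f /\
  cmod (cintegral mu (f_ k) - cintegral mu f) @[k --> \oo] --> (0 : R).
Proof.
move=> mf cf fh ih.
have mf0 := cmeasurable_lim mf cf.
(* The domination survives in the limit because [cmod (f x) <= h x + cmod (f_ k x - f x)] for every
   [k]. *)
have fh0 x : cmod (f x) <= h x.
  have lek k : cmod (f x) <= h x + cmod (f_ k x - f x).
    rewrite -lerBlDr; apply: le_trans (fh k x); rewrite lerBlDr.
    rewrite -[X in cmod X](subrK (f_ k x)) (le_trans (cmodD _ _))//.
    by rewrite addrC cmodBC.
  have : (h x + cmod (f_ k x - f x)) @[k --> \oo] --> h x + 0.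
    by apply: cvgD; [exact: cvg_cst|exact: cf].
  rewrite addr0 => hc; rewrite -(cvg_lim _ hc)//.
  by apply: limr_ge; [apply/cvg_ex; exists (h x)|exact: nearW].
have fi : cintegrable mu f by exact: le_cintegrable ih.
have fki k : cintegrable mu (f_ k) by exact: le_cintegrable ih.
split=> //.
have [] := @dominated_convergence _ _ _ mu setT measurableT
  (fun k x => (cmod (f_ k x - f x))%:E) (cst 0%E) (fun x => 2%:E * (h x)%:E)%E.
- by move=> k; apply: measurable_ecmod; exact: cmeasurableB.
- exact: measurable_cst.
- by apply: aeW => x _; apply: cvg_EFin; [exact: nearW|exact: cf].
- exact: integrableZl.
- apply: aeW => x k _; rewrite gee0_abs ?lee_fin ?cmod_ge0//.
  by rewrite (le_trans (cmodB _ _))// mulr_natl mulr2n lerD.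
move=> _ _; rewrite integral0 => /fine_cvg /= H.
apply: squeeze_cvgr H; last exact: cvg_cst.
apply: nearW => k; rewrite cmod_ge0 /= -cintegralB//.
have ki := cintegrableB (fki k) fi.
rewrite -lee_fin fineK; first exact: cmod_cintegral_le.
exact: (integrable_fin_num _ (cintegrable_cmod ki)).
Qed.

End cintegral_theory.

Lemma ae_eq_integrable d (T : measurableType d) (R : realType)
    (mu : {measure set T -> \bar R}) (f g : T -> \bar R) :
  measurable_fun setT g -> ae_eq mu setT f g -> mu.-integrable setT f ->
  mu.-integrable setT g.
Proof.
move=> mg fg /integrableP[mf fi]; apply/integrableP; split=> //.
rewrite -(@ae_eq_integral _ _ _ mu setT (abse \o g) (abse \o f))//.
- exact: measurableT_comp.
- exact: measurableT_comp.
- by apply: filterS fg => x /= E Dx; rewrite E.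
Qed.

(** * Fubini and Tonelli theorems for complex functions *)

Section fubini_complex.
Context d1 d2 (T1 : measurableType d1) (T2 : measurableType d2) (R : realType).
Variables (m1 : {sigma_finite_measure set T1 -> \bar R})
  (m2 : {sigma_finite_measure set T2 -> \bar R}).

Lemma measurable_Rintegral_fst (f : T1 * T2 -> R) : measurable_fun setT f ->
  measurable_fun setT (fun y => \int[m1]_x f (x, y)).
Proof.
move=> /measurable_EFinP mf; rewrite /Rintegral.
apply: (@measurableT_comp _ _ _ _ _ _ (@fine R)) => //.
rewrite (_ : (fun _ => _) = (fubini_G m1 (EFin \o f)^\+ \- fubini_G m1 (EFin \o f)^\-)%E).
  apply: emeasurable_funB; apply: measurable_fun_fubini_tonelli_G => //.
    exact: measurable_funepos.
  exact: measurable_funeneg.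
apply/funext => y; rewrite integralE; congr (_ - _)%E;
  by apply: eq_integral => x _; rewrite ?funeposE ?funenegE.
Qed.

Lemma measurable_Rintegral_snd (f : T1 * T2 -> R) : measurable_fun setT f ->
  measurable_fun setT (fun x => \int[m2]_y f (x, y)).
Proof.
move=> /measurable_EFinP mf; rewrite /Rintegral.
apply: (@measurableT_comp _ _ _ _ _ _ (@fine R)) => //.
rewrite (_ : (fun _ => _) = (fubini_F m2 (EFin \o f)^\+ \- fubini_F m2 (EFin \o f)^\-)%E).
  apply: emeasurable_funB; apply: measurable_fun_fubini_tonelli_F => //.
    exact: measurable_funepos.
  exact: measurable_funeneg.
apply/funext => y; rewrite integralE; congr (_ - _)%E;
  by apply: eq_integral => x _; rewrite ?funeposE ?funenegE.
Qed.

Lemma cmeasurable_cintegral_fst (f : T1 * T2 -> R[i]) : cmeasurable f ->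
  cmeasurable (fun y => cintegral m1 (fun x => f (x, y))).
Proof.
by move=> [f1 f2]; split; [exact: (measurable_Rintegral_fst f1)|exact: (measurable_Rintegral_fst f2)].
Qed.

Variable m : {measure set (T1 * T2) -> \bar R}.
Hypothesis mE : m = (m1 \x m2)%E :> (set (T1 * T2) -> \bar R).

Lemma tonelli12 (f : T1 * T2 -> \bar R) : measurable_fun setT f ->
  (forall z, (0 <= f z)%E) ->
  (\int[m]_z f z = \int[m1]_x \int[m2]_y f (x, y))%E.
Proof. by move=> mf f0; rewrite mE fubini_tonelli1. Qed.

Lemma tonelli21 (f : T1 * T2 -> \bar R) : measurable_fun setT f ->
  (forall z, (0 <= f z)%E) ->
  (\int[m]_z f z = \int[m2]_y \int[m1]_x f (x, y))%E.
Proof. by move=> mf f0; rewrite mE fubini_tonelli2. Qed.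

Lemma Rfubini12 (f : T1 * T2 -> R) : m.-integrable setT (EFin \o f) ->
  m1.-integrable setT (fun x => (\int[m2]_y f (x, y))%:E) /\
  \int[m]_z f z = \int[m1]_x \int[m2]_y f (x, y).
Proof.
rewrite mE => fi.
have mf : measurable_fun setT f by apply/measurable_EFinP; exact: measurable_int fi.
have Fi := integrable_fubini_F fi.
have mI : measurable_fun setT (fun x => (\int[m2]_y f (x, y))%:E).
  by apply/measurable_EFinP; exact: measurable_Rintegral_snd.
(* [Rintegral] turns an infinite inner integral into 0 through [fine]; for an integrable [f] this
   can happen only on a null set. *)
have aeF : ae_eq m1 setT (fubini_F m2 (EFin \o f)) (fun x => (\int[m2]_y f (x, y))%:E).
  have := integrable_ae measurableT Fi; apply: filterS => x /= /(_ Logic.I) Fx _.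
  by rewrite /Rintegral fineK.
split; first exact: (ae_eq_integrable mI aeF Fi).
rewrite [LHS]/Rintegral [in RHS]/Rintegral mE -(integral12_prod_meas1 fi).
by congr fine; apply: ae_eq_integral => //; exact: measurable_int Fi.
Qed.

Lemma Rfubini21 (f : T1 * T2 -> R) : m.-integrable setT (EFin \o f) ->
  m2.-integrable setT (fun y => (\int[m1]_x f (x, y))%:E) /\
  \int[m]_z f z = \int[m2]_y \int[m1]_x f (x, y).
Proof.
rewrite mE => fi.
have mf : measurable_fun setT f by apply/measurable_EFinP; exact: measurable_int fi.
have mI : measurable_fun setT (fun y => (\int[m1]_x f (x, y))%:E).
  by apply/measurable_EFinP; exact: measurable_Rintegral_fst.
have mG := measurable_fubini_G fi.
have aeF : ae_eq m2 setT (fubini_G m1 (EFin \o f)) (fun y => (\int[m1]_x f (x, y))%:E).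
  have := ae_integrable2 fi; apply: filterS => y /= fy _.
  by rewrite /Rintegral fineK//; exact: integrable_fin_num.
(* The inner integral is bounded in modulus by the inner integral of [|f|], which has a finite
   integral over [m2]. *)
have Gi : m2.-integrable setT (fubini_G m1 (EFin \o f)).
  apply/integrableP; split=> //.
  have /integrable21ltyP := fi; move=> /(_ (measurable_int _ fi)); apply: le_lt_trans.
  apply: ge0_le_integral => //.
  - exact: measurableT_comp.
  - apply: (measurable_fun_fubini_tonelli_G (abse \o (EFin \o f))) => //=.
    by apply: measurableT_comp => //; exact/measurable_EFinP.
  - move=> y _; apply: le_abse_integral => //.
    by apply/measurable_EFinP; exact: (measurableT_comp mf).
split; first exact: (ae_eq_integrable mI aeF Gi).
rewrite [LHS]/Rintegral [in RHS]/Rintegral mE -(integral21_prod_meas1 fi).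
by congr fine; apply: ae_eq_integral.
Qed.

Lemma cfubini12 (f : T1 * T2 -> R[i]) : cintegrable m f ->
  cintegral m f = cintegral m1 (fun x => cintegral m2 (fun y => f (x, y))).
Proof.
by move=> [f1 f2]; apply: complex_ext; rewrite /cintegral /=; [exact: (Rfubini12 f1).2|exact: (Rfubini12 f2).2].
Qed.

Lemma cfubini21 (f : T1 * T2 -> R[i]) : cintegrable m f ->
  cintegral m f = cintegral m2 (fun y => cintegral m1 (fun x => f (x, y))).
Proof.
by move=> [f1 f2]; apply: complex_ext; rewrite /cintegral /=; [exact: (Rfubini21 f1).2|exact: (Rfubini21 f2).2].
Qed.

Lemma cintegrable12 (f : T1 * T2 -> R[i]) : cmeasurable f ->
  (\int[m1]_x \int[m2]_y (cmod (f (x, y)))%:E < +oo)%E -> cintegrable m f.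
Proof.
move=> mf fi; apply/cintegrableP; split=> //.
by rewrite tonelli12//; [exact: measurable_ecmod|move=> z; rewrite lee_fin cmod_ge0].
Qed.

Lemma cintegrable21 (f : T1 * T2 -> R[i]) : cmeasurable f ->
  (\int[m2]_y \int[m1]_x (cmod (f (x, y)))%:E < +oo)%E -> cintegrable m f.
Proof.
move=> mf fi; apply/cintegrableP; split=> //.
by rewrite tonelli21//; [exact: measurable_ecmod|move=> z; rewrite lee_fin cmod_ge0].
Qed.

End fubini_complex.

Section cauchy_schwarz.
Context d (T : measurableType d) (R : realType) (mu : {measure set T -> \bar R}).

Lemma poweR2 (x : \bar R) : (0 <= x)%E -> (x `^ 2 = x ^+ 2)%E.
Proof.
case: x => [r||]//; first by rewrite lee_fin poweR_EFin => r0; rewrite powR_mulrn// EFin_expe.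
by rewrite poweRyr// expe2 mulyy.
Qed.

(** Hoelder's inequality with both exponents 2, squared so that no root of an extended real
    occurs. *)
Lemma cauchy_schwarz (f g : T -> R) :
  measurable_fun setT f -> measurable_fun setT g ->
  (forall x, 0 <= f x) -> (forall x, 0 <= g x) ->
  ((\int[mu]_x (f x * g x)%:E) ^+ 2 <=
   (\int[mu]_x (f x ^+ 2)%:E) * (\int[mu]_x (g x ^+ 2)%:E))%E.
Proof.
move=> mf mg f0 g0.
have two : (2^-1 + 2^-1 = 1 :> R) by lra.
have := hoelder mu mf mg (ltr0Sn _ 1) (ltr0Sn _ 1) two.
have N2 h : (forall x, 0 <= h x) -> ('N[mu]_2%:E[EFin \o h] ^+ 2 = \int[mu]_x (h x ^+ 2)%:E)%E.
  move=> h0; rewrite -poweR2 ?Lnorm_ge0// powR_Lnorm//.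
  by apply: eq_integral => x _; rewrite /= powR_mulrn// ger0_norm.
have -> : ('N[mu]_1[EFin \o (f \* g)%R] = \int[mu]_x (f x * g x)%:E)%E.
  by rewrite Lnorm1; apply: eq_integral => x _; rewrite /= ger0_norm// mulr_ge0.
rewrite -(N2 _ f0) -(N2 _ g0) !expe2 => H.
rewrite [leRHS]muleACA; apply: lee_pmul => //.
  by apply: integral_ge0 => x _; rewrite lee_fin mulr_ge0.
by apply: integral_ge0 => x _; rewrite lee_fin mulr_ge0.
Qed.

Lemma cLnorm_powR (p : R) (f : T -> R[i]) : 0 < p ->
  (cLnorm mu p%:E f `^ p = \int[mu]_x ((cmod (f x)) `^ p)%:E)%E.
Proof.
move=> p0; rewrite /cLnorm powR_Lnorm ?gt_eqF//.
by apply: eq_integral => x _; rewrite /= ger0_norm ?cmod_ge0.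
Qed.

Lemma cLnorm_sqr (f : T -> R[i]) :
  (cLnorm mu 2%:E f ^+ 2 = \int[mu]_x (cmod (f x) ^+ 2)%:E)%E.
Proof.
rewrite -poweR2 ?Lnorm_ge0// cLnorm_powR//.
by apply: eq_integral => x _; rewrite powR_mulrn ?cmod_ge0.
Qed.

Lemma cLnorm_ge0 p (f : T -> R[i]) : (0 <= cLnorm mu p f)%E.
Proof. exact: Lnorm_ge0. Qed.

End cauchy_schwarz.

(** * Discrete measures *)

Section discrete_measure.
Context d (I : measurableType d) (R : realType).

(** Counting measure on a countable set, described by properties that pass to products. The
    injective code supplies the exhaustion by the finite sets [code i < N] behind all truncation
    arguments. *)
Definition discrete (nu : {measure set I -> \bar R}) :=
  [/\ forall A : set I, measurable A, forall i, nu [set i] = 1%E &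
      exists code : I -> nat, injective code].

Variable nu : {measure set I -> \bar R}.
Hypothesis dnu : discrete nu.

Lemma discrete_measurable_fun d' (T : sigmaRingType d') (f : I -> T) D : measurable_fun D f.
Proof. by case: dnu => mI _ _ _ Y _; exact: mI. Qed.

Lemma discrete_cmeasurable (f : I -> R[i]) : cmeasurable f.
Proof. by split; exact: discrete_measurable_fun. Qed.

Lemma integral_point (F : I -> \bar R) (i : I) :
  (\int[nu]_(j in [set i]) F j = F i)%E.
Proof.
case: dnu => mI nu1 _.
rewrite (@eq_integral _ _ _ _ _ (cst (F i))); last by move=> j /set_mem ->.
by rewrite integral_cst// nu1 mule1.
Qed.

Lemma le_point_integral (F : I -> \bar R) (i : I) : (forall j, (0 <= F j)%E) ->
  (F i <= \int[nu]_j F j)%E.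
Proof.
case: dnu => mI _ _ F0; rewrite -(integral_point F i).
by apply: ge0_subset_integral => //; exact: discrete_measurable_fun.
Qed.

Lemma cintegrable_point (f : I -> R[i]) (i : I) :
  cintegrable nu (fun j => if j == i then f j else 0).
Proof.
case: dnu => mI _ _.
apply/cintegrableP; split; first exact: discrete_cmeasurable.
have := integral_point (fun j => (cmod (f j))%:E) i.
rewrite integral_mkcond => E.
rewrite (_ : (fun _ => _) = (fun j => (cmod (f j))%:E) \_ [set i]) ?E ?ltry//.
apply/funext => j; rewrite patchE; case: eqP => [->|ji]; first by rewrite mem_set.
by rewrite memNset// cmod0.
Qed.

Lemma cintegral_point (f : I -> R[i]) (i : I) :
  cintegral nu (fun j => if j == i then f j else 0) = f i.
Proof.
have P (h : I -> R) : \int[nu]_j (if j == i then h j else 0) = h i.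
  rewrite /Rintegral -[RHS]/(fine (h i)%:E) -(integral_point (fun j => (h j)%:E) i).
  rewrite [in RHS]integral_mkcond; congr fine; apply: eq_integral => j _.
  by rewrite patchE; case: eqP => [->|ji]; [rewrite mem_set|rewrite memNset].
apply: complex_ext; rewrite /cintegral /=.
  by rewrite -(P (fun j => complex.Re (f j))); apply: eq_Rintegral => j _; case: eqP.
by rewrite -(P (fun j => complex.Im (f j))); apply: eq_Rintegral => j _; case: eqP.
Qed.

Variable code : I -> nat.
Hypothesis code_inj : injective code.

Definition below (N : nat) : set I := [set i | (code i < N)%N].

(** Dominated convergence: every point leaves the tail as soon as [N] exceeds its code. *)
Lemma integral_tail (F : I -> R) : (forall i, 0 <= F i) ->
  (\int[nu]_i (F i)%:E < +oo)%E ->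
  (\int[nu]_i (if (code i < N)%N then 0 else F i)%:E)%E @[N --> \oo] --> 0%E.
Proof.
move=> F0 Fi.
have ci : nu.-integrable setT (EFin \o F).
  apply/integrableP; split; first exact: discrete_measurable_fun.
  by under eq_integral do rewrite /= ger0_norm//.
have [] := @dominated_convergence _ _ _ nu setT measurableT
  (fun N i => (if (code i < N)%N then 0 else F i)%:E) (cst 0%E) (EFin \o F).
- by move=> N; exact: discrete_measurable_fun.
- exact: measurable_cst.
- apply: aeW => i _; apply: cvg_near_cst; exists (code i).+1 => // N /= iN.
  by rewrite iN.
- exact: ci.
- by apply: aeW => i N _; rewrite abse_EFin lee_fin; case: ifP; rewrite ?normr0 ?ger0_norm.
by move=> _ _; rewrite integral0.
Qed.

(** As [code] is injective, raising [N] by one adds at most one point, and functions supported at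
    one point are integrable. *)
Lemma cintegrable_trunc (f : I -> R[i]) N :
  cintegrable nu (fun i => if (code i < N)%N then f i else 0).
Proof.
case: dnu => mI nu1 _.
elim: N => [|N ih]; first exact: cintegrable0.
have [[i iN]|no] := pselect (exists i, code i = N); last first.
  rewrite (_ : (fun _ => _) = (fun j => if (code j < N)%N then f j else 0))//.
  apply/funext => j; rewrite ltnS leq_eqVlt; case: eqP => [jN|//].
  by exfalso; apply: no; exists j.
rewrite (_ : (fun _ => _) = (fun j => (if (code j < N)%N then f j else 0) +
    (if j == i then f j else 0))); last first.
  apply/funext => j; rewrite ltnS leq_eqVlt -iN (inj_eq code_inj).
  by case: eqP => [->|_] /=; rewrite ?ltnn ?add0r ?addr0.
by apply: cintegrableD => //; exact: cintegrable_point.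
Qed.

Lemma cintegral_trunc_cvg (f : I -> R[i]) : cintegrable nu f ->
  cmod (cintegral nu (fun i => if (code i < N)%N then f i else 0) -
        cintegral nu f) @[N --> \oo] --> (0 : R).
Proof.
move=> fi.
have [||||//] := @cdominated _ _ _ nu (fun N i => if (code i < N)%N then f i else 0) f
  (fun i => cmod (f i)); first by move=> k; exact: discrete_cmeasurable.
- move=> i; apply: cvg_near_cst; exists (code i).+1 => // N /= iN.
  by rewrite iN subrr cmod0.
- by move=> N i /=; case: ifP; rewrite ?cmod0 ?cmod_ge0.
- exact: cintegrable_cmod.
Qed.

End discrete_measure.

(** Slicing by the code of the first coordinate makes [A] a countable union of rectangles, each a
    point times a section. Measurability over a discrete factor is thus checked row by row. *)
Lemma discrete_prod_measurable d1 d2 (I : measurableType d1) (T : measurableType d2)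
    (R : realType) (nu : {measure set I -> \bar R}) (A : set (I * T)) :
  discrete nu -> (forall i, measurable (xsection A i)) -> measurable A.
Proof.
move=> [mI _ [code code_inj]] mA.
rewrite (_ : A = \bigcup_n [set z | code z.1 = n /\ A z]); last first.
  by apply/seteqP; split=> [z Az|z [n _ []]//]; exists (code z.1).
apply: bigcupT_measurable => n.
have [[i iN]|no] := pselect (exists i, code i = n); last first.
  by rewrite (_ : [set z | _] = set0)// -subset0 => z [zn _]; apply: no; exists z.1.
rewrite (_ : [set z | _] = [set i] `*` xsection A i); first exact: measurableX.
apply/seteqP; split=> [[j t] /= [jn Az]|[j t] /= [-> At]].
  have ji : j = i by apply: code_inj; rewrite jn.
  by split=> //; rewrite /xsection/= -ji; exact: mem_set.
by split=> //; exact: set_mem At.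
Qed.

Section discrete_prod.
Context d1 d2 (I : measurableType d1) (T : measurableType d2) (R : realType).
Variable nu : {measure set I -> \bar R}.
Hypothesis dnu : discrete nu.

Lemma measurable_fun_discrete_prod d' (U : measurableType d') (f : I * T -> U) :
  (forall i, measurable_fun setT (fun t => f (i, t))) -> measurable_fun setT f.
Proof.
move=> mf _ Y mY; rewrite setTI; apply: (discrete_prod_measurable dnu) => i.
rewrite (_ : xsection _ i = (fun t => f (i, t)) @^-1` Y).
  by rewrite -[X in measurable X]setTI; exact: mf.
by apply/seteqP; split=> t; rewrite /xsection /=; [move/set_mem|move=> ?; exact/mem_set].
Qed.

Lemma cmeasurable_discrete_prod (f : I * T -> R[i]) :
  (forall i, cmeasurable (fun t => f (i, t))) -> cmeasurable f.
Proof. by move=> mf; split; apply: measurable_fun_discrete_prod => i; case: (mf i). Qed.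

End discrete_prod.

Lemma discrete_product d1 d2 (I : measurableType d1) (J : measurableType d2) (R : realType)
  (nu1 : {measure set I -> \bar R}) (nu2 : {sigma_finite_measure set J -> \bar R})
  (m : {measure set (I * J) -> \bar R}) :
  discrete nu1 -> discrete nu2 -> m = (nu1 \x nu2)%E :> (set _ -> \bar R) ->
  discrete m.
Proof.
move=> dI dJ mE; case: (dI) (dJ) => mI n1 [c1 i1] [mJ n2 [c2 i2]]; split.
- by move=> A; apply: (discrete_prod_measurable dI) => i; exact: mJ.
- move=> [i j]; rewrite mE (_ : [set (i, j)] = [set i] `*` [set j]).
    by rewrite product_measure1E// n1 n2 mule1.
  by apply/seteqP; split=> [[x y] /= [-> ->]//|[x y] /= [-> ->]].
- exists (fun z => pickle (c1 z.1, c2 z.2)) => -[a b] [a' b'] /=.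
  by move=> /(pcan_inj pickleK)[/i1 -> /i2 ->].
Qed.

Lemma discrete_countZ (R : realType) n : discrete (@countZ R n).
Proof.
split=> [A|i|]; first by [].
  by rewrite [LHS]/(counting _) /counting asboolT// fset_set1 finmap.cardfs1.
by exists pickle; exact: (pcan_inj pickleK).
Qed.

(** Counting measure is its own image under a bijection. All translations and reflections of sums
    over Z^n rest on this change of variables. *)
Lemma integral_countZ_bij (R : realType) n (f g : Zn n -> Zn n) (F : Zn n -> \bar R) :
  cancel f g -> cancel g f -> (forall k, 0 <= F k)%E ->
  (\int[@countZ R n]_k F (f k) = \int[@countZ R n]_k F k)%E.
Proof.
move=> fK gK F0.
have mf : measurable_fun setT f by [].
have mF : measurable_fun setT F by [].
have := @ge0_integral_pushforward _ _ _ _ R f mf (@countZ R n) setT F measurableT mF.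
rewrite preimage_setT => <-; last by move=> k _; exact: F0.
apply: eq_measure_integral => A _ _.
have E : f @^-1` A = g @` A.
  apply/seteqP; split=> [k /= Ak|k /= [a Aa <-]]; first by exists (f k).
  by rewrite gK.
rewrite [LHS]/(counting (f @^-1` A)) [RHS]/(counting A) /counting E.
have [fA|nfA] := pselect (finite_set A).
  rewrite !asboolT//; last exact: finite_image.
  by rewrite fset_set_image// finmap.card_imfset//=; exact: can_inj gK.
rewrite !asboolF// => fgA; apply: nfA.
rewrite (_ : A = f @` (g @` A)); first exact: finite_image.
by rewrite image_comp; apply/seteqP; split=> [k Ak|k [a Aa <-]] /=; rewrite ?gK//; exists k; rewrite //= gK.
Qed.

Lemma integral_prob_cst d (T : measurableType d) (R : realType)
    (P : probability T R) (M : \bar R) : (\int[P]_t cst M t = M)%E.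
Proof.
rewrite integral_cst// [X in (_ * X)%E](_ : _ = 1%E) ?mule1//.
exact: probability_setT.
Qed.

Lemma cintegral_ae d (T : measurableType d) (R : realType)
    (mu : {measure set T -> \bar R}) (f g : T -> R[i]) :
  cmeasurable f -> cmeasurable g -> {ae mu, forall x, f x = g x} ->
  cintegral mu f = cintegral mu g.
Proof.
move=> [f1 f2] [g1 g2] fg; apply: complex_ext; rewrite /cintegral /= /Rintegral;
  congr fine; apply: ae_eq_integral => //;
  by [apply/measurable_EFinP|apply: filterS fg => x /= -> _].
Qed.

(** * Orthonormal systems and Lieb-type inequality *)

Section orthonormal_system.
Context d1 d2 (I : measurableType d1) (Theta : measurableType d2) (R : realType).
Variables (nu : {sigma_finite_measure set I -> \bar R}) (P : probability Theta R).
Hypothesis dnu : discrete nu.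
Variable chi : I -> Theta -> R[i].

(** Besides orthonormality every member has modulus 1, as characters do. This bounds a series by the
    l^1 norm of its coefficients and a coefficient by the L^1 norm of its series. *)
Definition orthonormal_system := [/\ forall i, cmeasurable (chi i),
  forall i t, cmod (chi i t) = 1 &
  forall i j, cintegral P (fun t => chi i t * (chi j t)^*%R) = (i == j)%:R].

Hypothesis chiP : orthonormal_system.

Definition synthesis (b : I -> R[i]) (t : Theta) : R[i] :=
  cintegral nu (fun i => b i * chi i t).

Lemma cmeasurable_synthesis_term (b : I -> R[i]) :
  cmeasurable (fun z : I * Theta => b z.1 * chi z.1 z.2).
Proof.
case: chiP => mchi _ _; apply: (cmeasurable_discrete_prod dnu) => i /=.
by apply: cmeasurableM; [exact: cmeasurable_cst|exact: mchi].
Qed.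

Lemma cmeasurable_synthesis b : cmeasurable (synthesis b).
Proof. exact: (cmeasurable_cintegral_fst nu (cmeasurable_synthesis_term b)). Qed.

Lemma cintegrable_synthesis_term (b : I -> R[i]) t : cintegrable nu b ->
  cintegrable nu (fun i => b i * chi i t).
Proof.
case: chiP => _ chi1 _ /cintegrableP[mb bi]; apply/cintegrableP; split.
  exact: (discrete_cmeasurable dnu).
by under eq_integral do rewrite cmodM chi1 mulr1.
Qed.

Lemma cmod_synthesis_le b t : cintegrable nu b ->
  ((cmod (synthesis b t))%:E <= \int[nu]_i (cmod (b i))%:E)%E.
Proof.
move=> bi; case: chiP => _ chi1 _.
rewrite (le_trans (cmod_cintegral_le (cintegrable_synthesis_term t bi)))//.
by under eq_integral do rewrite cmodM chi1 mulr1.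
Qed.

Lemma synthesisB b c t : cintegrable nu b -> cintegrable nu c ->
  synthesis (fun i => b i - c i) t = synthesis b t - synthesis c t.
Proof.
move=> bi ci; rewrite /synthesis -cintegralB; try exact: cintegrable_synthesis_term.
by apply: cintegral_ext => i; rewrite mulrBl.
Qed.

Lemma cintegrable_bounded (f : Theta -> R[i]) (M : \bar R) : cmeasurable f ->
  (forall t, ((cmod (f t))%:E <= M)%E) -> (M < +oo)%E -> cintegrable P f.
Proof.
move=> mf fM Moo; apply/cintegrableP; split=> //.
apply: (@le_lt_trans _ _ (\int[P]_t cst M t)%E).
  apply: ge0_le_integral => //; [|exact: measurable_ecmod].
  by move=> t _; rewrite lee_fin cmod_ge0.
by rewrite integral_prob_cst.
Qed.

(* Fubini on I x Theta, where the integrand has modulus |b| |f| *)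
Lemma synthesis_pairing b (f : Theta -> R[i]) : cintegrable nu b -> cintegrable P f ->
  cintegral P (fun t => synthesis b t * f t) =
  cintegral nu (fun i => b i * cintegral P (fun t => chi i t * f t)).
Proof.
move=> bi fi; case: (chiP) => mchi chi1 _; have mf := cintegrable_cmeasurable fi.
pose F (z : I * Theta) := b z.1 * chi z.1 z.2 * f z.2.
have mF : cmeasurable F.
  apply: cmeasurableM; first exact: cmeasurable_synthesis_term.
  by apply: (cmeasurable_comp mf); exact: measurable_snd.

have Fi : cintegrable (nu \x P)%E F.
  apply: (@cintegrable12 _ _ _ _ _ nu P) => //.
  apply: (@le_lt_trans _ _ (\int[nu]_i ((cmod (b i))%:E * \int[P]_t (cmod (f t))%:E))%E).
    apply: ge0_le_integral => //.
    - by move=> i _; apply: integral_ge0 => t _; rewrite lee_fin cmod_ge0.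
    - exact: (discrete_measurable_fun dnu).
    - exact: (discrete_measurable_fun dnu).
    move=> i _; rewrite -ge0_integralZl//.
    - apply: ge0_le_integral => //.
      + by move=> t _; rewrite lee_fin cmod_ge0.
      + apply: measurable_ecmod; apply: cmeasurableM => //.
        by apply: (@cmeasurableM _ _ _ (fun=> b i) (chi i)) => //; exact: cmeasurable_cst.
      + by apply: measurable_funeM; exact: measurable_ecmod.
      + by move=> t _; rewrite -EFinM lee_fin /F /= !cmodM chi1 mulr1.
    - exact: measurable_ecmod.
    - by move=> t _; rewrite lee_fin cmod_ge0.
    - by rewrite lee_fin cmod_ge0.
  case/cintegrableP : (bi) => _ bioo; case/cintegrableP: (fi) => _ fioo.
  rewrite ge0_integralZr//.
  - by apply: lte_mul_pinfty => //;
      [apply: integral_ge0 => i _; rewrite lee_fin cmod_ge0|rewrite ge0_fin_numE//;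
       apply: integral_ge0 => i _; rewrite lee_fin cmod_ge0].
  - exact: (discrete_measurable_fun dnu).
  - by move=> i _; rewrite lee_fin cmod_ge0.
  - by apply: integral_ge0 => t _; rewrite lee_fin cmod_ge0.
have L := @cfubini21 _ _ _ _ _ nu P (nu \x P)%E erefl F Fi.
have L' := @cfubini12 _ _ _ _ _ nu P (nu \x P)%E erefl F Fi.
transitivity (cintegral P (fun t => cintegral nu (fun i => F (i, t)))).
  apply: cintegral_ext => t; rewrite mulrC -cintegralZ; last exact: cintegrable_synthesis_term.
  by apply: cintegral_ext => i; rewrite /F /= mulrC.
rewrite -L L'; apply: cintegral_ext => i.
rewrite -cintegralZ; last first.
  apply: (le_cintegrable _ _ (cintegrable_cmod fi)); first exact: cmeasurableM.
  by move=> t; rewrite cmodM chi1 mul1r.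
by apply: cintegral_ext => t; rewrite /F /= mulrA.
Qed.

Lemma synthesis_coef b j : cintegrable nu b ->
  cintegral P (fun t => synthesis b t * (chi j t)^*%R) = b j.
Proof.
move=> bi; case: (chiP) => mchi chi1 orth.
rewrite synthesis_pairing//; last first.
  apply: (@cintegrable_bounded _ 1%:E); rewrite ?ltry//; first exact: cmeasurable_conj.
  by move=> t; rewrite cmod_conj chi1.
rewrite -(cintegral_point dnu b j); apply: cintegral_ext => i.
by rewrite orth; case: eqP; rewrite ?mulr1 ?mulr0.
Qed.

Lemma synthesis_bound b : cintegrable nu b -> exists2 M : \bar R, (M < +oo)%E &
  forall t, ((cmod (synthesis b t))%:E <= M)%E.
Proof.
move=> bi; exists (\int[nu]_i (cmod (b i))%:E)%E; first by case/cintegrableP: bi.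
by move=> t; exact: cmod_synthesis_le.
Qed.

(** The series is paired with its own conjugate, whose integrals against [chi i] are the conjugates
    of [b i]. This is an identity of real integrals; it lifts to extended reals because both sides
    are finite. *)
Lemma parseval_synthesis b : cintegrable nu b ->
  (\int[P]_t (cmod (synthesis b t) ^+ 2)%:E = \int[nu]_i (cmod (b i) ^+ 2)%:E)%E.
Proof.
move=> bi; have [M Moo bM] := synthesis_bound bi.
case: (chiP) => mchi chi1 orth.
have ms := cmeasurable_synthesis b.
have msq : cmeasurable (fun t => synthesis b t * (synthesis b t)^*%R).
  by apply: cmeasurableM => //; exact: cmeasurable_conj.
have cs i : cintegral P (fun t => chi i t * (synthesis b t)^*%R) = (b i)^*%R.
  rewrite -(synthesis_coef i bi) -cintegral_conj; last first.
    apply: (cintegrable_bounded _ _ Moo).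
      by apply: cmeasurableM => //; exact: cmeasurable_conj.
    by move=> t; rewrite cmodM cmod_conj chi1 mulr1.
  by apply: cintegral_ext => t; rewrite rmorphM /= conjCK mulrC.
have si : cintegrable P (fun t => (synthesis b t)^*%R).
  apply: (cintegrable_bounded _ _ Moo); first exact: cmeasurable_conj.
  by move=> t; rewrite cmod_conj.
have := synthesis_pairing bi si.
under [X in _ = X]cintegral_ext do rewrite cs mul_conj.
under [X in X = _]cintegral_ext do rewrite mul_conj.
rewrite !cintegral_real => H.
have {}H : \int[P]_t (cmod (synthesis b t) ^+ 2) = \int[nu]_i (cmod (b i) ^+ 2).
  exact: (congr1 (@complex.Re R) H).
have Mf : M \is a fin_num.
  have [//|] := boolP (M \is a fin_num); rewrite ge0_fin_numE ?Moo//.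
  by apply: le_trans (bM point); rewrite lee_fin cmod_ge0.
have sqi : cintegrable P (fun t => synthesis b t * (synthesis b t)^*%R).
  apply: (@cintegrable_bounded _ (M * M)%E) => //.
    move=> t; rewrite cmodM cmod_conj EFinM; apply: lee_pmul => //;
    by rewrite lee_fin cmod_ge0.
  by rewrite -(fineK Mf) -EFinM ltry.
(* Each [b i] is the integral of the series against a unimodular function, hence bounded by [M], and
   [|b|^2 <= M |b|] is summable. *)
have bsq : cintegrable nu (fun i => b i * (b i)^*%R).
  apply: (@le_cintegrable _ _ _ _ _ (fun i => fine M * cmod (b i))).
  - exact: (discrete_cmeasurable dnu).
  - move=> i; rewrite cmodM cmod_conj ler_wpM2r ?cmod_ge0//.
    rewrite -lee_fin fineK// -(synthesis_coef i bi).
    apply: (le_trans (cmod_cintegral_le _)).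
      apply: (cintegrable_bounded _ _ Moo).
        by apply: cmeasurableM => //; exact: cmeasurable_conj.
      by move=> t; rewrite cmodM cmod_conj chi1 mulr1.
    apply: (@le_trans _ _ (\int[P]_t cst M t)%E).
      apply: ge0_le_integral => //.
      + by move=> t _; rewrite lee_fin cmod_ge0.
      + by apply: measurable_ecmod; apply: cmeasurableM => //; exact: cmeasurable_conj.
      + by move=> t _; rewrite cmodM cmod_conj chi1 mulr1.
    by rewrite integral_prob_cst.
  - rewrite /comp; under eq_fun do rewrite EFinM.
    by apply: integrableZl => //; exact: cintegrable_cmod.
have e1 : (\int[P]_t (cmod (synthesis b t) ^+ 2)%:E)%E \is a fin_num.
  have /= := integrable_fin_num measurableT (cintegrable_cmod sqi).
  by under eq_integral do rewrite cmodM cmod_conj -expr2.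
have e2 : (\int[nu]_i (cmod (b i) ^+ 2)%:E)%E \is a fin_num.
  have /= := integrable_fin_num measurableT (cintegrable_cmod bsq).
  by under eq_integral do rewrite cmodM cmod_conj -expr2.
by rewrite -(fineK e1) -(fineK e2); congr EFin.
Qed.

End orthonormal_system.

(** Hoelder's inequality against the constant 1, which has norm 1 on a probability space. The case
    [p = 1] is separate since [1 - p^-1] is then 0. *)
Lemma jensen_powR d (T : measurableType d) (R : realType) (P : probability T R)
    (f : T -> R) (p : R) : 1 <= p -> measurable_fun setT f -> (forall t, 0 <= f t) ->
  ((\int[P]_t (f t)%:E) `^ p <= \int[P]_t ((f t) `^ p)%:E)%E.
Proof.
move=> p1 mf f0.
have p0 : 0 < p by exact: lt_le_trans p1.
have [->|pn1] := eqVneq p 1.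
  rewrite poweRe1; last by apply: integral_ge0 => t _; rewrite lee_fin.
  by under [in leRHS]eq_integral do rewrite powRr1//.
have {p1 pn1}p1 : 1 < p by rewrite lt_neqAle eq_sym pn1.
have q0 : 0 < (1 - p^-1)^-1 by rewrite invr_gt0 subr_gt0 invf_lt1.
have := hoelder P mf (measurable_cst (1 : R)) p0 q0.
rewrite invrK addrC subrK => /(_ erefl).
rewrite (_ : 'N[P]_(((1 - p^-1)^-1)%:E)[EFin \o cst 1%R] = 1)%E; last first.
  rewrite -[RHS](poweR1r (((1 - p^-1)^-1)^-1)) -[X in _ = (X `^ _)%E](probability_setT P).
  exact: (Lnorm_cst1 P).
rewrite mule1 => H.
rewrite (_ : (\int[P]_t (f t `^ p)%:E)%E = ('N[P]_p%:E[EFin \o f] `^ p)%E); last first.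
  rewrite powR_Lnorm ?gt_eqF//; apply: eq_integral => t _ /=.
  by rewrite ger0_norm.
apply: (gt0_ler_poweR (ltW p0)); rewrite ?in_itv/= ?leey ?andbT//.
- by apply: integral_ge0 => t _; rewrite lee_fin.
- exact: Lnorm_ge0.
- apply: le_trans H; rewrite Lnorm1; apply: ge0_le_integral => //.
  + by move=> t _; rewrite lee_fin.
  + exact/measurable_EFinP.
  + apply: measurableT_comp => //; apply/measurable_EFinP.
    by apply: measurable_funM => //; exact: measurable_cst.
  + by move=> t _; rewrite lee_fin /= mulr1 ler_norm.
Qed.

Section lieb.
Context d1 d2 (I : measurableType d1) (Theta : measurableType d2) (R : realType).
Variables (nu : {sigma_finite_measure set I -> \bar R}) (P : probability Theta R).
Hypothesis dnu : discrete nu.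
Variable chi : I -> Theta -> R[i].
Hypothesis chiP : orthonormal_system P chi.
(* [tau i j] is the difference [i - j] of a discrete group *)
Variable tau : I -> I -> I.
Hypothesis tauK : forall i j, tau i (tau i j) = j.
Hypothesis tau_l : forall i (F : I -> \bar R), (forall j, 0 <= F j)%E ->
  (\int[nu]_j F (tau i j) = \int[nu]_j F j)%E.
Hypothesis tau_r : forall j (F : I -> \bar R), (forall i, 0 <= F i)%E ->
  (\int[nu]_i F (tau i j) = \int[nu]_i F i)%E.

Variables (c a : I -> R[i]) (p N : R).
Hypothesis p12 : 1 <= p <= 2.
Hypothesis N0 : 0 <= N.
(** These are the coefficients of the transform at the discrete point [x]: coefficient of the
    distribution times shifted coefficient of the window. *)
Let b x i := c i * a (tau i x).
Hypothesis bi : forall x, (\int[nu]_i (cmod (b x i))%:E < +oo)%E.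
Hypothesis a2 : (\int[nu]_i (cmod (a i) ^+ 2)%:E < +oo)%E.
Hypothesis a_neq0 : exists i, a i != 0.
Hypothesis hN : (\int[nu]_x \int[P]_t (cmod (synthesis nu chi (b x) t) `^ p)%:E <= (N `^ p)%:E)%E.

Let p0 : 0 < p. Proof. by case/andP : p12 => h _; exact: lt_le_trans h. Qed.

Let ms x := cmeasurable_synthesis dnu chiP (b x).

Let bint x : cintegrable nu (b x).
Proof. by apply/cintegrableP; split; [exact: (discrete_cmeasurable dnu)|exact: bi]. Qed.

Let psi x := (\int[P]_t (cmod (synthesis nu chi (b x) t) `^ p)%:E)%E.

Let psi0 x : (0 <= psi x)%E.
Proof. by apply: integral_ge0 => t _; rewrite lee_fin powR_ge0. Qed.

(** At [x = tau i i0] the coefficient with index [i] is [c i * a i0]. It is at most the L^1 norm of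
    the series, and Jensen's inequality passes to the [p]-th power. *)
Let coef_le i i0 : (((cmod (c i) * cmod (a i0)) `^ p)%:E <= psi (tau i i0))%E.
Proof.
case: (chiP) => mchi chi1 _.
have m1 : cmeasurable (fun t => synthesis nu chi (b (tau i i0)) t * (chi i t)^*%R).
  by apply: cmeasurableM; [exact: ms|exact: cmeasurable_conj].
have [M Moo bM] := synthesis_bound dnu chiP (bint (tau i i0)).
have : ((cmod (c i) * cmod (a i0))%:E <=
    \int[P]_t (cmod (synthesis nu chi (b (tau i i0)) t))%:E)%E.
  have -> : cmod (c i) * cmod (a i0) = cmod (b (tau i i0) i) by rewrite /b cmodM tauK.
  rewrite -(synthesis_coef dnu chiP i (bint _)).
  apply: (le_trans (cmod_cintegral_le _)).
    apply: (cintegrable_bounded _ m1 _ Moo).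
    by move=> t; rewrite cmodM cmod_conj chi1 mulr1.
  apply: ge0_le_integral => //.
  - by move=> t _; rewrite lee_fin cmod_ge0.
  - exact: measurable_ecmod.
  - exact: measurable_ecmod.
  - by move=> t _; rewrite cmodM cmod_conj chi1 mulr1.
move=> H; apply: (@le_trans _ _ ((\int[P]_t (cmod (synthesis nu chi (b (tau i i0)) t))%:E) `^ p)%E).
  rewrite -poweR_EFin; apply: (gt0_ler_poweR (ltW p0)); rewrite ?in_itv/= ?leey ?andbT//.
  - by rewrite lee_fin mulr_ge0 ?cmod_ge0.
  - by apply: integral_ge0 => t _; rewrite lee_fin cmod_ge0.
apply: jensen_powR => [||t]; [by case/andP : p12| |exact: cmod_ge0].
exact: measurable_cmod.
Qed.

(** This is the crude bound that makes [L] finite in [lieb_ineq]. A fixed [i0] with [a i0 != 0]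
    gives [t i = |c i| |a i0|] with [t i <= N], while summing over [x = tau i i0] gives
    [sum t^p <= N^p]; l^p then embeds into l^2. *)
Lemma lieb_l2 : (\int[nu]_i (cmod (c i) ^+ 2)%:E < +oo)%E.
Proof.
have [i0 ai0] := a_neq0.
have A0 := cmod_gt0 ai0.
set A := cmod (a i0) in A0.
pose t i := cmod (c i) * A.
have t0 i : 0 <= t i by rewrite mulr_ge0 ?cmod_ge0.
have tN i : t i <= N.
  rewrite leNgt; apply/negP => Nt.
  have := gt0_ltr_powR p0 N0 (t0 i) Nt; apply/negP; rewrite -leNgt -lee_fin.
  apply: le_trans hN; apply: (le_trans (coef_le i i0)).
  by apply: (le_point_integral dnu (F := psi)).
have tp : (\int[nu]_i (t i `^ p)%:E <= (N `^ p)%:E)%E.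
  apply: le_trans hN; rewrite -/(psi) -(tau_r i0 psi0).
  apply: ge0_le_integral => //.
  - by move=> i _; rewrite lee_fin powR_ge0.
  - exact: (discrete_measurable_fun dnu).
  - exact: (discrete_measurable_fun dnu).
  - by move=> i _; exact: coef_le.
(* Write [t^2 = t^(2-p) t^p] and bound the first factor by [N^(2-p)]; the exponent is nonnegative
   because [p <= 2]. *)
have E i : ((cmod (c i) ^+ 2)%:E <= (A ^- 2 * N `^ (2 - p))%:E * (t i `^ p)%:E)%E.
  rewrite -EFinM lee_fin -mulrA -ler_pdivrMl ?invr_gt0 ?exprn_gt0//.
  rewrite invrK mulrC -exprMn -/(t i) -(powR_mulrn _ (t0 i)).
  rewrite -[in leLHS](subrK p 2%:R) powRD; last by rewrite subrK pnatr_eq0.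
  rewrite ler_wpM2r ?powR_ge0//; apply: ge0_ler_powR; rewrite ?nnegrE//.
  by case/andP : p12; rewrite subr_ge0.
apply: (@le_lt_trans _ _ ((A ^- 2 * N `^ (2 - p))%:E * \int[nu]_i (t i `^ p)%:E)%E).
  rewrite -ge0_integralZl//.
  - apply: ge0_le_integral => //.
    + by move=> i _; rewrite lee_fin sqr_ge0.
    + exact: (discrete_measurable_fun dnu).
    + exact: (discrete_measurable_fun dnu).
  - exact: (discrete_measurable_fun dnu).
  - by move=> i _; rewrite lee_fin powR_ge0.
  - by rewrite lee_fin mulr_ge0 ?powR_ge0// invr_ge0 exprn_ge0// ltW.
apply: (@le_lt_trans _ _ ((A ^- 2 * N `^ (2 - p))%:E * (N `^ p)%:E)%E).
  by apply: lee_wpmul2l => //; rewrite lee_fin mulr_ge0 ?powR_ge0// invr_ge0 exprn_ge0// ltW.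
by rewrite -EFinM ltry.
Qed.

(* [||h_x||_oo <= ||c||_2 ||a||_2 =: L] by Cauchy-Schwarz, while the
   L^2 norm of [h] over all [(x, t)] is exactly [L]; so
   [L ^ 2 <= L ^ (2 - p) N ^ p]. *)
Lemma lieb_ineq :
  ((\int[nu]_i (cmod (c i) ^+ 2)%:E) * (\int[nu]_i (cmod (a i) ^+ 2)%:E) <= (N ^+ 2)%:E)%E.
Proof.
have c2 := lieb_l2; have a2' := a2.
have int0 (u : I -> R[i]) : (0 <= \int[nu]_i (cmod (u i) ^+ 2)%:E)%E.
  by apply: integral_ge0 => i _; rewrite lee_fin sqr_ge0.
set C2 := (\int[nu]_i (cmod (c i) ^+ 2)%:E)%E in c2 *.
set A2 := (\int[nu]_i (cmod (a i) ^+ 2)%:E)%E in a2' *.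
have C2f : C2 \is a fin_num by rewrite ge0_fin_numE// int0.
have A2f : A2 \is a fin_num by rewrite ge0_fin_numE// int0.
have C20 := int0 c; have A20 := int0 a; rewrite -/C2 -/A2 in C20 A20.
set L2 := fine C2 * fine A2.
have L2E : (C2 * A2 = L2%:E)%E by rewrite EFinM !fineK.
have L20 : 0 <= L2 by rewrite mulr_ge0 ?fine_ge0.
pose L := Num.sqrt L2.
have L0 : 0 <= L by exact: sqrtr_ge0.
have LL : L ^+ 2 = L2 by rewrite sqr_sqrtr.
have hL x t : cmod (synthesis nu chi (b x) t) <= L.
  rewrite -(@ler_pXn2r _ 2) ?nnegrE ?cmod_ge0// LL -lee_fin -L2E.
  apply: (@le_trans _ _ ((\int[nu]_i (cmod (c i) * cmod (a (tau i x)))%:E) ^+ 2)%E).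
    have H : ((cmod (synthesis nu chi (b x) t))%:E <=
        \int[nu]_i (cmod (c i) * cmod (a (tau i x)))%:E)%E.
      apply: (le_trans (cmod_synthesis_le dnu chiP t (bint x))).
      by under eq_integral do rewrite /b cmodM.
    by rewrite EFin_expe !expe2; apply: lee_pmul => //; rewrite lee_fin cmod_ge0.
  have mI (u : I -> R) : measurable_fun setT u by exact: (discrete_measurable_fun dnu).
  have := @cauchy_schwarz _ _ _ nu (fun i => cmod (c i)) (fun i => cmod (a (tau i x)))
    (mI _) (mI _) (fun i => cmod_ge0 _) (fun i => cmod_ge0 _).
  rewrite (tau_r x (F := fun i => (cmod (a i) ^+ 2)%:E))// => i.
  by rewrite lee_fin sqr_ge0.
have L2int : (L2%:E = \int[nu]_x \int[P]_t (cmod (synthesis nu chi (b x) t) ^+ 2)%:E)%E.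
  under eq_integral do rewrite (parseval_synthesis dnu chiP)//.
  have dnn : discrete (nu \x nu)%E by exact: (discrete_product dnu dnu).
  rewrite -(fubini_tonelli (fun z => (cmod (b z.2 z.1) ^+ 2)%:E)) /=; last 2 first.
  - exact: (discrete_measurable_fun dnn).
  - by move=> z; rewrite lee_fin sqr_ge0.
  rewrite -L2E -ge0_integralZr//; last 2 first.
  - exact: (discrete_measurable_fun dnu).
  - by move=> i _; rewrite lee_fin sqr_ge0.
  apply: eq_integral => i _.
  rewrite /A2 -(tau_l i (F := fun i => (cmod (a i) ^+ 2)%:E)); last first.
    by move=> j; rewrite lee_fin sqr_ge0.
  rewrite -ge0_integralZl//.
  - by apply: eq_integral => x _; rewrite /b cmodM exprMn EFinM.
  - exact: (discrete_measurable_fun dnu).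
  - by move=> j _; rewrite lee_fin sqr_ge0.
  - by rewrite lee_fin sqr_ge0.
have key : L2 <= L `^ (2 - p) * N `^ p.
  rewrite -lee_fin L2int.
  apply: (@le_trans _ _ (\int[nu]_x ((L `^ (2 - p))%:E * psi x))%E).
    apply: ge0_le_integral => //.
    - by move=> x _; apply: integral_ge0 => t _; rewrite lee_fin sqr_ge0.
    - exact: (discrete_measurable_fun dnu).
    - exact: (discrete_measurable_fun dnu).
    move=> x _; rewrite -ge0_integralZl//; last 3 first.
    - apply/measurable_EFinP; apply: (measurableT_comp (measurable_powR p)).
      exact: measurable_cmod.
    - by move=> t _; rewrite lee_fin powR_ge0.
    - by rewrite lee_fin powR_ge0.
    apply: ge0_le_integral => //.
    - by move=> t _; rewrite lee_fin sqr_ge0.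
    - by apply/measurable_EFinP; apply: measurable_funX; exact: measurable_cmod.
    - apply: measurable_funeM; apply/measurable_EFinP.
      by apply: (measurableT_comp (measurable_powR p)); exact: measurable_cmod.
    move=> t _; rewrite -EFinM lee_fin -powR_mulrn ?cmod_ge0//.
    rewrite -[in leLHS](subrK p 2%:R) powRD; last by rewrite subrK pnatr_eq0.
    rewrite ler_wpM2r ?powR_ge0//; apply: ge0_ler_powR; rewrite ?nnegrE ?cmod_ge0//.
    by case/andP : p12; rewrite subr_ge0.
  rewrite ge0_integralZl//; last 2 first.
  - exact: (discrete_measurable_fun dnu).
  - by rewrite lee_fin powR_ge0.
  by rewrite EFinM; apply: lee_wpmul2l => //; rewrite lee_fin powR_ge0.
rewrite L2E lee_fin.
have [LN|NL] := leP L N; first by rewrite -LL ler_pXn2r ?nnegrE.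
have Lp : 0 < L by exact: le_lt_trans NL.
(* If [L > N], then [L > 0] and [L^(2-p) N^p < L^2], against [key]. Arguing by contradiction avoids
   dividing by a power of [L] that might vanish. *)
exfalso; move: key; apply/negP; rewrite -ltNge -LL -powR_mulrn//.
rewrite -[in ltRHS](subrK p 2%:R) [ltRHS]powRD; last by rewrite subrK pnatr_eq0.
by rewrite ltr_pM2l ?powR_gt0//; exact: gt0_ltr_powR.
Qed.

End lieb.

Lemma cmod_cvg_unique (R : realType) (u : nat -> R[i]) (a b : R[i]) :
  cmod (u k - a) @[k --> \oo] --> (0 : R) -> cmod (u k - b) @[k --> \oo] --> (0 : R) ->
  a = b.
Proof.
move=> ua ub; apply/eqP; rewrite -subr_eq0; apply/eqP; apply: cmod_eq0.
apply/eqP; rewrite eq_le cmod_ge0 andbT.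
have H : cmod (u k - a) + cmod (u k - b) @[k --> \oo] --> (0 : R).
  by rewrite -[X in _ --> X](addr0 (0 : R)); apply: cvgD.
rewrite -(cvg_lim _ H)//; apply: limr_ge; first by apply/cvg_ex; exists 0.
apply: nearW => k; rewrite (_ : a - b = (u k - b) - (u k - a)); last by ring.
by rewrite [leRHS]addrC; exact: cmodB.
Qed.

(** * The Riesz-Fischer theorem *)

Section riesz_fischer.
Context d1 d2 (I : measurableType d1) (Theta : measurableType d2) (R : realType).
Variables (nu : {sigma_finite_measure set I -> \bar R}) (P : probability Theta R).
Hypothesis dnu : discrete nu.
Variable chi : I -> Theta -> R[i].
Hypothesis chiP : orthonormal_system P chi.
Variable c : I -> R[i].
Hypothesis c2 : (\int[nu]_i (cmod (c i) ^+ 2)%:E < +oo)%E.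

(** The rate of a fast subsequence of truncations: tails below [e k ^+ 2] force successive partial
    sums to differ by at most [3 * e k] in L^1, which is summable in [k]. *)
Let e (k : nat) : R := (2 ^ k.+1)%:R^-1.

Let e_gt0 k : 0 < e k. Proof. by rewrite invr_gt0 ltr0n expn_gt0. Qed.

Let e_half k : e k.+1 ^+ 2 <= e k ^+ 2.
Proof.
by rewrite ler_pXn2r ?nnegrE ?(ltW (e_gt0 _))// lef_pV2 ?posrE ?ltr0n ?expn_gt0// ler_nat leq_pexp2l.
Qed.

Variable code : I -> nat.
Hypothesis code_inj : injective code.

Let tail N i : R := if (code i < N)%N then 0 else cmod (c i) ^+ 2.

Let tail0 N i : 0 <= tail N i.
Proof. by rewrite /tail; case: ifP => // _; rewrite sqr_ge0. Qed.

Lemma small_tails : exists K : nat -> nat, forall k,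
  (\int[nu]_i (tail (K k) i)%:E <= (e k ^+ 2)%:E)%E.
Proof.
suff H k : exists N, (\int[nu]_i (tail N i)%:E <= (e k ^+ 2)%:E)%E.
  by exists (fun k => projT1 (cid (H k))) => k; exact: projT2 (cid (H k)).
have /fine_cvgP[[N1 _ H1]] := integral_tail dnu code (fun i => sqr_ge0 (cmod (c i))) c2.
move/cvgrPdist_lt => /(_ (e k ^+ 2)); rewrite exprn_gt0// => /(_ isT)[N2 _ H2].
exists (maxn N1 N2); have f1 := H1 _ (leq_maxl N1 N2); have := H2 _ (leq_maxr N1 N2).
rewrite /= sub0r normrN => h; rewrite -(fineK f1) lee_fin ltW//.
exact: le_lt_trans (ler_norm _) h.
Qed.

Let K := projT1 (cid small_tails).
Let KP : forall k, (\int[nu]_i (tail (K k) i)%:E <= (e k ^+ 2)%:E)%E.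
Proof. exact: projT2 (cid small_tails). Qed.

Let ck k i : R[i] := if (code i < K k)%N then c i else 0.
Let cki k : cintegrable nu (ck k).
Proof. exact: (cintegrable_trunc dnu). Qed.

Let s_ k := synthesis nu chi (ck k).
Let ms k : cmeasurable (s_ k). Proof. exact: (cmeasurable_synthesis dnu chiP). Qed.

Let dk k t := cmod (s_ k.+1 t - s_ k t).

Let mdk k : measurable_fun setT (dk k).
Proof. by apply: measurable_cmod; exact: cmeasurableB. Qed.

(** By Parseval only indices between two truncation levels count. The levels [K k] and [K k.+1] are
    not known to be ordered, so both tails enter, whence the factor 2. *)
Let dk_sqr k : (\int[P]_t (dk k t ^+ 2)%:E <= (2 * e k ^+ 2)%:E)%E.
Proof.
have -> : (\int[P]_t (dk k t ^+ 2)%:E =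
    \int[nu]_i (cmod (ck k.+1 i - ck k i) ^+ 2)%:E)%E.
  rewrite -(parseval_synthesis dnu chiP); last exact: cintegrableB.
  by apply: eq_integral => t _; rewrite (synthesisB dnu chiP).
apply: (@le_trans _ _ (\int[nu]_i ((tail (K k) i)%:E + (tail (K k.+1) i)%:E))%E).
  apply: ge0_le_integral => //.
  - by move=> i _; rewrite lee_fin sqr_ge0.
  - exact: (discrete_measurable_fun dnu).
  - exact: (discrete_measurable_fun dnu).
  move=> i _; rewrite -EFinD lee_fin /ck /tail.
  case: ifP => _; case: ifP => _; rewrite ?subrr ?subr0 ?sub0r ?cmodN ?cmod0 ?addr0 ?add0r ?expr0n//=.
  by rewrite addr_ge0// sqr_ge0.
rewrite ge0_integralD//; last 4 first.
- by move=> i _; rewrite lee_fin.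
- exact: (discrete_measurable_fun dnu).
- by move=> i _; rewrite lee_fin.
- exact: (discrete_measurable_fun dnu).
rewrite mulr_natl mulr2n EFinD; apply: leeD => //.
by apply: (le_trans (KP k.+1)); rewrite lee_fin.
Qed.

(** From L^2 to L^1 by the elementary bound [d <= e + d^2 / e]; integration gives
    [e k + 2 * e k]. *)
Let dk_le k : (\int[P]_t (dk k t)%:E <= (3 * e k)%:E)%E.
Proof.
have H t : ((dk k t)%:E <= (e k)%:E + ((e k)^-1)%:E * (dk k t ^+ 2)%:E)%E.
  rewrite -EFinM -EFinD lee_fin; have [le|lt] := leP (dk k t) (e k).
    by rewrite (le_trans le)// lerDl mulr_ge0 ?sqr_ge0// invr_ge0 ltW.
  apply: (@le_trans _ _ ((e k)^-1 * dk k t ^+ 2)); last by rewrite lerDr ltW.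
  rewrite expr2 mulrA ler_peMl//; first exact: cmod_ge0.
  by rewrite mulrC ler_pdivlMr// mul1r ltW.
apply: (@le_trans _ _ (\int[P]_t ((e k)%:E + ((e k)^-1)%:E * (dk k t ^+ 2)%:E))%E).
  apply: ge0_le_integral => //.
  - by move=> t _; rewrite lee_fin cmod_ge0.
  - exact/measurable_EFinP.
  - apply: emeasurable_funD; first exact: measurable_cst.
    by apply: measurable_funeM; apply/measurable_EFinP; exact: measurable_funX.
have msq : measurable_fun setT (fun t => (dk k t ^+ 2)%:E).
  by apply/measurable_EFinP; exact: measurable_funX.
have ie : 0 <= (e k)^-1 by rewrite invr_ge0 ltW.
rewrite ge0_integralD//; last 3 first.
- by move=> t _; rewrite lee_fin ltW.
- by move=> t _; rewrite -EFinM lee_fin mulr_ge0 ?sqr_ge0.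
- exact: measurable_funeM.
rewrite ge0_integralZl//; last by move=> t _; rewrite lee_fin sqr_ge0.
rewrite integral_prob_cst.
apply: (@le_trans _ _ ((e k)%:E + ((e k)^-1)%:E * (2 * e k ^+ 2)%:E)%E).
  by apply: leeD => //; apply: lee_wpmul2l => //; rewrite lee_fin.
rewrite -EFinM -EFinD lee_fin le_eqVlt; apply/orP; left; apply/eqP.
by field; rewrite gt_eqF.
Qed.

(** The total variation of the sequence of partial sums at [t]: where it is finite, the sums
    converge, and it also bounds them all relative to the first. *)
Let E t : \bar R := (\sum_(0 <= k <oo) (dk k t)%:E)%E.

Let mE : measurable_fun setT E.
Proof.
apply: ge0_emeasurable_sum => [k t _ _|k _]; first by rewrite lee_fin cmod_ge0.
exact/measurable_EFinP.
Qed.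

Let E0 t : (0 <= E t)%E.
Proof. by apply: nneseries_ge0 => k _ _; rewrite lee_fin cmod_ge0. Qed.

Let Ei : P.-integrable setT E.
Proof.
apply/integrableP; split=> //.
under eq_integral do rewrite gee0_abs//.
rewrite integral_nneseries//.
- apply: (@le_lt_trans _ _ 3%:E); last exact: ltry.
  apply: le_trans (epsilon_trick0 xpredT _) => //.
  apply: lee_nneseries => [k _ _|k _]; last exact: dk_le.
  by apply: integral_ge0 => t _; rewrite lee_fin cmod_ge0.
- by move=> k; exact/measurable_EFinP.
- by move=> k t _; rewrite lee_fin cmod_ge0.
Qed.

Let good t : bool := (E t < +oo)%E.

Let mgood : measurable_fun setT good.
Proof. exact: (@measurable_fun_lte _ _ _ _ _ (cst +oo%E)). Qed.

Let ae_good : {ae P, forall t, good t}.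
Proof.
have := integrable_ae measurableT Ei; apply: filterS => t /(_ Logic.I).
by rewrite /good ge0_fin_numE.
Qed.

(** Replacing the partial sums by 0 on the null set where [E] is infinite makes convergence and
    domination hold at every point, the form used by [cmeasurable_lim] and [cdominated]. *)
Let sg k t : R[i] := if good t then s_ k t else 0.

Let mif (f : Theta -> R[i]) : cmeasurable f ->
  cmeasurable (fun t => if good t then f t else 0).
Proof.
move=> [f1 f2]; split.
  rewrite (_ : (fun _ => _) = (fun t => if good t then complex.Re (f t) else 0)).
    by apply: measurable_fun_ifT.
  by apply/funext => t; case: ifP.
rewrite (_ : (fun _ => _) = (fun t => if good t then complex.Im (f t) else 0)).
  by apply: measurable_fun_ifT.
by apply/funext => t; case: ifP.
Qed.

Let sg_bound k t : good t -> cmod (sg k t) <= cmod (s_ 0%N t) + fine (E t).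
Proof.
move=> gt; rewrite /sg gt; rewrite -lee_fin EFinD fineK ?ge0_fin_numE//.
apply: (@le_trans _ _ ((cmod (s_ 0%N t))%:E + \sum_(0 <= i < k) (dk i t)%:E)%E); last first.
  by apply: leeD => //; apply: nneseries_lim_ge => i _ _; rewrite lee_fin cmod_ge0.
rewrite sumEFin -EFinD lee_fin; elim: k => [|k ih].
  by rewrite big_geq// addr0.
rewrite big_nat_recr//= addrA -[X in cmod X](subrK (s_ k t)).
by rewrite (le_trans (cmodD _ _))// addrC lerD.
Qed.

(** The increments form a series dominated by [E t], hence absolutely convergent, and the series
    telescopes to [p (s_ k t) - p (s_ 0 t)]. *)
Let component_cvg (p : R[i] -> R) t : (forall z, `|p z| <= cmod z) ->
  (forall z w, p (z - w) = p z - p w) -> good t -> cvgn (fun k => p (s_ k t)).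
Proof.
move=> p1 p2 gt.
have : cvgn [normed series (fun k => p (s_ k.+1 t) - p (s_ k t))].
  apply: nondecreasing_is_cvgn.
    by apply: nondecreasing_series => k _ _; exact: normr_ge0.
  exists (fine (E t)) => _ [k _ <-]; rewrite /series /=.
  rewrite -lee_fin fineK ?ge0_fin_numE// -sumEFin.
  apply: le_trans (nneseries_lim_ge k _); last by move=> i _ _; rewrite lee_fin cmod_ge0.
  by apply: lee_sum => i _; rewrite lee_fin -p2; exact: p1.
move/normed_cvg; rewrite -[X in series X]/(telescope (fun k => p (s_ k t))) telescopeK.
move/cvg_ex => [l hl]; apply/cvg_ex; exists (l + p (s_ 0%N t)).
rewrite (_ : (fun k => p (s_ k t)) =
    (fun k => (p (s_ k t) - p (s_ 0%N t)) + p (s_ 0%N t))).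
  by apply: cvgD => //; exact: cvg_cst.
by apply/funext => k; rewrite subrK.
Qed.

Let s t : R[i] := if good t then
  (limn (fun k => complex.Re (s_ k t))) +i* (limn (fun k => complex.Im (s_ k t))) else 0.

Let sg_cvg t : cmod (sg k t - s t) @[k --> \oo] --> (0 : R).
Proof.
rewrite /sg /s; case: ifPn => gt; last first.
  by under eq_cvg do rewrite subrr cmod0; exact: cvg_cst.
have h1 : complex.Re (s_ k t) @[k --> \oo] --> limn (fun k => complex.Re (s_ k t)).
  apply: (component_cvg _ _ gt) => [z|z w]; first exact: Re_le_cmod.
  by rewrite !complexE.
have h2 : complex.Im (s_ k t) @[k --> \oo] --> limn (fun k => complex.Im (s_ k t)).
  apply: (component_cvg _ _ gt) => [z|z w]; first exact: Im_le_cmod.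
  by rewrite !complexE.
have dd : `|complex.Re (s_ k t) - limn (fun k => complex.Re (s_ k t))| +
    `|complex.Im (s_ k t) - limn (fun k => complex.Im (s_ k t))| @[k --> \oo] --> (0 : R).
  rewrite -[X in _ --> X](addr0 (0 : R)).
  by apply: cvgD; apply/norm_cvg0P/subr_cvg0.
apply: squeeze_cvgr dd; last exact: cvg_cst.
by apply: nearW => k; rewrite cmod_ge0 (le_trans (cmod_le _))// !complexE.
Qed.

Let mchi : forall i, cmeasurable (chi i). Proof. by case: chiP. Qed.
Let chi1 i t : cmod (chi i t) = 1. Proof. by case: chiP. Qed.

Lemma riesz_fischer_code : exists s : Theta -> R[i], [/\ cmeasurable s,
  (\int[P]_t (cmod (s t) ^+ 2)%:E <= \int[nu]_i (cmod (c i) ^+ 2)%:E)%E &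
  forall j, cintegral P (fun t => s t * (chi j t)^*%R) = c j].
Proof.
have msg k : cmeasurable (sg k) by exact: mif.
exists s; split.
- exact: cmeasurable_lim sg_cvg.
- have sq_cvg t : ((cmod (sg k t) ^+ 2)%:E @[k --> \oo] --> (cmod (s t) ^+ 2)%:E)%E.
    apply: cvg_EFin; first exact: nearW.
    have H : cmod (sg k t) @[k --> \oo] --> cmod (s t).
      apply/subr_cvg0; apply: norm_cvg0; apply: squeeze_cvgr (sg_cvg t); last exact: cvg_cst.
      apply: nearW => k; rewrite normr_ge0 /= ler_norml; apply/andP; split.
        rewrite lerNl opprB lerBlDr -[X in cmod X <= _](subrK (sg k t)).
        by rewrite (le_trans (cmodD _ _))// cmodBC.
      by rewrite lerBlDr -[X in cmod X <= _](subrK (s t)) (le_trans (cmodD _ _)).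
    by rewrite [X in _ --> X]expr2; exact: (cvgM H H).
  (* Fatou's lemma bounds the norm of the limit, since by Parseval every partial sum has L^2 norm at
     most that of [c]. *)
  have := @fatou _ _ _ P setT measurableT (fun k t => (cmod (sg k t) ^+ 2)%:E).
  under eq_integral do rewrite (cvg_limn_einf_sup (sq_cvg _)).1.
  move=> /(_ _ _)/le_trans; apply.
  + by move=> k; apply/measurable_EFinP; apply: measurable_funX; exact: measurable_cmod.
  + by move=> k t _; rewrite lee_fin sqr_ge0.
  rewrite limn_einf_lim; apply: lime_le; first exact: is_cvg_einfs.
  apply: nearW => k; apply: (@le_trans _ _ (\int[P]_t (cmod (sg k t) ^+ 2)%:E)%E).
    by apply: ereal_inf_lbound; exists k => /=.
  apply: (@le_trans _ _ (\int[P]_t (cmod (s_ k t) ^+ 2)%:E)%E).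
    apply: ge0_le_integral => //.
    + by move=> t _; rewrite lee_fin sqr_ge0.
    + by apply/measurable_EFinP; apply: measurable_funX; exact: measurable_cmod.
    + by apply/measurable_EFinP; apply: measurable_funX; exact: measurable_cmod.
    + by move=> t _; rewrite lee_fin /sg; case: ifP => // _; rewrite cmod0 expr0n sqr_ge0.
  rewrite (parseval_synthesis dnu chiP)//.
  apply: ge0_le_integral => //.
  + by move=> i _; rewrite lee_fin sqr_ge0.
  + exact: (discrete_measurable_fun dnu).
  + exact: (discrete_measurable_fun dnu).
  + by move=> i _; rewrite lee_fin /ck; case: ifP => // _; rewrite cmod0 expr0n sqr_ge0.
- move=> j.
  (* An integrable majorant of all modified partial sums, so that integrals against [chi j] pass to
     the limit. *)
  pose g t := if good t then cmod (s_ 0%N t) + fine (E t) else 0.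
  have gi : P.-integrable setT (EFin \o g).
    have [M Moo bM] := synthesis_bound dnu chiP (cki 0).
    have s0i := cintegrable_cmod (cintegrable_bounded P (ms 0) bM Moo).
    apply: (ae_eq_integrable _ _ (integrableD measurableT s0i Ei)).
      apply/measurable_EFinP; apply: measurable_fun_ifT => //.
      apply: measurable_funD; first exact: measurable_cmod.
      exact: (measurableT_comp (fine_measurable measurableT)).
    apply: filterS ae_good => t gt _; rewrite /= /g gt EFinD fineK// ge0_fin_numE//.
  have [||||_] := @cdominated _ _ _ P (fun k t => sg k t * (chi j t)^*%R)
    (fun t => s t * (chi j t)^*%R) g.
  + by move=> k; apply: cmeasurableM => //; exact: cmeasurable_conj.
  + by move=> t; under eq_cvg do rewrite -mulrBl cmodM cmod_conj chi1 mulr1; exact: sg_cvg.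
  + move=> k t; rewrite cmodM cmod_conj chi1 mulr1 /g.
    by case: ifPn => gt; [exact: sg_bound|rewrite /sg (negbTE gt) cmod0].
  + exact: gi.
  have -> : (fun k => cmod (cintegral P (fun t => sg k t * (chi j t)^*%R) -
      cintegral P (fun t => s t * (chi j t)^*%R))) =
      (fun k => cmod (ck k j - cintegral P (fun t => s t * (chi j t)^*%R))).
    apply/funext => k; rewrite -(synthesis_coef dnu chiP j (cki k)); congr (cmod (_ - _)).
    apply: cintegral_ae.
    + by apply: cmeasurableM => //; exact: cmeasurable_conj.
    + by apply: (cmeasurableM (ms k)); exact: cmeasurable_conj.
    + by apply: filterS ae_good => t gt; rewrite /sg gt.
  move=> H.
  have ec : e k @[k --> \oo] --> (0 : R).
    have := @cvg_geometric R 2^-1 2^-1; rewrite ger0_norm// => /(_ _) G.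
    have {}G := G (ltac:(by rewrite invf_lt1// ltr1n)).
    by under eq_cvg do rewrite /e expnS natrM natrX invfM -exprVn.
  (* The square of this modulus is a single term of the tail sum, hence at most [e k ^+ 2]. *)
  have H2 : cmod (ck k j - c j) @[k --> \oo] --> (0 : R).
    apply: squeeze_cvgr ec; last exact: cvg_cst.
    apply: nearW => k; rewrite cmod_ge0 /= -(@ler_pXn2r _ 2) ?nnegrE ?cmod_ge0//; last exact: ltW.
    rewrite -lee_fin; apply: le_trans (KP k).
    apply: le_trans (le_point_integral dnu (F := fun i => (tail (K k) i)%:E) j _); last first.
      by move=> i; rewrite lee_fin.
    by rewrite lee_fin /ck /tail; case: ifP => _; rewrite ?subrr ?cmod0 ?expr0n//= sub0r cmodN.
  exact: cmod_cvg_unique H H2.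
Qed.

End riesz_fischer.

Lemma riesz_fischer d1 d2 (I : measurableType d1) (Theta : measurableType d2) (R : realType)
    (nu : {sigma_finite_measure set I -> \bar R}) (P : probability Theta R)
    (chi : I -> Theta -> R[i]) (c : I -> R[i]) :
  discrete nu -> orthonormal_system P chi ->
  (\int[nu]_i (cmod (c i) ^+ 2)%:E < +oo)%E ->
  exists s : Theta -> R[i], [/\ cmeasurable s,
  (\int[P]_t (cmod (s t) ^+ 2)%:E <= \int[nu]_i (cmod (c i) ^+ 2)%:E)%E &
  forall j, cintegral P (fun t => s t * (chi j t)^*%R) = c j].
Proof.
move=> dnu chiP c2; have [_ _ [code code_inj]] := dnu.
exact: (riesz_fischer_code dnu chiP c2 code_inj).
Qed.

(** * Integration on the torus and characters *)

Section line_derivative.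
Variables (R : realType) (V : normedModType R) (f : V -> R) (x v : V).

Let line_quotient s : (fun h : R => h^-1 *: (((fun t : R => f (x + t *: v)) \o shift s) (h *: 1) -
      (fun t : R => f (x + t *: v)) s)) =
  (fun h => h^-1 *: ((f \o shift (x + s *: v)) (h *: v) - f (x + s *: v))).
Proof.
apply/funext => h /=; congr (_ *: (f _ - _)).
by rewrite scalerDl -[h *: 1]/(h * 1) mulr1 addrCA addrC.
Qed.

(** Directional derivatives are ordinary derivatives along lines, which opens them to one-variable
    calculus. *)
Lemma derivable_line s : derivable (fun t : R => f (x + t *: v)) s 1 =
  derivable f (x + s *: v) v.
Proof. by rewrite /derivable line_quotient. Qed.

Lemma derive_line s :
  'D_1 (fun t : R => f (x + t *: v)) s = 'D_v f (x + s *: v).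
Proof. by rewrite /derive line_quotient. Qed.

End line_derivative.

Section torus_integration.
Variable R : realType.

Lemma torus_consD0 n (x t : R) (w : torus R n) :
  torus_cons (x + t, w) = (torus_cons (x, w) : 'rV[R]_n.+1) + t *: delta_mx ord0 ord0.
Proof.
apply/rowP => j; rewrite !mxE; case: unliftP => [i ->|->].
  by rewrite [lift ord0 i == ord0]eq_sym (negbTE (neq_lift _ _)) andbF mulr0 addr0.
by rewrite eqxx mulr1.
Qed.

Lemma torus_consD_lift n (x t : R) (w : torus R n) (i : 'I_n) :
  torus_cons (x, (w : 'rV[R]_n) + t *: delta_mx ord0 i) =
  (torus_cons (x, w) : 'rV[R]_n.+1) + t *: delta_mx ord0 (lift ord0 i).
Proof.
apply/rowP => j; rewrite !mxE; case: unliftP => [k ->|->].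
  by rewrite !mxE (inj_eq (@lift_inj _ _)).
by rewrite mulr0 addr0.
Qed.

Lemma integral_uniform01 (f : R -> R) : measurable_fun [set: measurableTypeR R] f ->
  \int[uniform_prob (@ltr01 R)]_x f x = \int[lebesgue_measure]_(x in `[0, 1]) f x.
Proof.
move=> /measurable_EFinP mf; rewrite /Rintegral; congr fine.
rewrite integralE [RHS]integralE; congr (_ - _)%E;
  rewrite integral_uniform ?subr0 ?invr1 ?mul1e//.
  exact: measurable_funepos.
exact: measurable_funeneg.
Qed.

Lemma ge0_integral_haarS n (f : torus R n.+1 -> \bar R) :
  measurable_fun setT f -> (forall w, 0 <= f w)%E ->
  (\int[haar R n.+1]_w f w =
   \int[uniform_prob (@ltr01 R) \x haar R n]_z f (torus_cons z))%E.
Proof.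
move=> mf f0.
have := (@ge0_integral_pushforward _ _ _ _ R (@torus_cons R n) (@measurable_torus_cons R n)
  (uniform_prob (@ltr01 R) \x haar R n)%E setT f measurableT mf (fun w _ => f0 w)).
by rewrite preimage_setT.
Qed.

Lemma integrable_haarS n (f : torus R n.+1 -> \bar R) :
  (haar R n.+1).-integrable setT f ->
  (uniform_prob (@ltr01 R) \x haar R n)%E.-integrable setT (f \o @torus_cons R n).
Proof.
move=> /integrableP[mf fi]; apply/integrableP; split.
  by apply: measurableT_comp => //; exact: (@measurable_torus_cons R n).
have mA : measurable_fun setT (abse \o f) by exact: measurableT_comp.
by have := ge0_integral_haarS mA (fun=> abse_ge0 _); rewrite /= => <-.
Qed.

Lemma Rintegral_haarS n (f : torus R n.+1 -> R) :
  (haar R n.+1).-integrable setT (EFin \o f) ->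
  \int[haar R n.+1]_w f w =
  \int[(uniform_prob (@ltr01 R) \x haar R n)%E]_z f (torus_cons z).
Proof.
move=> fi; rewrite /Rintegral; congr fine.
have mf := measurable_int _ fi.
have := (@integral_pushforward _ _ _ _ R (@torus_cons R n) (@measurable_torus_cons R n)
  _ setT (EFin \o f) mf (integrable_haarS fi) measurableT).
by rewrite preimage_setT.
Qed.

Lemma bounded_integrable d (T : measurableType d) (P : probability T R) (f : T -> R) M :
  measurable_fun setT f -> (forall x, `|f x| <= M) -> P.-integrable setT (EFin \o f).
Proof.
move=> mf fM; apply: (@le_integrable _ _ _ P _ measurableT _ (cst M%:E)).
- exact/measurable_EFinP.
- by move=> x _; rewrite /= lee_fin (le_trans (fM x))// ler_norm.
- apply/integrableP; split; first exact: measurable_cst.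
  by rewrite /= integral_prob_cst ltry.
Qed.

(* induction on the dimension, the torus being integrated coordinate by
   coordinate; the fundamental theorem of calculus applies in direction [i] *)
Lemma haar_derive0 n (i : 'I_n) (f : 'rV[R]_n -> R) (M : R) :
  (forall x, derivable f x (delta_mx ord0 i)) ->
  (forall x, continuous (fun t : R => 'D_(delta_mx ord0 i) f (x + t *: delta_mx ord0 i))) ->
  measurable_fun [set: torus R n] ('D_(delta_mx ord0 i) f) ->
  (forall x, `|'D_(delta_mx ord0 i) f x| <= M) ->
  (forall x, f (x + delta_mx ord0 i) = f x) ->
  \int[haar R n]_w ('D_(delta_mx ord0 i) f w) = 0.
Proof.
elim: n => [|n IH] in i f M *; first by case: i.
set df := 'D_(delta_mx ord0 i) f => fd fc mf fM fp.
have di := bounded_integrable (haar R n.+1) mf fM.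
have dic := integrable_haarS di.
rewrite Rintegral_haarS//.
have mfc : measurable_fun setT (df \o @torus_cons R n).
  by apply: measurableT_comp => //; exact: (@measurable_torus_cons R n).
case: (unliftP ord0 i) => [j iE|iE].
- rewrite (@Rfubini12 _ _ _ _ _ _ _ (uniform_prob (@ltr01 R) \x haar R n)%E erefl
    (df \o @torus_cons R n) dic).2.
  under eq_Rintegral => x _.
    pose g (w : 'rV[R]_n) := f (torus_cons (x, w)).
    have gl w t : g (w + t *: delta_mx ord0 j) =
        f ((torus_cons (x, w) : 'rV[R]_n.+1) + t *: delta_mx ord0 i).
      by rewrite /g torus_consD_lift iE.
    have gd w : derivable g w (delta_mx ord0 j) /\
        'D_(delta_mx ord0 j) g w = df (torus_cons (x, w)).
      have := derivable_line g w (delta_mx ord0 j) 0.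
      have := derive_line g w (delta_mx ord0 j) 0.
      rewrite (_ : (fun t => g _) =
        (fun t => f ((torus_cons (x, w) : 'rV[R]_n.+1) + t *: delta_mx ord0 i))).
        rewrite derive_line derivable_line !scale0r !addr0 => <- <-; split=> //.
      by apply/funext => t; rewrite gl.
    have gD : 'D_(delta_mx ord0 j) g = fun w => df (torus_cons (x, w)).
      by apply/funext => w; case: (gd w).
    have -> : \int[haar R n]_y (df \o @torus_cons R n) (x, y) = 0.
      rewrite -[LHS]/(\int[haar R n]_y (fun w => df (torus_cons (x, w))) y) -gD.
      apply: (IH j g M).
      + by move=> w; case: (gd w).
      + move=> w.
        rewrite (_ : (fun t => _) = (fun t : R =>
          df ((torus_cons (x, w) : 'rV[R]_n.+1) + t *: delta_mx ord0 i)));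
          first exact: fc.
        by apply/funext => t; case: (gd (w + t *: delta_mx ord0 j)) => _ ->;
          rewrite torus_consD_lift iE.
      + rewrite gD; apply: (measurableT_comp mfc).
        exact: measurable_pair1.
      + by move=> w; case: (gd w) => _ ->; exact: fM.
      + by move=> w; rewrite -[delta_mx ord0 j]scale1r gl scale1r fp.
    over.
  by rewrite /Rintegral integral0.
- rewrite (@Rfubini21 _ _ _ _ _ _ _ (uniform_prob (@ltr01 R) \x haar R n)%E erefl
    (df \o @torus_cons R n) dic).2.
  under eq_Rintegral => w _.
    have lineE t : torus_cons (t, w) =
        (torus_cons (0, w) : 'rV[R]_n.+1) + t *: delta_mx ord0 i.
      by rewrite -[in LHS](add0r t) torus_consD0 iE.
    pose g (t : R) := f ((torus_cons (0, w) : 'rV[R]_n.+1) + t *: delta_mx ord0 i).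
    have gd t : derivable g t 1 by rewrite derivable_line.
    have gD t : derive1 g t = df (torus_cons (t, w)).
      by rewrite derive1E derive_line -lineE.
    have gc : continuous g.
      by move=> t; apply: differentiable_continuous; exact/derivable1_diffP.
    have -> : \int[uniform_prob (@ltr01 R)]_t (df \o @torus_cons R n) (t, w) = 0.
      rewrite integral_uniform01; last first.
        by apply: (measurableT_comp mfc); exact: measurable_pair2.
      rewrite /Rintegral.
      rewrite (@continuous_FTC2 _ (fun t => df (torus_cons (t, w))) g 0 1)//.
      + by rewrite /= /g scale1r scale0r addr0 fp subrr.
      + apply: continuous_subspaceT => t.
        rewrite (_ : (fun t => _) = (fun t : R =>
          df ((torus_cons (0, w) : 'rV[R]_n.+1) + t *: delta_mx ord0 i)));
          first exact: fc.
        by apply/funext => s; rewrite lineE.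
      + split.
        * by move=> t _; exact: gd.
        * by apply: cvg_at_right_filter; exact: gc.
        * by apply: cvg_at_left_filter; exact: gc.
    over.
  by rewrite /Rintegral integral0.
Qed.

End torus_integration.

Lemma is_derive_line (R : realType) (V : normedModType R) (f : V -> R) (x v : V) (l : R) :
  is_derive (0 : R) 1 (fun t : R => f (x + t *: v)) l -> is_derive x v f l.
Proof.
move=> [fd fl]; have := derivable_line f x v 0; have := derive_line f x v 0.
by rewrite scale0r addr0 fl => e1 e2; split; [rewrite -e2|rewrite -e1].
Qed.

Section characters.
Variable R : realType.

Lemma expiD (s t : R) : expi (s + t) = expi s * expi t.
Proof.
apply: complex_ext; rewrite !complexE /= mulrDr ?cosD ?sinD//.
by rewrite addrC mulrC [X in X + _]mulrC [X in _ + X]mulrC; ring.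
Qed.

Lemma expi0 : expi (0 : R) = 1.
Proof. by rewrite /expi mulr0 cos0 sin0. Qed.

Lemma expiN (t : R) : expi (- t) = (expi t)^*%R.
Proof. by apply: complex_ext; rewrite !complexE /= mulrN ?cosN ?sinN. Qed.

Lemma cmod_expi (t : R) : cmod (expi t) = 1.
Proof. by rewrite cmodE /= cos2Dsin2 sqrtr1. Qed.

Lemma expi_nat (k : nat) : expi (k%:R : R) = 1.
Proof.
elim: k => [|k ih]; first exact: expi0.
rewrite -[k.+1]addn1 natrD expiD ih mul1r /expi mulr1.
by rewrite mulr_natl cos2pi sin2pi.
Qed.

Lemma expi_int (k : int) : expi (k%:~R : R) = 1.
Proof.
case: k => k; first by rewrite -[X in expi X]/(k%:R) expi_nat.
by rewrite NegzE mulrNz expiN -[X in expi X]/(k.+1%:R) expi_nat rmorph1.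
Qed.

Variable n : nat.
Implicit Types (k j : Zn n) (w x y : torus R n).

Lemma ZnDE k j i : ((k + j : Zn n) : 'rV[int]_n) ord0 i =
  (k : 'rV[int]_n) ord0 i + (j : 'rV[int]_n) ord0 i.
Proof. exact: mxE. Qed.

Lemma ZnNE k i : ((- k : Zn n) : 'rV[int]_n) ord0 i = - (k : 'rV[int]_n) ord0 i.
Proof. exact: mxE. Qed.

Lemma Zn_neq0 k : k != 0 -> exists i, (k : 'rV[int]_n) ord0 i != 0.
Proof.
move=> k0; apply/existsP; apply: contraNT k0; rewrite negb_exists => /forallP k0.
apply/eqP; apply/rowP => i; rewrite [RHS]mxE; apply/eqP.
by have := k0 i; rewrite negbK.
Qed.

Lemma dotDl k j w : dot (k + j) w = dot k w + dot j w.
Proof.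
by rewrite /dot -big_split /=; apply: eq_bigr => i _; rewrite ZnDE mulrzDr.
Qed.

Lemma dotNl k w : dot (- k) w = - dot k w.
Proof.
by rewrite /dot -sumrN; apply: eq_bigr => i _; rewrite ZnNE mulrNz.
Qed.

Lemma dot0l w : dot 0 w = 0.
Proof. by rewrite -(subrr 0) dotDl dotNl subrr. Qed.

Lemma dotDr k (x y : 'rV[R]_n) : dot k (x + y : 'rV[R]_n) = dot k x + dot k y.
Proof. by rewrite /dot -big_split /=; apply: eq_bigr => i _; rewrite mxE mulrzDl. Qed.

Lemma dotNr k (x : 'rV[R]_n) : dot k (- x : 'rV[R]_n) = - dot k x.
Proof. by rewrite /dot -sumrN; apply: eq_bigr => i _; rewrite mxE mulNrz. Qed.

Lemma dot_delta k (t : R) (i : 'I_n) :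
  dot k (t *: delta_mx ord0 i : 'rV[R]_n) = t *~ (k : 'rV[int]_n) ord0 i.
Proof.
rewrite /dot (bigD1 i)//= big1 ?addr0 => [|j ji]; rewrite !mxE eqxx/=.
  by rewrite eqxx mulr1.
by rewrite (negbTE ji) mulr0 mul0rz.
Qed.

Lemma measurable_dot k : measurable_fun setT (fun w => dot k w).
Proof.
apply: measurable_sum => i.
rewrite (_ : (fun _ => _) = (fun w => torus_coord i w * ((k : 'rV[int]_n) ord0 i)%:~R)).
  by apply: measurable_funM => //; exact: measurable_torus_coord.
by apply/funext => w; rewrite mulrzr.
Qed.

Definition character k w : R[i] := expi (dot k w).

Lemma cmeasurable_expi d (T : measurableType d) (f : T -> R) :
  measurable_fun setT f -> cmeasurable (fun t => expi (f t)).
Proof.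
move=> mf; have m2 : measurable_fun setT (fun t => 2 * pi * f t).
  by apply: measurable_funM.
split; apply: (measurableT_comp _ m2); apply: continuous_measurable_fun.
  exact: continuous_cos.
exact: continuous_sin.
Qed.

Lemma cmeasurable_character k : cmeasurable (character k).
Proof. by apply: cmeasurable_expi; exact: measurable_dot. Qed.

Lemma is_derive_affine (a b s : R) : is_derive s 1 (fun t : R => 2 * pi * (a + t * b)) (2 * pi * b).
Proof.
apply: is_derive_eq.
by rewrite /GRing.scale /=; ring.
Qed.

Lemma dot_line k x i (t : R) : dot k ((x : 'rV[R]_n) + t *: delta_mx ord0 i) =
  dot k x + t * ((k : 'rV[int]_n) ord0 i)%:~R.
Proof. by rewrite dotDr dot_delta mulrzr. Qed.

Lemma is_derive_cos_dot k (x : 'rV[R]_n) i :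
  is_derive x (delta_mx ord0 i) (fun y : 'rV[R]_n => cos (2 * pi * dot k y))
    (- (2 * pi * ((k : 'rV[int]_n) ord0 i)%:~R) * sin (2 * pi * dot k x)).
Proof.
apply: is_derive_line; under eq_fun do rewrite dot_line.
have A := is_derive_affine (dot k x) ((k : 'rV[int]_n) ord0 i)%:~R 0.
apply: (is_derive_eq (@is_derive1_comp _ cos _ _ _ _ (is_derive_cos _) A)).
by rewrite mul0r addr0 /GRing.scale /=; ring.
Qed.

Lemma is_derive_sin_dot k (x : 'rV[R]_n) i :
  is_derive x (delta_mx ord0 i) (fun y : 'rV[R]_n => sin (2 * pi * dot k y))
    (2 * pi * ((k : 'rV[int]_n) ord0 i)%:~R * cos (2 * pi * dot k x)).
Proof.
apply: is_derive_line; under eq_fun do rewrite dot_line.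
have A := is_derive_affine (dot k x) ((k : 'rV[int]_n) ord0 i)%:~R 0.
apply: (is_derive_eq (@is_derive1_comp _ sin _ _ _ _ (is_derive_sin _) A)).
by rewrite mul0r addr0 /GRing.scale /=; ring.
Qed.

Lemma expi_periodic k (x : 'rV[R]_n) i :
  character k (x + delta_mx ord0 i : 'rV[R]_n) = character k x.
Proof.
rewrite /character dotDr -[delta_mx ord0 i]scale1r dot_delta expiD.
by rewrite expi_int mulr1.
Qed.

End characters.

Section continuous_real_functions.
Variables (R : realType) (T : topologicalType).
Implicit Types f g : T -> R.

Lemma continuous_funD f g : continuous f -> continuous g ->
  continuous (fun x => f x + g x).
Proof. by move=> hf hg x; exact: (cvgD (hf x) (hg x)). Qed.

Lemma continuous_funB f g : continuous f -> continuous g ->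
  continuous (fun x => f x - g x).
Proof. by move=> hf hg x; exact: (cvgB (hf x) (hg x)). Qed.

Lemma continuous_funM f g : continuous f -> continuous g ->
  continuous (fun x => f x * g x).
Proof. by move=> hf hg x; exact: (cvgM (hf x) (hg x)). Qed.

Lemma continuous_funZ (c : R) f : continuous f -> continuous (fun x => c * f x).
Proof. by move=> hf x; exact: (cvgMl_tmp (hf x)). Qed.

End continuous_real_functions.

Section continuous_torus.
Variables (R : realType) (n : nat).

Let grid (N : nat) (y : torus R n) : Zn n :=
  \row_i Num.floor (N.+1%:R * (y : 'rV[R]_n) ord0 i).

Let measurable_grid N : measurable_fun setT (grid N).
Proof.
move=> _ A _; rewrite setTI.
rewrite (_ : _ @^-1` A = \bigcup_m [set y | pickle (grid N y) = m /\ A (grid N y)]); last first.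
  by apply/seteqP; split=> [y Ay|y [m _ []]//]; exists (pickle (grid N y)).
apply: bigcupT_measurable => m.
have [[k [km Ak]]|no] := pselect (exists k : Zn n, pickle k = m /\ A k); last first.
  rewrite (_ : [set y | _] = set0)// -subset0 => y [ym Ay].
  by apply: no; exists (grid N y).
(* The fibre of the grid map over [k] is a half-open box, a finite intersection of conditions on
   single coordinates. *)
rewrite (_ : [set y | _] = \bigcap_(i in [set: 'I_n])
    (@torus_coord R n i @^-1` [set x : R | (((k : 'rV[int]_n) ord0 i)%:~R <= N.+1%:R * x < ((k : 'rV[int]_n) ord0 i + 1)%:~R)%R])).
  apply: fin_bigcap_measurable => // i _; rewrite -[X in measurable X]setTI.
  apply: measurable_torus_coord => //.
  rewrite (_ : [set x | _] = [set x : R | (((k : 'rV[int]_n) ord0 i)%:~R / N.+1%:R <= x) /\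
     (x < ((k : 'rV[int]_n) ord0 i + 1)%:~R / N.+1%:R)]).
    rewrite (_ : [set x | _] = `[((k : 'rV[int]_n) ord0 i)%:~R / N.+1%:R,
      ((k : 'rV[int]_n) ord0 i + 1)%:~R / N.+1%:R[%classic); first exact: measurable_itv.
    by apply/seteqP; split=> x /=; rewrite in_itv/=; [case=> -> ->|case/andP].
  apply/seteqP; split=> x /=; rewrite ler_pdivrMr ?ltr0Sn// ltr_pdivlMr ?ltr0Sn// ![x * _]mulrC.
    by case/andP.
  by case=> -> ->.
apply/seteqP; split=> [y /= [ym Ay] i _|y /= H].
  have -> : k = grid N y by apply: (pcan_inj pickleK); rewrite km ym.
  rewrite /torus_coord /grid /= mxE; apply/andP; split; first exact: floor_le.
  exact: floorD1_gt.
suff -> : grid N y = k by [].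
apply/rowP => i; rewrite mxE; apply: floor_def.
exact: H.
Qed.

(** The sigma-algebra is defined through the coordinates, not through open sets. A continuous [f] is
    the pointwise limit of its values at the grid points [floor ((N + 1) y) / (N + 1)], and the grid
    map is measurable with countably many values. *)
Lemma continuous_measurable_torus (f : 'rV[R]_n -> R) : continuous f ->
  measurable_fun [set: torus R n] f.
Proof.
move=> cf.
pose back (N : nat) (k : Zn n) : 'rV[R]_n := \row_i (((k : 'rV[int]_n) ord0 i)%:~R / N.+1%:R).
apply: (@measurable_fun_cvg _ _ _ _ (fun N y => f (back N (grid N y)))).
  by move=> N; apply: (@measurableT_comp _ _ _ _ _ _ (fun k => f (back N k))); last exact: measurable_grid.
move=> y _; apply: (@continuous_cvg _ _ _ _ _ (fun N => back N (grid N y)) f y); first exact: cf.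
apply/cvg_ballP => e e0.
near=> N; split=> // i j; rewrite /ball /= ord1 !mxE.
rewrite -[X in `|X - _|](mulfK (_ : N.+1%:R != 0)) ?pnatr_eq0// -mulrBl normrM.
rewrite [y ord0 j * _]mulrC normfV (@ger0_norm _ N.+1%:R)// ltr_pdivrMr ?ltr0Sn//.
apply: (@le_lt_trans _ _ 1).
  rewrite ger0_norm ?subr_ge0 ?floor_le// lerBlDl.
  by have := floorD1_gt (N.+1%:R * (y : 'rV[R]_n) ord0 j); rewrite intrD1 => /ltW.
rewrite mulrC -ltr_pdivrMr// div1r invf_plt ?posrE ?ltr0Sn//.
near: N; exact: (near_infty_natSinv_lt (PosNum e0)).
Unshelve. all: by end_near. Qed.

End continuous_torus.

(** * Integration by parts and orthogonality of characters *)

Section characters_orthogonality.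
Variables (R : realType) (n : nat).
Local Notation th k x := (2 * pi * dot k x).

(** The regularity under which [haar_derive0] applies and which survives multiplication by a
    character. Periodicity is demanded in direction [i] alone, so bounds are recorded instead of
    being drawn from compactness. *)
Record periodic_C1 (i : 'I_n) (u : 'rV[R]_n -> R) : Prop := PeriodicC1 {
  pC1_cont : continuous u;
  pC1_der : forall x, derivable u x (delta_mx ord0 i);
  pC1_dcont : continuous ('D_(delta_mx ord0 i) u);
  pC1_bound : exists M : R, forall x, `|u x| <= M;
  pC1_dbound : exists M : R, forall x, `|'D_(delta_mx ord0 i) u x| <= M;
  pC1_per : forall x, u (x + delta_mx ord0 i) = u x }.

Lemma continuous_dot (k : Zn n) : continuous (fun x : 'rV[R]_n => dot k x).
Proof.
apply: continuous_big => [|i _]; first exact: add_continuous.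
rewrite (_ : (fun _ => _) = (fun x : 'rV[R]_n => x ord0 i * ((k : 'rV[int]_n) ord0 i)%:~R)).
  move=> x; exact: (cvgMr_tmp (@coord_continuous R 1 n ord0 i x)).
by apply/funext => x; rewrite mulrzr.
Qed.

Lemma continuous_th (k : Zn n) : continuous (fun x : 'rV[R]_n => th k x).
Proof. by apply: continuous_funZ; exact: continuous_dot. Qed.

Lemma continuous_cos_th (k : Zn n) : continuous (fun x : 'rV[R]_n => cos (th k x)).
Proof.
move=> x; exact: (@continuous_comp _ _ _ (fun x : 'rV[R]_n => th k x) cos x
  (@continuous_th k x) (@continuous_cos R _)).
Qed.

Lemma continuous_sin_th (k : Zn n) : continuous (fun x : 'rV[R]_n => sin (th k x)).
Proof.
move=> x; exact: (@continuous_comp _ _ _ (fun x : 'rV[R]_n => th k x) sin x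
  (@continuous_th k x) (@continuous_sin R _)).
Qed.

Lemma derive_pC1 i u x : periodic_C1 i u ->
  is_derive x (delta_mx ord0 i) u ('D_(delta_mx ord0 i) u x).
Proof. by move=> [_ ud _ _ _ _]; split. Qed.

Lemma pC1_integral0 i u : periodic_C1 i u ->
  \int[haar R n]_w ('D_(delta_mx ord0 i) u w) = 0.
Proof.
move=> [uc ud dc _ [M dM] up]; apply: (haar_derive0 ud _ _ dM up).
  move=> x t; apply: (@continuous_comp _ _ _ (fun t : R => x + t *: delta_mx ord0 i)
    ('D_(delta_mx ord0 i) u)); last exact: dc.
  exact: (cvgD (cvg_cst x) (cvgZr_tmp (cvg_id))).
exact: continuous_measurable_torus.
Qed.

Lemma is_deriveE (f : 'rV[R]_n -> R) v (df : 'rV[R]_n -> R) :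
  (forall x, is_derive x v f (df x)) -> 'D_v f = df.
Proof. by move=> h; apply/funext => x; case: (h x). Qed.

(** Integration by parts against a character in real terms. For [u = a + i b], [f] is the real part
    of [u] times the conjugate of [character k]; its derivative [g + kap * h] integrates to 0. The
    imaginary part is the same identity for the pair [b], [- a]. *)
Lemma pC1_twist i (a b : 'rV[R]_n -> R) (k : Zn n) : periodic_C1 i a -> periodic_C1 i b ->
  \int[haar R n]_w ('D_(delta_mx ord0 i) a w * cos (th k w) +
    'D_(delta_mx ord0 i) b w * sin (th k w)) =
  - (2 * pi * ((k : 'rV[int]_n) ord0 i)%:~R) *
  \int[haar R n]_w (b w * cos (th k w) - a w * sin (th k w)).
Proof.
move=> ha hb; set kap := 2 * pi * _.
pose f (x : 'rV[R]_n) := a x * cos (th k x) + b x * sin (th k x).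
have [Ma aM] := pC1_bound ha; have [Mb bM] := pC1_bound hb.
have [Na aN] := pC1_dbound ha; have [Nb bN] := pC1_dbound hb.
have cs := @continuous_cos_th k; have ss := @continuous_sin_th k.
pose g (x : 'rV[R]_n) := 'D_(delta_mx ord0 i) a x * cos (th k x) +
    'D_(delta_mx ord0 i) b x * sin (th k x).
pose h (x : 'rV[R]_n) := b x * cos (th k x) - a x * sin (th k x).
have fd x : is_derive x (delta_mx ord0 i) f (g x + kap * h x).
  have := derive_pC1 x ha; have := derive_pC1 x hb => db da.
  have dc := is_derive_cos_dot k x i; have ds := is_derive_sin_dot k x i.
  apply: is_derive_eq.
  by rewrite /g /h /GRing.scale /= -/kap; ring.
have fD := is_deriveE fd.
have bnd (u v : R) M : `|u| <= M -> `|v| <= 1 -> `|u * v| <= M.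
  move=> uM v1; rewrite normrM (le_trans _ uM)// ler_piMr//.
have c1 x : `|cos (th k x)| <= 1 by exact: cos_max.
have s1 x : `|sin (th k x)| <= 1 by exact: sin_max.
have gc : continuous g.
  by apply: continuous_funD; apply: continuous_funM => //; [exact: pC1_dcont ha|exact: pC1_dcont hb].
have hc : continuous h.
  by apply: continuous_funB; apply: continuous_funM => //; [exact: pC1_cont hb|exact: pC1_cont ha].
have gM x : `|g x| <= Na + Nb.
  by rewrite (le_trans (ler_normD _ _))// lerD// bnd.
have hM x : `|h x| <= Mb + Ma.
  by rewrite (le_trans (ler_normB _ _))// lerD// bnd.
have hf : periodic_C1 i f.
  split.
  - by apply: continuous_funD; apply: continuous_funM => //; [exact: pC1_cont ha|exact: pC1_cont hb].
  - by move=> x; case: (fd x).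
  - by rewrite fD; apply: continuous_funD => //; exact: continuous_funZ.
  - by exists (Ma + Mb) => x; rewrite (le_trans (ler_normD _ _))// lerD// bnd.
  - exists (Na + Nb + `|kap| * (Mb + Ma)) => x; case: (fd x) => _ ->.
    by rewrite (le_trans (ler_normD _ _))// lerD// normrM ler_wpM2l.
  - move=> x; have E : character k (x + delta_mx ord0 i) = character k x.
      exact: expi_periodic.
    rewrite /f (pC1_per ha) (pC1_per hb).
    have Ec : cos (th k (x + delta_mx ord0 i : 'rV[R]_n)) = cos (th k x).
      exact: (congr1 (@complex.Re R) E).
    have Es : sin (th k (x + delta_mx ord0 i : 'rV[R]_n)) = sin (th k x).
      exact: (congr1 (@complex.Im R) E).
    by rewrite Ec Es.
have gi := bounded_integrable (haar R n) (continuous_measurable_torus gc) gM.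
have hi := bounded_integrable (haar R n) (continuous_measurable_torus hc) hM.
have := pC1_integral0 hf; rewrite fD.
rewrite RintegralD//; last first.
  by rewrite /comp; under eq_fun do rewrite EFinM; exact: integrableZl.
rewrite RintegralZl// => /eqP; rewrite addr_eq0 => /eqP ->.
by rewrite mulNr.
Qed.

Lemma pC1_cst i (c : R) : periodic_C1 i (fun=> c).
Proof.
have D : 'D_(delta_mx ord0 i) (fun=> c) = (fun=> 0) :> ('rV[R]_n -> R).
  by apply: is_deriveE => x; exact: is_derive_cst.
split.
- exact: cst_continuous.
- by move=> x; case: (is_derive_cst c x (delta_mx ord0 i)).
- by rewrite D; exact: cst_continuous.
- by exists `|c|.
- by exists 0 => x; rewrite (congr1 (fun f => f x) D) normr0.
- by [].
Qed.

(** For [k != 0], integration by parts with constant [a] and [b] has a zero left side and a nonzero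
    factor [kap] in some direction. The choices (0, 1) and (-1, 0) give the integrals of cosine and
    sine. *)
Lemma cintegral_character (k : Zn n) :
  cintegral (haar R n) (character k) = (k == 0)%:R.
Proof.
have [->|k0] := eqVneq k 0.
  rewrite (_ : character 0 = fun=> 1); last first.
    by apply/funext => w; rewrite /character dot0l expi0.
  rewrite -[1]/((1 : R)%:C) (@cintegral_real _ _ _ (haar R n) (fun=> 1)).
  by rewrite /Rintegral (integral_prob_cst (haar R n) 1%:E).
have [i ki] := Zn_neq0 k0.
have kap0 : - (2 * pi * ((k : 'rV[int]_n) ord0 i)%:~R) != 0 :> R.
  by rewrite oppr_eq0 !mulf_neq0 ?intr_eq0// ?pnatr_eq0// gt_eqF ?pi_gt0.
have D (c : R) : 'D_(delta_mx ord0 i) (fun=> c) = (fun=> 0) :> ('rV[R]_n -> R).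
  by apply: is_deriveE => x; exact: is_derive_cst.
have Dx (c : R) (w : 'rV[R]_n) : 'D_(delta_mx ord0 i) (fun=> c) w = 0 :> R.
  exact: (congr1 (fun f => f w) (D c)).
have H (a b : R) : \int[haar R n]_w (b * cos (th k w) - a * sin (th k w)) = 0.
  have := pC1_twist k (pC1_cst i a) (pC1_cst i b).
  under [X in X = _ -> _]eq_Rintegral do rewrite !Dx !mul0r addr0.
  by rewrite {1}/Rintegral integral0 => /esym/eqP; rewrite mulf_eq0 (negbTE kap0)/= => /eqP.
apply: complex_ext; rewrite /cintegral /= /character /=.
  have := H 0 1; under eq_Rintegral do rewrite mul1r mul0r subr0.
  by [].
have := H (-1) 0; under eq_Rintegral do rewrite mul0r sub0r mulN1r opprK.
by [].
Qed.

Lemma character_conj (k : Zn n) (w : torus R n) :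
  character (- k) w = ((character k w)^*)%R.
Proof. by rewrite /character dotNl expiN. Qed.

Lemma characterD (k j : Zn n) (w : torus R n) :
  character (k + j) w = character k w * character j w.
Proof. by rewrite /character dotDl expiD. Qed.

Lemma cmod_character (k : Zn n) (w : torus R n) : cmod (character k w) = 1.
Proof. exact: cmod_expi. Qed.

Lemma orthonormal_character : orthonormal_system (haar R n) (@character R n).
Proof.
split; [exact: cmeasurable_character|exact: cmod_character|move=> i j].
rewrite -subr_eq0 -cintegral_character; apply: cintegral_ext => w.
by rewrite characterD character_conj.
Qed.

End characters_orthogonality.

Lemma orthonormal_system_comp d1 d2 d3 (I : measurableType d1) (J : measurableType d3)
    (T : measurableType d2) (R : realType) (P : probability T R)
    (chi : I -> T -> R[i]) (f : J -> I) : injective f ->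
  orthonormal_system P chi -> orthonormal_system P (fun j => chi (f j)).
Proof.
move=> fi [mchi chi1 orth]; split=> [j|j t|i j]; [exact: mchi|exact: chi1|].
by rewrite orth (inj_eq fi).
Qed.

Lemma orthonormal_system_prod d1 d2 d3 d4 (I1 : measurableType d1) (I2 : measurableType d2)
    (T1 : measurableType d3) (T2 : measurableType d4) (R : realType)
    (P1 : probability T1 R) (P2 : probability T2 R) (m : probability (T1 * T2)%type R)
    (chi1 : I1 -> T1 -> R[i]) (chi2 : I2 -> T2 -> R[i]) :
  m = (P1 \x P2)%E :> (set _ -> \bar R) ->
  orthonormal_system P1 chi1 -> orthonormal_system P2 chi2 ->
  orthonormal_system m (fun (i : I1 * I2) t => chi1 i.1 t.1 * chi2 i.2 t.2).
Proof.
move=> mE [m1 u1 o1] [m2 u2 o2].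
have mm (i : I1 * I2) : cmeasurable (fun t : T1 * T2 => chi1 i.1 t.1 * chi2 i.2 t.2).
  apply: cmeasurableM; first by apply: (cmeasurable_comp (m1 i.1)); exact: measurable_fst.
  by apply: (cmeasurable_comp (m2 i.2)); exact: measurable_snd.
have uu (i : I1 * I2) t : cmod (chi1 i.1 t.1 * chi2 i.2 t.2) = 1.
  by rewrite cmodM u1 u2 mulr1.
split=> // -[i1 i2] [j1 j2].
rewrite (cfubini12 mE); last first.
  apply: (@cintegrable_bounded _ _ _ _ _ 1%:E); last exact: ltry.
    by apply: cmeasurableM; [exact: (mm (i1, i2))|apply: cmeasurable_conj; exact: (mm (j1, j2))].
  by move=> t; rewrite cmodM cmod_conj (uu (i1, i2)) (uu (j1, j2)) mulr1.
have i2P x y : cintegrable P2 (fun t => chi2 x t * (chi2 y t)^*%R).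
  apply: (@cintegrable_bounded _ _ _ _ _ 1%:E); last exact: ltry.
    by apply: cmeasurableM; [exact: m2|apply: cmeasurable_conj; exact: m2].
  by move=> t; rewrite cmodM cmod_conj !u2 mulr1.
have i1P x y : cintegrable P1 (fun t => chi1 x t * (chi1 y t)^*%R).
  apply: (@cintegrable_bounded _ _ _ _ _ 1%:E); last exact: ltry.
    by apply: cmeasurableM; [exact: m1|apply: cmeasurable_conj; exact: m1].
  by move=> t; rewrite cmodM cmod_conj !u1 mulr1.
transitivity (cintegral P1 (fun x => cintegral P2 (fun t => chi2 i2 t * (chi2 j2 t)^*%R) *
    (chi1 i1 x * (chi1 j1 x)^*%R))).
  apply: cintegral_ext => x; rewrite [RHS]mulrC -cintegralZ//.
  by apply: cintegral_ext => y /=; rewrite rmorphM /=; ring.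
rewrite cintegralZ// o1 o2 -natrM mulnb xpair_eqE.
by rewrite andbC.
Qed.

(** * Trigonometric series and Fourier inversion *)

Section trigonometric_series.
Variables (R : realType) (n : nat).
Local Notation th k x := (2 * pi * dot k x).
Local Notation cZ := (@countZ R n).
Local Notation wt := (@weight R n).
Implicit Types (al be : Zn n -> R) (k : Zn n).

Lemma weight_ge1 k : 1 <= wt k.
Proof. by rewrite /weight lerDl ler0n. Qed.

Lemma weight_gt0 k : 0 < wt k.
Proof. exact: lt_le_trans (weight_ge1 k). Qed.

Lemma weight_ge0 k : 0 <= wt k.
Proof. exact: ltW (weight_gt0 k). Qed.

Lemma coord_le_weight k i : `|((k : 'rV[int]_n) ord0 i)%:~R| <= wt k.
Proof.
rewrite /weight -intr_norm -natr_absz.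
by rewrite ler_wpDl// ler_nat (bigD1 i)//= leq_addr.
Qed.

(** Rapid decrease in summable rather than supremum form, the form needed for termwise
    differentiation. *)
Definition rapid al :=
  forall N, cZ.-integrable setT (fun k => (wt k ^+ N * al k)%:E).

Lemma le_rapid al be : (forall k, `|al k| <= `|be k|) -> rapid be -> rapid al.
Proof.
move=> ab rb N; apply: le_integrable (rb N) => //.
by move=> k _; rewrite !abse_EFin lee_fin !normrM ler_wpM2l.
Qed.

Lemma rapid_norm al : rapid al -> rapid (fun k => `|al k|).
Proof. by apply: le_rapid => k; rewrite normr_id. Qed.

Lemma rapidD al be : rapid al -> rapid be -> rapid (fun k => al k + be k).
Proof.
move=> ra rb N; under eq_fun do rewrite mulrDr EFinD.
exact: integrableD.
Qed.

Lemma rapidN al : rapid al -> rapid (fun k => - al k).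
Proof. by apply: le_rapid => k; rewrite normrN. Qed.

Lemma rapidZ (c : R) al : rapid al -> rapid (fun k => c * al k).
Proof.
move=> ra N; under eq_fun do rewrite mulrCA EFinM.
exact: integrableZl.
Qed.

Lemma rapid_weight al : rapid al -> rapid (fun k => wt k * al k).
Proof.
by move=> ra N; have := ra N.+1; under eq_fun do rewrite exprSr -mulrA.
Qed.

Lemma rapid_integrable al : rapid al -> cZ.-integrable setT (EFin \o al).
Proof. by move=> /(_ 0); under eq_fun do rewrite expr0 mul1r. Qed.

Definition freq i k : R := 2 * pi * ((k : 'rV[int]_n) ord0 i)%:~R.

Lemma freq_le i k : `|freq i k| <= 2 * pi * wt k.
Proof.
rewrite normrM ger0_norm ?mulr_ge0 ?pi_ge0//.
by rewrite ler_wpM2l ?mulr_ge0 ?pi_ge0// coord_le_weight.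
Qed.

Lemma rapid_freq i al : rapid al -> rapid (fun k => freq i k * al k).
Proof.
move=> ra; apply: (@le_rapid _ (fun k => 2 * pi * (wt k * al k))).
  move=> k; rewrite [in leRHS]mulrA [leLHS]normrM [leRHS]normrM; apply: ler_wpM2r => //.
  by rewrite [leRHS]ger0_norm ?freq_le// !mulr_ge0 ?pi_ge0 ?weight_ge0.
exact/rapidZ/rapid_weight.
Qed.

(** Two real coefficient families make the class closed under coordinate derivatives, and the real
    and imaginary parts of a complex Fourier series both have this form. *)
Definition trig al be (x : 'rV[R]_n) : R :=
  \int[cZ]_k (al k * cos (th k x) + be k * sin (th k x)).

Lemma trig_term_le al be k (x : 'rV[R]_n) :
  `|al k * cos (th k x) + be k * sin (th k x)| <= `|al k| + `|be k|.
Proof.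
rewrite (le_trans (ler_normD _ _))// lerD// normrM ler_piMr//.
  exact: cos_max.
exact: sin_max.
Qed.

Lemma integrable_trig_term al be (x : 'rV[R]_n) : rapid al -> rapid be ->
  cZ.-integrable setT (fun k => (al k * cos (th k x) + be k * sin (th k x))%:E).
Proof.
move=> ra rb; have rs := rapid_integrable (rapidD (rapid_norm ra) (rapid_norm rb)).
apply: le_integrable rs => //.
move=> k _; rewrite !abse_EFin lee_fin (le_trans (trig_term_le al be k x))//.
by rewrite ger0_norm// addr_ge0.
Qed.

Lemma trig_le al be (x : 'rV[R]_n) : rapid al -> rapid be ->
  `|trig al be x| <= \int[cZ]_k (`|al k| + `|be k|).
Proof.
move=> ra rb; have ti := integrable_trig_term x ra rb.
rewrite (le_trans (le_normr_Rintegral _ _))//.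
apply: le_Rintegral => //.
- exact: (integrable_norm ti).
- exact: (rapid_integrable (rapidD (rapid_norm ra) (rapid_norm rb))).
- by move=> k _; exact: trig_term_le.
Qed.

(** Differentiation under the sum along the line through [x]: uniformly in [t], the derivatives of
    the terms are dominated by [G], which is summable because rapid decrease absorbs the factor
    [freq]. *)
Lemma is_derive_trig al be (x : 'rV[R]_n) i : rapid al -> rapid be ->
  is_derive x (delta_mx ord0 i) (trig al be)
    (trig (fun k => freq i k * be k) (fun k => - (freq i k * al k)) x).
Proof.
move=> ra rb; apply: is_derive_line.
pose f (t : R) (k : Zn n) := al k * cos (th k (x + t *: delta_mx ord0 i : 'rV[R]_n)) +
  be k * sin (th k (x + t *: delta_mx ord0 i : 'rV[R]_n)).
have I0 : `](-1), 1[%classic (0 : R) by rewrite /= in_itv/= ltr01 ltrN10.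
have fd (t : R) k : is_derive t 1 (f ^~ k)
    (freq i k * be k * cos (th k (x + t *: delta_mx ord0 i : 'rV[R]_n)) +
     - (freq i k * al k) * sin (th k (x + t *: delta_mx ord0 i : 'rV[R]_n))).
  have A := is_derive_affine (dot k x) ((k : 'rV[int]_n) ord0 i)%:~R t.
  have fE : f ^~ k = (fun t => al k * cos (2 * pi * (dot k x + t * ((k : 'rV[int]_n) ord0 i)%:~R)) +
      be k * sin (2 * pi * (dot k x + t * ((k : 'rV[int]_n) ord0 i)%:~R))).
    by apply/funext => u; rewrite /f dot_line.
  have dc := is_derive1_comp (is_derive_cos _) A.
  have ds := is_derive1_comp (is_derive_sin _) A.
  rewrite fE dot_line.
  apply: (is_derive_eq (is_deriveD (is_deriveZ (al k) dc) (is_deriveZ (be k) ds))).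
  by rewrite /freq /GRing.scale /=; ring.
pose G (k : Zn n) := `|freq i k * be k| + `|freq i k * al k|.
have rG : rapid G.
  by apply: rapidD; apply: rapid_norm; exact: rapid_freq.
have fi (t : R) : `](-1), 1[%classic t -> cZ.-integrable setT (EFin \o f t).
  by move=> _; exact: integrable_trig_term.
have fder (t : R) k : `](-1), 1[%classic t -> setT k -> derivable (f ^~ k) t 1.
  by move=> _ _; case: (fd t k).
have G0 k : 0 <= G k by rewrite addr_ge0.
have Gub (t : R) k : `](-1), 1[%classic t -> setT k -> `|partial1of2 f t k| <= G k.
  move=> _ _; rewrite partial1of2E; case: (fd t k) => _ ->.
  rewrite /G -[in leRHS](normrN (freq i k * al k)).
  exact: (trig_term_le (fun k => freq i k * be k) (fun k => - (freq i k * al k))).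
split.
  exact: (derivable_under_integral measurableT I0 fi fder G0 (rapid_integrable rG) Gub).
rewrite -derive1E.
have := differentiation_under_integral measurableT I0 fi fder G0 (rapid_integrable rG) Gub.
rewrite -[X in X = _ -> _]/(derive1 (fun t => trig al be (x + t *: delta_mx ord0 i)) 0) => ->.
apply: eq_Rintegral => k _; rewrite partial1of2E; case: (fd 0 k) => _ ->.
by rewrite scale0r addr0.
Qed.

(* the coefficients of the derivative of a trigonometric series along [s] *)
Fixpoint dcoef (s : seq 'I_n) (ab : (Zn n -> R) * (Zn n -> R)) :=
  if s is i :: s' then let ab' := dcoef s' ab in
    (fun k => freq i k * ab'.2 k, fun k => - (freq i k * ab'.1 k))
  else ab.

Lemma rapid_dcoef s al be : rapid al -> rapid be ->
  rapid (dcoef s (al, be)).1 /\ rapid (dcoef s (al, be)).2.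
Proof.
move=> ra rb; elim: s => [//|i s [h1 h2]] /=; split; first exact: rapid_freq.
by apply: rapidN; exact: rapid_freq.
Qed.

Lemma partials_trig s al be : rapid al -> rapid be ->
  partials s (trig al be) = trig (dcoef s (al, be)).1 (dcoef s (al, be)).2.
Proof.
move=> ra rb; elim: s => [//|i s ih].
rewrite -[LHS]/('D_(delta_mx ord0 i) (partials s (trig al be))) ih.
have [h1 h2] := rapid_dcoef s ra rb.
by apply: is_deriveE => x; exact: is_derive_trig.
Qed.

Lemma dcoef_le s al be k :
  `|(dcoef s (al, be)).1 k| + `|(dcoef s (al, be)).2 k| <=
  (2 * pi * wt k) ^+ size s * (`|al k| + `|be k|).
Proof.
elim: s => [|i s ih] /=; first by rewrite expr0 mul1r.
rewrite normrN !(normrM (freq i k)) -mulrDr addrC exprS -[leRHS]mulrA.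
by apply: ler_pM; rewrite ?addr_ge0 ?freq_le// addrC.
Qed.

Lemma cos_lip (a b : R) : `|cos a - cos b| <= `|a - b|.
Proof.
wlog ab : a b / a <= b.
  by move=> h; case: (leP a b) => [/h//|/ltW/h]; rewrite distrC [leRHS]distrC.
have [x _ ] := @MVT_segment R cos (fun x => - sin x) _ _ ab
  (fun x _ => is_derive_cos x) (continuous_subspaceT (@continuous_cos R)).
rewrite -normrN opprB => ->; rewrite normrM normrN [X in _ * X]distrC ler_piMl//.
exact: sin_max.
Qed.

Lemma sin_lip (a b : R) : `|sin a - sin b| <= `|a - b|.
Proof.
wlog ab : a b / a <= b.
  by move=> h; case: (leP a b) => [/h//|/ltW/h]; rewrite distrC [leRHS]distrC.
have [x _ ] := @MVT_segment R sin (fun x => cos x) _ _ ab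
  (fun x _ => is_derive_sin x) (continuous_subspaceT (@continuous_sin R)).
rewrite -normrN opprB => ->; rewrite normrM [X in _ * X]distrC ler_piMl//.
exact: cos_max.
Qed.

Lemma th_lip k (x y : 'rV[R]_n) e : (forall i, `|x ord0 i - y ord0 i| <= e) ->
  0 <= e -> `|th k x - th k y| <= 2 * pi * wt k * e.
Proof.
move=> xy e0; rewrite -mulrBr normrM ger0_norm ?mulr_ge0 ?pi_ge0// -mulrA.
rewrite ler_wpM2l ?mulr_ge0 ?pi_ge0// /dot -sumrB.
rewrite (le_trans (ler_norm_sum _ _ _))//.
apply: (@le_trans _ _ (\sum_i (absz ((k : 'rV[int]_n) ord0 i))%:R * e)).
  apply: ler_sum => i _; rewrite -mulrzBl -mulrzr normrM mulrC.
  by rewrite -intr_norm -natr_absz ler_wpM2l.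
by rewrite -mulr_suml ler_wpM2r// -natr_sum /weight lerDr.
Qed.

Lemma continuous_trig al be : rapid al -> rapid be -> continuous (trig al be).
Proof.
move=> ra rb x.
pose S (k : Zn n) := 2 * pi * (wt k * (`|al k| + `|be k|)).
have rS : rapid S.
  by apply/rapidZ/rapid_weight; apply: rapidD; exact: rapid_norm.
have S0 k : 0 <= S k by rewrite !mulr_ge0 ?pi_ge0 ?weight_ge0 ?addr_ge0.
pose L := \int[cZ]_k S k.
have L0 : 0 <= L by apply: Rintegral_ge0 => k _; exact: S0.
have FF : Filter (nbhs (x : 'rV[R]_n)) by exact: nbhs_filter.
apply/(@cvgrPdist_le _ _ _ _ FF) => e e0.
(* [L] is a Lipschitz constant of the series for the maximum distance; adding 1 covers [L = 0]. *)
pose d := e / (L + 1).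
have L1 : 0 < L + 1 by rewrite ltr_wpDl.
have d0 : 0 < d by rewrite divr_gt0.
near=> y.
have [_ B] : ball (x : 'rV[R]_n) d y by near: y; exact: nbhsx_ballx.
have xy i : `|x ord0 i - y ord0 i| <= d by apply: ltW; exact: (B ord0 i).
have ix := integrable_trig_term x ra rb; have iy := integrable_trig_term y ra rb.
rewrite /trig -RintegralB// (le_trans (le_normr_Rintegral _ _))//.
  by rewrite /comp; under eq_fun do rewrite EFinB; exact: integrableB.
apply: (@le_trans _ _ (\int[cZ]_k (d * S k))).
  apply: le_Rintegral => //.
  - apply: integrable_norm.
    by rewrite /comp; under eq_fun do rewrite EFinB; exact: integrableB.
  - exact: (rapid_integrable (rapidZ d rS)).
  move=> k _; have T := th_lip k xy (ltW d0).
  rewrite opprD addrACA -!mulrBr (le_trans (ler_normD _ _))// !normrM.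
  have -> : d * S k = `|al k| * (2 * pi * wt k * d) + `|be k| * (2 * pi * wt k * d).
    by rewrite /S; ring.
  by rewrite lerD// ler_wpM2l// (le_trans _ T)// ?cos_lip ?sin_lip.
rewrite RintegralZl//; last exact: rapid_integrable.
by rewrite -/L /d mulrAC ler_pdivrMr// ler_wpM2l ?ltW// ltrDl.
Unshelve. all: by end_near. Qed.

Lemma smooth_trig al be : rapid al -> rapid be -> smooth (trig al be).
Proof.
move=> ra rb s; rewrite partials_trig//; have [h1 h2] := rapid_dcoef s ra rb.
split; first exact: continuous_trig.
by move=> x i; case: (is_derive_trig x i h1 h2).
Qed.

Lemma partials_trig_le s al be N (x : 'rV[R]_n) : rapid al -> rapid be ->
  (size s <= N)%N ->
  `|partials s (trig al be) x| <=
  (2 * pi) ^+ N * \int[cZ]_k (wt k ^+ N * (`|al k| + `|be k|)).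
Proof.
move=> ra rb sN; rewrite partials_trig//; have [h1 h2] := rapid_dcoef s ra rb.
rewrite (le_trans (trig_le x h1 h2))//.
have rab := rapidD (rapid_norm ra) (rapid_norm rb).
rewrite -RintegralZl//; last exact: rab.
apply: le_Rintegral => //.
- exact: (rapid_integrable (rapidD (rapid_norm h1) (rapid_norm h2))).
- by rewrite /comp; under eq_fun do rewrite EFinM; apply: integrableZl => //; exact: rab.
move=> k _; rewrite (le_trans (dcoef_le _ _ _ _))// mulrA -exprMn ler_wpM2r ?addr_ge0//.
apply: ler_weXn2l => //; have p2 := pi_ge2 R; have w1 := weight_ge1 k.
by nra.
Qed.

End trigonometric_series.

Section weight_summable.
Variables (R : realType) (n : nat).
Local Notation cZ := (@countZ R n).
Local Notation wt := (@weight R n).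

Let box (m : nat) (a : {ffun 'I_n -> 'I_(2 * m + 1)}) : Zn n :=
  \row_i ((a i : nat)%:Z - m%:Z).

Let abssum (k : Zn n) : nat := \sum_i absz ((k : 'rV[int]_n) ord0 i).

Let mem_box (k : Zn n) : exists a, k = box (m := abssum k) a.
Proof.
have lt i : (absz (((k : 'rV[int]_n) ord0 i + (abssum k)%:Z)%R) < 2 * abssum k + 1)%N.
  have : (absz ((k : 'rV[int]_n) ord0 i) <= abssum k)%N by rewrite /abssum (bigD1 i)//= leq_addr.
  lia.
exists [ffun i => Ordinal (lt i)]; apply/rowP => i; rewrite !mxE ffunE /=.
rewrite -[LHS]/((k : 'rV[int]_n) ord0 i).
have : (absz ((k : 'rV[int]_n) ord0 i) <= abssum k)%N by rewrite /abssum (bigD1 i)//= leq_addr.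
lia.
Qed.

(** A vector with coordinate sum of size [m] lies in a box of [(2 m + 1)^n] points and has weight
    [m + 1]. The exponent [n + 2] leaves a multiple of [1 / (m + 1)^2] after counting, which a
    telescoping series dominates. *)
Lemma integrable_weight : cZ.-integrable setT (fun k => (wt k ^- (n + 2))%:E).
Proof.
have w0 k : 0 <= wt k ^- (n + 2) by rewrite invr_ge0 exprn_ge0// weight_ge0.
apply/integrableP; split=> //.
under eq_integral do rewrite gee0_abs ?lee_fin//.
(* [f m] spreads the value [(m + 1)^-(n + 2)] over the box of radius [m]. Larger boxes count [k]
   again, which only enlarges the majorant. *)
pose f (m : nat) (k : Zn n) : \bar R :=
  (\sum_(a : {ffun 'I_n -> 'I_(2 * m + 1)}) ((m.+1%:R ^- (n + 2)) * (k == box a)%:R)%:E)%E.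
have f0 m k : (0 <= f m k)%E.
  apply: sume_ge0 => a _; rewrite lee_fin mulr_ge0// invr_ge0 exprn_ge0//.
apply: (@le_lt_trans _ _ (\int[cZ]_k (\sum_(0 <= m <oo) f m k))%E).
  apply: ge0_le_integral => //.
  - by move=> k _; rewrite lee_fin.
  move=> k _; have [a ka] := mem_box k.
  apply: (@le_trans _ _ (f (abssum k) k)).
    rewrite /f (bigD1 a)//= -ka eqxx mulr1.
    rewrite (_ : wt k = (abssum k).+1%:R); last by rewrite /weight addrC natr1.
    rewrite leeDl//; apply: sume_ge0 => b _.
    by rewrite lee_fin mulr_ge0// invr_ge0 exprn_ge0.
  apply: le_trans (nneseries_lim_ge (abssum k).+1 _) => //.
  rewrite big_nat_recr//= leeDr//; exact: sume_ge0.
rewrite integral_nneseries//.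
have intf m : (\int[cZ]_k f m k = (m.+1%:R ^- (n + 2) * ((2 * m + 1) ^ n)%:R)%:E)%E.
  rewrite /f ge0_integral_sum//.
  rewrite (eq_bigr (fun=> (m.+1%:R ^- (n + 2))%:E)); last first.
    move=> a _; rewrite -(integral_point (discrete_countZ R n) (fun=> (m.+1%:R ^- (n + 2))%:E) (box a)).
    rewrite [RHS]integral_mkcond; apply: eq_integral => k _; rewrite patchE.
    by case: eqP => [->|kb]; [rewrite mem_set// mulr1|rewrite memNset// mulr0].
  by rewrite sumEFin sumr_const mulr_natr card_ffun !card_ord.
apply: (@le_lt_trans _ _ ((2 ^+ n * 2)%:E)); last exact: ltry.
apply: lime_le.
  by apply: is_cvg_nneseries => m _ _; apply: integral_ge0 => k _.
apply: nearW => N.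
(* Use [2 m + 1 <= 2 (m + 1)] and [1 / x^2 <= 2 (1 / x - 1 / (x + 1))] for [x >= 1]. *)
have term m : m.+1%:R ^- (n + 2) * ((2 * m + 1) ^ n)%:R <=
    2 ^+ n * 2 * (m.+1%:R^-1 - m.+2%:R^-1) :> R.
  have m1 : 0 < m.+1%:R :> R by [].
  apply: (@le_trans _ _ (2 ^+ n * m.+1%:R ^- 2)).
    rewrite mulrC ler_pdivrMr ?exprn_gt0//.
    rewrite (_ : 2 ^+ n * m.+1%:R ^- 2 * m.+1%:R ^+ (n + 2) = (2 * m.+1%:R) ^+ n); last first.
      by rewrite exprMn exprD [_ ^+ n * _ ^+ 2]mulrC mulrA mulfVK// expf_neq0// gt_eqF.
    by rewrite natrX; apply: lerXn2r; rewrite ?nnegrE// -natrM ler_nat; lia.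
  rewrite -mulrA ler_wpM2l ?exprn_ge0//.
  have x1 : 1 <= m.+1%:R :> R by rewrite ler1n.
  have -> : m.+2%:R = m.+1%:R + 1 :> R by rewrite natr1.
  move: (m.+1%:R : R) m1 x1 => x x0 x1.
  have xn : (x != 0) * (x + 1 != 0) by rewrite !gt_eqF// addr_gt0.
  rewrite -subr_ge0 (_ : _ - _ = (x - 1) / (x ^+ 2 * (x + 1))); last by field; rewrite !xn.
  by rewrite divr_ge0 ?subr_ge0// mulr_ge0 ?sqr_ge0// addr_ge0// ltW.
under eq_bigr do rewrite intf.
rewrite sumEFin lee_fin (le_trans (ler_sum _ (fun m _ => term m)))//.
rewrite -mulr_sumr -[leRHS]mulr1 ler_wpM2l ?mulr_ge0 ?exprn_ge0//.
rewrite big_mkord; suff -> : \sum_(i < N) (i.+1%:R^-1 - i.+2%:R^-1) = 1 - N.+1%:R^-1 :> R.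
  by rewrite gerBl invr_ge0.
elim: N => [|N ih]; first by rewrite big_ord0 invr1 subrr.
by rewrite big_ord_recr/= ih addrA subrK.
Qed.

End weight_summable.

(** * Decay of the Fourier coefficients of Schwartz functions *)

Section fourier_decay.
Variables (R : realType) (n : nat).
Local Notation wt := (@weight R n).
Local Notation th k x := (2 * pi * dot k x).
Variable F : Zn n * torus R n -> R[i].
Hypothesis hF : schwartzZT F.

Definition fourier (j l : Zn n) : R[i] :=
  cintegral (haar R n) (fun y => F (j, y) * (character l y)^*%R).

Lemma schwartzZT_bound N : exists C : R, 0 <= C /\
  forall k s (x : 'rV[R]_n), (size s <= N)%N ->
  wt k ^+ N * cmod (cpartials s (fun y => F (k, y)) x) <= C.
Proof.
case: hF => _ _ _ /(_ N); set E := seminormZT N F => Eoo.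
have ub k s (x : 'rV[R]_n) : (size s <= N)%N ->
    ((wt k ^+ N * cmod (cpartials s (fun y => F (k, y)) x))%:E <= E)%E.
  by move=> sN; apply: ereal_sup_ubound; exists k, s, x.
have E0 : (0 <= E)%E.
  apply: le_trans (ub 0 [::] 0 _) => //.
  by rewrite lee_fin mulr_ge0 ?cmod_ge0// exprn_ge0// weight_ge0.
have Ef : E \is a fin_num by rewrite ge0_fin_numE.
exists (fine E); split; first exact: fine_ge0.
by move=> k s x sN; rewrite -lee_fin fineK// ub.
Qed.

Lemma partials_periodic s (f : 'rV[R]_n -> R) v : (forall x, f (x + v) = f x) ->
  forall x, partials s f (x + v) = partials s f x.
Proof.
move=> fp; elim: s => [//|i s ih] x.
rewrite -[LHS]/('D_(delta_mx ord0 i) (partials s f) (x + v)).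
rewrite -[RHS]/('D_(delta_mx ord0 i) (partials s f) x) /derive.
rewrite (_ : (fun h : R => h^-1 *: ((partials s f \o shift (x + v)) (h *: delta_mx ord0 i) -
    partials s f (x + v))) = (fun h : R => h^-1 *:
    ((partials s f \o shift x) (h *: delta_mx ord0 i) - partials s f x)))//.
by apply/funext => h /=; rewrite ih addrA ih.
Qed.

Let re j (y : 'rV[R]_n) := complex.Re (F (j, y)).
Let im j (y : 'rV[R]_n) := complex.Im (F (j, y)).

(** Every partial derivative of a row may be integrated by parts; the seminorm of order
    [(size s).+1] bounds it together with one further derivative. *)
Let pC1 j s i : periodic_C1 i (partials s (re j)) /\ periodic_C1 i (partials s (im j)).
Proof.
case: hF => Fp sre sim _.
have [C [C0 CP]] := schwartzZT_bound (size s).+1.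
have b t (x : 'rV[R]_n) : (size t <= (size s).+1)%N ->
    cmod (cpartials t (fun y => F (j, y)) x) <= C.
  move=> ts; apply: le_trans (CP j t x ts); rewrite ler_peMl ?cmod_ge0//.
  by rewrite exprn_ege1// weight_ge1.
split; split.
- by case: (sre j s).
- by move=> x; case: (sre j s) => _; apply.
- by case: (sre j (i :: s)).
- by exists C => x; apply: le_trans (b s x (leqnSn _)); exact: (Re_le_cmod (cpartials s _ x)).
- exists C => x; apply: le_trans (b (i :: s) x _) => //.
  exact: (Re_le_cmod (cpartials (i :: s) (fun y => F (j, y)) x)).
- by apply: partials_periodic => x; rewrite /re Fp.
- by case: (sim j s).
- by move=> x; case: (sim j s) => _; apply.
- by case: (sim j (i :: s)).
- by exists C => x; apply: le_trans (b s x (leqnSn _)); exact: (Im_le_cmod (cpartials s _ x)).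
- exists C => x; apply: le_trans (b (i :: s) x _) => //.
  exact: (Im_le_cmod (cpartials (i :: s) (fun y => F (j, y)) x)).
- by apply: partials_periodic => x; rewrite /im Fp.
Qed.

Let cf j s l := cintegral (haar R n)
  (fun y => cpartials s (fun y => F (j, y)) y * (character l y)^*%R).

(** In complex terms a derivative multiplies the coefficient by [i * freq]. The real part is
    [pC1_twist] for the real and imaginary parts of the row, the imaginary part is [pC1_twist] for
    the rotated pair [b], [- a]. *)
Let cf_step j s i l : cmod (cf j (i :: s) l) = `|freq R i l| * cmod (cf j s l).
Proof.
have [ha hb] := pC1 j s i.
set a := partials s (re j) in ha; set b := partials s (im j) in hb.
have hna : periodic_C1 i (fun x => - a x).
  have D : 'D_(delta_mx ord0 i) (fun x => - a x) = fun x => - 'D_(delta_mx ord0 i) a x.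
    by apply: is_deriveE => x; apply: is_deriveN; exact: derive_pC1.
  case: (ha) => h1 h2 h3 [M h4] [M' h5] h6; split.
  - by move=> x; exact: (cvgN (h1 x)).
  - by move=> x; exact: derivableN.
  - by rewrite D => x; exact: (cvgN (h3 x)).
  - by exists M => x; rewrite normrN.
  - by exists M' => x; rewrite (congr1 (fun f => f x) D) normrN.
  - by move=> x; rewrite h6.
have Dna x : 'D_(delta_mx ord0 i) (fun x => - a x) x = - 'D_(delta_mx ord0 i) a x.
  by rewrite deriveN//; case: ha.
have UE (w : 'rV[R]_n) : cpartials s (fun y => F (j, y)) w = a w +i* b w by [].
have UE' (w : 'rV[R]_n) : cpartials (i :: s) (fun y => F (j, y)) w =
    ('D_(delta_mx ord0 i) a w) +i* ('D_(delta_mx ord0 i) b w) by [].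
have reE : complex.Re (cf j (i :: s) l) = - freq R i l * complex.Im (cf j s l).
  transitivity (\int[haar R n]_w ('D_(delta_mx ord0 i) a w * cos (th l w) +
    'D_(delta_mx ord0 i) b w * sin (th l w))).
    by apply: eq_Rintegral => w _; rewrite ?UE ?UE' !complexE /=; ring.
  rewrite pC1_twist//; congr (_ * _).
  by apply: eq_Rintegral => w _; rewrite ?UE ?UE' !complexE /=; ring.
have imE : complex.Im (cf j (i :: s) l) = freq R i l * complex.Re (cf j s l).
  transitivity (\int[haar R n]_w ('D_(delta_mx ord0 i) b w * cos (th l w) +
    'D_(delta_mx ord0 i) (fun x => - a x) w * sin (th l w))).
    by apply: eq_Rintegral => w _; rewrite Dna UE' !complexE /=; ring.
  rewrite pC1_twist// -[complex.Re (cf j s l)]opprK mulrN -mulNr; congr (_ * _).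
  rewrite -mulN1r -RintegralZl//.
    by apply: eq_Rintegral => w _; rewrite ?UE ?UE' !complexE /=; ring.
  have [[Ma aM] [Mb bM]] := (pC1_bound ha, pC1_bound hb).
  apply: (@bounded_integrable _ _ _ (haar R n) _ (Ma + Mb)).
    have [mc ms] := cmeasurable_character R l.
    rewrite (_ : (fun _ => _) = (fun y => a y * complex.Re (character l y) + b y * complex.Im (character l y))).
      by apply: measurable_funD; apply: measurable_funM => //; apply: continuous_measurable_torus;
        [exact: pC1_cont ha|exact: pC1_cont hb].
    by apply/funext => y; rewrite UE !complexE /=; ring.
  move=> x; rewrite UE ReM Re_conj Im_conj mulrN opprK.
  apply: (le_trans (ler_normD _ _)); apply: lerD; rewrite [leLHS]normrM -[leRHS]mulr1;
    apply: ler_pM => //; [exact: aM|exact: cos_max|exact: bM|exact: sin_max].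
apply/eqP; rewrite -(@eqrXn2 _ 2) ?mulr_ge0 ?cmod_ge0//; apply/eqP.
by rewrite exprMn !cmod_sqr reE imE real_normK ?num_real//; ring.
Qed.

Let cf_le j s l C : (forall x : 'rV[R]_n, cmod (cpartials s (fun y => F (j, y)) x) <= C) ->
  cmod (cf j s l) <= C.
Proof.
move=> sC; rewrite -lee_fin.
have m : cmeasurable (fun y : torus R n => cpartials s (fun y => F (j, y)) y * (character l y)^*%R).
  apply: cmeasurableM; last by apply: cmeasurable_conj; exact: cmeasurable_character.
  case: hF => _ sre sim _; split; apply: continuous_measurable_torus.
    by case: (sre j s).
  by case: (sim j s).
apply: (le_trans (cmod_cintegral_le _)).
  apply: (@cintegrable_bounded _ _ _ (haar R n) _ C%:E m _ (ltry _)).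
  by move=> t; rewrite cmodM cmod_conj cmod_character mulr1 lee_fin.
rewrite -[leRHS](integral_prob_cst (haar R n)); apply: ge0_le_integral => //.
- by move=> t _; rewrite lee_fin cmod_ge0.
- exact: measurable_ecmod.
- by move=> t _; rewrite cmodM cmod_conj cmod_character mulr1 lee_fin.
Qed.

(** Differentiating [N] times in the single direction where [l] has its largest coordinate suffices,
    because that coordinate controls the whole weight of [l]. Decay in [j] is already part of the
    seminorm. *)
Lemma fourier_decay N : exists C : R, 0 <= C /\ forall j l,
  wt j ^+ N * wt l ^+ N * cmod (fourier j l) <= C.
Proof.
have [C [C0 CP]] := schwartzZT_bound N.
exists (n.+1%:R ^+ N * C); split; first by rewrite mulr_ge0// exprn_ge0.
move=> j l.
have wj : 0 < wt j ^+ N by rewrite exprn_gt0// weight_gt0.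
have cE s : (size s <= N)%N -> cmod (cf j s l) <= C / wt j ^+ N.
  by move=> sN; apply: cf_le => x; rewrite ler_pdivlMr// mulrC CP.
have f0 : fourier j l = cf j [::] l.
  by apply: cintegral_ext => y; congr (_ * _); rewrite /cpartials /=; case: (F (j, y)).
have pw i k : cmod (cf j (nseq k i) l) = `|freq R i l| ^+ k * cmod (cf j [::] l).
  by elim: k => [|k ih]; rewrite ?expr0 ?mul1r//= cf_step ih exprS mulrA.
have fi i : `|freq R i l| ^+ N * cmod (fourier j l) <= C / wt j ^+ N.
  by rewrite f0 -pw cE// size_nseq.
have fz : cmod (fourier j l) <= C / wt j ^+ N by rewrite f0 cE.
(* [m] is the largest [|l_i|], so that [1 + sum |l_i| <= m + n m]. For [l = 0] the value is 1 and no
   derivative is taken. *)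
have [m wm mC] : exists2 m : R, 0 <= m /\ wt l <= n.+1%:R * m &
    m ^+ N * cmod (fourier j l) <= C / wt j ^+ N.
  pose d i : nat := absz ((l : 'rV[int]_n) ord0 i).
  have dfreq i : (d i)%:R <= `|freq R i l|.
    rewrite /freq normrM ger0_norm ?mulr_ge0 ?pi_ge0// -intr_norm -natr_absz -/(d i).
    by rewrite ler_peMl//; have := pi_ge2 R; lra.
  have [[i i1 imax]|no] : (exists2 i, (0 < d i)%N & forall j, (d j <= d i)%N) \/ forall i, d i = 0%N.
    have [[i0 i01]|no] := pselect (exists i, (0 < d i)%N); last first.
      right=> i; apply/eqP; rewrite -leqn0 leqNgt; apply/negP => di.
      by apply: no; exists i.
    left; case: (@arg_maxnP _ i0 xpredT d isT) => i _ imax; exists i => //.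
      exact: leq_trans i01 (imax _ _).
    by move=> k; exact: imax.
  - exists (d i)%:R.
      split=> //; rewrite /weight -natrM -[1]/(1%:R) -natrD ler_nat mulSn.
      rewrite leq_add//; apply: (@leq_trans (\sum_(k < n) d i)%N).
        by apply: leq_sum => k _; exact: imax.
      by rewrite sum_nat_const card_ord.
    apply: le_trans (fi i); rewrite ler_wpM2r ?cmod_ge0//.
    by apply: lerXn2r; rewrite ?nnegrE.
  - exists 1; last by rewrite expr1n mul1r.
    split=> //; rewrite mulr1 /weight big1 ?addr0 ?ler1n// => i _.
    exact: no.
have [m0 wm'] := wm.
rewrite -mulrA mulrC -ler_pdivlMr// -mulrA -(ler_pM2l (_ : 0 < 1)) ?mul1r//.
apply: (@le_trans _ _ (n.+1%:R ^+ N * (m ^+ N * cmod (fourier j l)))).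
  rewrite mulrA -exprMn ler_wpM2r ?cmod_ge0//.
  by apply: lerXn2r; rewrite ?nnegrE ?mulr_ge0// weight_ge0.
by rewrite ler_wpM2l ?exprn_ge0.
Qed.

End fourier_decay.

(** * Fejer kernels on the torus *)

Section fejer.
Variables (R : realType) (n : nat).
Local Notation th k x := (2 * pi * dot k x).

Definition zvec (k : Zn n) : 'rV[R]_n := \row_i ((k : 'rV[int]_n) ord0 i)%:~R.

Lemma periodic_zvec (X : Type) (u : 'rV[R]_n -> X) :
  (forall x i, u (x + delta_mx ord0 i) = u x) -> forall k x, u (x + zvec k) = u x.
Proof.
move=> up k x.
have un i (m : nat) y : u (y + m%:R *: delta_mx ord0 i) = u y.
  elim: m => [|m ih] in y *; first by rewrite scale0r addr0.
  by rewrite -natr1 scalerDl scale1r addrA up ih.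
have uz i (m : int) y : u (y + m%:~R *: delta_mx ord0 i) = u y.
  case: m => m; first exact: un.
  by rewrite NegzE mulrNz scaleNr -(un i m.+1 (y - _)) subrK.
rewrite [zvec k]row_sum_delta.
under eq_bigr do rewrite mxE.
elim: (index_enum _) x => [|i r ih] x; first by rewrite big_nil addr0.
by rewrite big_cons addrA ih uz.
Qed.

(* A Korovkin-type estimate: away from the integer translates of [x] the test
   function [\sum_i (1 - cos (2 pi (y_i - x_i)))] is bounded below. *)
Lemma korovkin (u : 'rV[R]_n -> R[i]) (M : R) (x : 'rV[R]_n) (e : R) :
  continuous (fun y => complex.Re (u y)) -> continuous (fun y => complex.Im (u y)) ->
  (forall y i, u (y + delta_mx ord0 i) = u y) -> (forall y, cmod (u y) <= M) -> 0 < e ->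
  exists C : R, 0 <= C /\ forall y,
    cmod (u y - u x) <= e + C * \sum_i (1 - cos (2 * pi * (y ord0 i - x ord0 i))).
Proof.
move=> cre cim up uM e0.
have FF : Filter (nbhs x) by exact: nbhs_filter.
have e2 : 0 < e / 2 by rewrite divr_gt0.
have h1 : \forall y \near x, `|complex.Re (u x) - complex.Re (u y)| < e / 2.
  by have /(@cvgrPdist_lt _ _ _ _ FF) := cre x; apply.
have h2 : \forall y \near x, `|complex.Im (u x) - complex.Im (u y)| < e / 2.
  by have /(@cvgrPdist_lt _ _ _ _ FF) := cim x; apply.
have [d' /= d'0 hd'] := proj1 (nbhs_ballP _ _) (filterI h1 h2).
pose d := Num.min d' (1 / 2).
have d0 : 0 < d by rewrite lt_min d'0 divr_gt0.
have d12 : d <= 1 / 2 by rewrite ge_min lexx orbT.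
have near_x (y : 'rV[R]_n) : (forall i, `|x ord0 i - y ord0 i| < d) -> cmod (u y - u x) <= e.
  move=> xy; have [|r i] := hd' y.
    split=> // i j; rewrite ord1; apply: lt_le_trans (xy j) _.
    by rewrite ge_min lexx.
  rewrite cmodBC (le_trans (cmod_le _))// !complexE /= (splitr e).
  by rewrite lerD// ltW.
have pg := pi_gt0 R.
pose c := 1 - cos (2 * pi * d).
have c0 : 0 < c.
  rewrite subr_gt0 -[ltRHS]cos0 ltr_cos ?in_itv/= ?lexx ?mulr_gt0//.
    by rewrite ltW.
  by apply/andP; split; nra.
have far t : d <= `|t| <= 1 / 2 -> c <= 1 - cos (2 * pi * t).
  move=> /andP[dt t12]; rewrite lerD2l lerN2.
  have -> : cos (2 * pi * t) = cos (2 * pi * `|t|).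
    by case: (leP 0 t) => [/ger0_norm ->//|/ltr0_norm ->]; rewrite mulrN cosN.
  have [<-//|dt'] := eqVneq d `|t|.
  rewrite ltW// ltr_cos ?in_itv/=.
  - by rewrite ltr_pM2l ?mulr_gt0// lt_neqAle dt'.
  - by apply/andP; split; [nra|nra].
  - by apply/andP; split; nra.
have w0 (y : 'rV[R]_n) i : 0 <= 1 - cos (2 * pi * (y ord0 i - x ord0 i)) by rewrite subr_ge0 cos_le1.
have M0 : 0 <= M by exact: le_trans (cmod_ge0 _) (uM x).
exists (2 * M / c); split; first by rewrite divr_ge0 ?mulr_ge0// ltW.
move=> y0.
pose k : Zn n := \row_i Num.floor (y0 ord0 i - x ord0 i + 1 / 2).
pose y := y0 - zvec k.
have yE i : y ord0 i = y0 ord0 i - (Num.floor (y0 ord0 i - x ord0 i + 1 / 2))%:~R.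
  by rewrite !mxE.
have uy : u y0 = u y by rewrite -(periodic_zvec up k y) subrK.
have cE i : cos (2 * pi * (y0 ord0 i - x ord0 i)) = cos (2 * pi * (y ord0 i - x ord0 i)).
  set m := Num.floor (y0 ord0 i - x ord0 i + 1 / 2).
  have -> : y0 ord0 i - x ord0 i = (y ord0 i - x ord0 i) + m%:~R.
    by rewrite yE -/m; ring.
  have := congr1 (@complex.Re R) (expiD (y ord0 i - x ord0 i) m%:~R).
  by rewrite expi_int mulr1.
under eq_bigr do rewrite cE.
rewrite uy.
have yx i : `|y ord0 i - x ord0 i| <= 1 / 2.
  rewrite yE; set t := y0 ord0 i - x ord0 i + 1 / 2.
  have := floor_itv t; rewrite intrD1 => /andP[f1 f2].
  have -> : y0 ord0 i - (Num.floor t)%:~R - x ord0 i = t - (Num.floor t)%:~R - 1 / 2.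
    by rewrite /t; ring.
  by rewrite ler_norml; apply/andP; split; lra.
have S0 : 0 <= \sum_i (1 - cos (2 * pi * (y ord0 i - x ord0 i))).
  by apply: sumr_ge0 => i _; exact: w0.
have [[i di]|near_y] := pselect (exists i, d <= `|y ord0 i - x ord0 i|); last first.
  apply: (@le_trans _ _ e); last by rewrite lerDl mulr_ge0// divr_ge0 ?mulr_ge0// ltW.
  apply: near_x => i; rewrite distrC ltNge; apply/negP => di.
  by apply: near_y; exists i.
apply: (@le_trans _ _ (2 * M)).
  by rewrite (le_trans (cmodB _ _))// mulr_natl mulr2n lerD.
apply: ler_wpDl; first exact: ltW.
rewrite -mulrA ler_peMr ?mulr_ge0// mulrC ler_pdivlMr// mul1r (bigD1 i)//=.
apply: (@le_trans _ _ (1 - cos (2 * pi * (y ord0 i - x ord0 i)))).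
  by apply: far; rewrite di yx.
by rewrite lerDl; apply: sumr_ge0 => j _; exact: w0.
Qed.

Variable m : nat.
Local Notation N := m.+1.
Local Notation A := {ffun 'I_n -> 'I_N}.
Variable x : torus R n.

Let iota_ (a : A) : Zn n := \row_i (a i : nat)%:Z.

Let iota_inj : injective iota_.
Proof.
move=> a b ab; apply/ffunP => i; apply: val_inj => /=.
have := congr1 (fun k : Zn n => (k : 'rV[int]_n) ord0 i) ab.
by rewrite /iota_ !mxE => -[].
Qed.

Let sh k y : R[i] := character k x * ((character k y)^*)%R.

Let shD k l y : sh (k - l) y = sh k y * ((sh l y)^*)%R.
Proof. by rewrite /sh !characterD !character_conj !rmorphM /= !conjCK; ring. Qed.

Let D y : R[i] := \sum_(a : A) sh (iota_ a) y.

(** The n-dimensional Fejer kernel centred at [x], as the normalized squared modulus of a Dirichlet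
    sum over the cube of vectors with coordinates in 0, ..., m. Positivity is immediate in this
    form. *)
Definition fejer (y : torus R n) : R := (N ^ n)%:R^-1 * cmod (D y) ^+ 2.

Lemma fejer_ge0 y : 0 <= fejer y.
Proof. by rewrite mulr_ge0 ?invr_ge0 ?sqr_ge0// ler0n. Qed.

Lemma fejerE y : (fejer y)%:C = ((N ^ n)%:R^-1)%:C *
  \sum_(a : A) \sum_(b : A) sh (iota_ a - iota_ b) y.
Proof.
rewrite /fejer rmorphM /=; congr (_ * _); rewrite -mul_conj /D rmorph_sum /= mulr_suml.
apply: eq_bigr => a _; rewrite mulr_sumr; apply: eq_bigr => b _.
by rewrite shD.
Qed.

Let csh k : cmeasurable (sh k).
Proof.
apply: cmeasurableM; first exact: cmeasurable_cst.
by apply: cmeasurable_conj; exact: cmeasurable_character.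
Qed.

Let sh1 k y : cmod (sh k y) = 1.
Proof. by rewrite /sh cmodM cmod_conj !cmod_character mulr1. Qed.

Lemma measurable_fejer : measurable_fun setT fejer.
Proof.
apply: measurable_funM; first exact: measurable_cst.
apply: measurable_funX; apply: measurable_cmod.
by apply: cmeasurable_sum => a; exact: csh.
Qed.

Let cintegrable_sh_mul (v : torus R n -> R[i]) k : cintegrable (haar R n) v ->
  cintegrable (haar R n) (fun y => v y * sh k y).
Proof.
move=> vi; apply: (@le_cintegrable _ _ _ _ _ (fun y => cmod (v y))).
- by apply: cmeasurableM; [exact: cintegrable_cmeasurable vi|exact: csh].
- by move=> y; rewrite cmodM sh1 mulr1.
- exact: cintegrable_cmod.
Qed.

(** Integration against the kernel sees only finitely many Fourier coefficients of [v]; in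
    particular it gives 0 when they all vanish. *)
Lemma cintegral_fejer (v : torus R n -> R[i]) : cintegrable (haar R n) v ->
  cintegral (haar R n) (fun y => v y * (fejer y)%:C) = ((N ^ n)%:R^-1)%:C *
  \sum_(a : A) \sum_(b : A) character (iota_ a - iota_ b) x *
    cintegral (haar R n) (fun y => v y * ((character (iota_ a - iota_ b) y)^*)%R).
Proof.
move=> vi.
have i1 (a b : A) : cintegrable (haar R n) (fun y => v y * sh (iota_ a - iota_ b) y).
  exact: cintegrable_sh_mul.
transitivity (cintegral (haar R n) (fun y => ((N ^ n)%:R^-1)%:C *
    (\sum_(a : A) \sum_(b : A) v y * sh (iota_ a - iota_ b) y))).
  apply: cintegral_ext => y; rewrite fejerE mulrCA; congr (_ * _).
  rewrite mulr_sumr; apply: eq_bigr => a _; rewrite mulr_sumr.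
  by apply: eq_bigr => b _.
rewrite cintegralZ; last by apply: cintegrable_sum => a; exact: cintegrable_sum.
congr (_ * _); rewrite cintegral_sum; last by move=> a; exact: cintegrable_sum.
apply: eq_bigr => a _; rewrite cintegral_sum//; apply: eq_bigr => b _.
rewrite -cintegralZ; first by apply: cintegral_ext => y; rewrite /sh; ring.
apply: (@le_cintegrable _ _ _ _ _ (fun y => cmod (v y))).
- apply: cmeasurableM; first exact: cintegrable_cmeasurable vi.
  by apply: cmeasurable_conj; exact: cmeasurable_character.
- by move=> y; rewrite cmodM cmod_conj cmod_character mulr1.
- exact: cintegrable_cmod.
Qed.

Let bounded_cint (v : torus R n -> R[i]) M : cmeasurable v -> (forall y, cmod (v y) <= M) ->
  cintegrable (haar R n) v.
Proof.
move=> mv vM; apply: (@cintegrable_bounded _ _ _ _ _ M%:E) => //; last exact: ltry.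
Qed.

Let Nn0 : ((N ^ n)%:R : R) != 0.
Proof. by rewrite pnatr_eq0 expn_eq0. Qed.

(** By orthogonality only the [N ^ n] diagonal pairs [a = b] contribute, which the normalization
    cancels. *)
Lemma fejer_int1 : \int[haar R n]_y fejer y = 1.
Proof.
apply: (congr1 (@complex.Re R) (_ : (_)%:C = 1)).
rewrite -cintegral_real.
transitivity (cintegral (haar R n) (fun y => 1 * (fejer y)%:C)).
  by apply: cintegral_ext => y; rewrite mul1r.
rewrite cintegral_fejer; last by apply: (@bounded_cint _ 1) => [|y]; [exact: cmeasurable_cst|rewrite cmod1].
rewrite (eq_bigr (fun=> 1)); last first.
  move=> a _; rewrite (bigD1 a)//= big1 ?addr0 => [|b ba].
    rewrite subrr (_ : (fun y => _) = (fun y => character (- 0) y)).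
      by rewrite oppr0 cintegral_character eqxx mulr1 /character dot0l expi0.
    by apply/funext => y; rewrite mul1r character_conj.
  rewrite (_ : (fun y => _) = (fun y => character (- (iota_ a - iota_ b)) y)).
    rewrite cintegral_character oppr_eq0 subr_eq0 (inj_eq iota_inj) eq_sym (negbTE ba).
    by rewrite mulr0.
  by apply/funext => y; rewrite mul1r character_conj.
rewrite sumr_const card_ffun !card_ord -[X in _ * X](rmorph_nat (@real_complex R)).
by rewrite -rmorphM /= mulVf.
Qed.

Let unit_ i : Zn n := delta_mx ord0 i.

Let count_last i : ((\sum_(a : A) (a i == ord_max)) * N = N ^ n)%N.
Proof.
have E : (\sum_(a : A) (a i == ord_max))%N = #|family (fun j => if j == i then pred1 (ord_max : 'I_N) else predT)|.
  rewrite -sum1_card [RHS]big_mkcond /=; apply: eq_bigr => a _.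
  rewrite (_ : (a \in family _) = (a i == ord_max)); first by case: ifP.
  apply/familyP/idP => [/(_ i)|ai j]; first by rewrite eqxx inE.
  by case: ifP => [/eqP ->|_]; rewrite inE.
rewrite E card_family foldrE big_map big_enum /= (bigD1 i)//= eqxx card1 mul1n.
rewrite (eq_bigr (fun=> N)) => [|j ji]; last by rewrite (negbTE ji) card_ord.
rewrite prod_nat_const mulnC -expnS; congr (_ ^ _)%N.
rewrite -[X in #|X|]/(predC1 i : pred _) cardC1 card_ord prednK//.
exact: leq_ltn_trans (ltn_ord i).
Qed.

(** The cosine is the real part of the character of the [i]-th unit vector, so the integral is the
    proportion of pairs in the cube with [a = b] plus that vector. Only a fraction [1 / N] of the
    [b] lacks a partner. *)
Lemma fejer_int_cos i : 1 - \int[haar R n]_y (cos (2 * pi * ((y : 'rV[R]_n) ord0 i - (x : 'rV[R]_n) ord0 i)) * fejer y) <=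
  N%:R^-1.
Proof.
pose v (y : torus R n) : R[i] := ((character (unit_ i) x)^*)%R * character (unit_ i) y.
have dE (y : torus R n) : dot (unit_ i) y = (y : 'rV[R]_n) ord0 i.
  rewrite /dot (bigD1 i)//= big1 ?addr0 => [|j ji]; rewrite mxE eqxx/=.
    by rewrite eqxx mulr1z.
  by rewrite (negbTE ji) mulr0z.
have vi : cintegrable (haar R n) v.
  apply: (@bounded_cint _ 1).
    by apply: cmeasurableM; [exact: cmeasurable_cst|exact: cmeasurable_character].
  by move=> y; rewrite cmodM cmod_conj !cmod_character mulr1.
have -> : \int[haar R n]_y (cos (2 * pi * ((y : 'rV[R]_n) ord0 i - (x : 'rV[R]_n) ord0 i)) * fejer y) =
    complex.Re (cintegral (haar R n) (fun y => v y * (fejer y)%:C)).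
  apply: eq_Rintegral => y _.
  rewrite (_ : v y = expi ((y : 'rV[R]_n) ord0 i - (x : 'rV[R]_n) ord0 i)).
    by rewrite ReM /= mulr0 subr0.
  by rewrite /v /character !dE -expiN -expiD addrC.
rewrite cintegral_fejer//.
pose ev (a b : A) : bool := iota_ a == iota_ b + unit_ i.
have termE (a b : A) : character (iota_ a - iota_ b) x *
    cintegral (haar R n) (fun y => v y * ((character (iota_ a - iota_ b) y)^*)%R) =
    (ev a b)%:R.
  have -> : cintegral (haar R n) (fun y => v y * ((character (iota_ a - iota_ b) y)^*)%R) =
      ((character (unit_ i) x)^*)%R * (unit_ i == iota_ a - iota_ b)%:R.
    rewrite -subr_eq0 -cintegral_character -cintegralZ.
      by apply: cintegral_ext => y; rewrite /v (characterD (unit_ i)) character_conj mulrA.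
    apply: (@bounded_cint _ 1) => [|y]; first exact: cmeasurable_character.
    by rewrite cmod_character.
  rewrite [unit_ i == _]eq_sym subr_eq [unit_ i + _]addrC /ev.
  case: eqP => [->|_]; last by rewrite !mulr0.
  by rewrite [iota_ b + _]addrC addrK mulr1 mul_conj cmod_character expr1n.
under eq_bigr do under eq_bigr do rewrite termE.
set S := \sum_(a : A) _.
have SE : S = ((\sum_(a : A) \sum_(b : A) ev a b)%N%:R)%:C.
  rewrite [RHS]rmorph_nat natr_sum; apply: eq_bigr => a _.
  by rewrite natr_sum.
rewrite SE -rmorphM /=.
(* Each [b] either has last possible [i]-th coordinate or has the partner obtained by raising that
   coordinate by one. *)
have cnt : (N ^ n <= (\sum_(a : A) \sum_(b : A) ev a b) +
    \sum_(a : A) (a i == ord_max))%N.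
  rewrite exchange_big /= -big_split /=.
  have -> : (N ^ n = \sum_(b : A) 1)%N by rewrite sum1_card card_ffun !card_ord.
  apply: leq_sum => b _; case: (eqVneq (b i) ord_max) => [_|bi]; first by rewrite addn1.
  have lt : ((b i).+1 < N)%N.
    rewrite ltn_neqAle ltn_ord andbT; apply: contra bi => /eqP bi.
    by apply/eqP; apply: val_inj => /=; case: bi.
  rewrite addn0 (bigD1 [ffun j => if j == i then Ordinal lt else b j])//=.
  rewrite (_ : ev _ b); first by rewrite leq_addr.
  apply/eqP/rowP => j; rewrite !mxE ffunE eqxx /=; case: eqVneq => [->|ji] /=.
    by rewrite -addn1 PoszD.
  by rewrite addr0.
have N0 : 0 < N%:R :> R by rewrite ltr0n.
have NN : 0 < (N ^ n)%:R :> R by rewrite ltr0n expn_gt0.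
rewrite lerBlDr -(ler_pM2l NN) mulr1 mulrDr mulrA mulfV// mul1r.
have -> : (N ^ n)%:R * N%:R^-1 = (\sum_(a : A) (a i == ord_max))%N%:R :> R.
  by rewrite -(count_last i) natrM mulfK// gt_eqF.
by rewrite -natrD ler_nat addnC.
Qed.

End fejer.

(** * Uniqueness of Fourier coefficients *)

Section fourier_uniqueness.
Variables (R : realType) (n : nat).

(** With vanishing coefficients, [u x] is minus the integral of [u y - u x] against the Fejer
    kernel. The Korovkin estimate and [fejer_int_cos] bound it by [e / 2 + C * n / (m + 1)], where
    [C] depends on [e] but not on [m]. *)
Lemma fourier_uniqueness (u : 'rV[R]_n -> R[i]) (M : R) :
  continuous (fun y => complex.Re (u y)) -> continuous (fun y => complex.Im (u y)) ->
  (forall y i, u (y + delta_mx ord0 i) = u y) -> (forall y, cmod (u y) <= M) ->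
  (forall k : Zn n, cintegral (haar R n) (fun y => u y * ((character k y)^*)%R) = 0) ->
  forall x, u x = 0.
Proof.
move=> cre cim up uM u0 x; apply: cmod_eq0; apply/eqP; rewrite eq_le cmod_ge0 andbT.
apply/ler_addgt0Pl => e e0; rewrite addr0.
have e2 : 0 < e / 2 by rewrite divr_gt0.
have [C [C0 CP]] := korovkin x cre cim up uM e2.
have mu : @cmeasurable _ (torus R n) R u.
  by split; exact: continuous_measurable_torus.
have ui : cintegrable (haar R n) u.
  by apply: (@cintegrable_bounded _ _ _ (haar R n) _ M%:E mu) => //; exact: ltry.
have bound (m : nat) : cmod (u x) <= e / 2 + C * (n%:R / m.+1%:R).
  have mf := measurable_fejer m x; have f0 := fejer_ge0 m (x : torus R n).
  have fi : (haar R n).-integrable setT (EFin \o fejer m x).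
    apply/integrableP; split; first exact/measurable_EFinP.
    have := fejer_int1 m x; rewrite /Rintegral.
    under [in X in _ -> X]eq_integral do rewrite /= ger0_norm//.
    case: (\int[haar R n]_y (fejer m x y)%:E)%E => [r _|/=|//]; first exact: ltry.
    by move/eqP; rewrite eq_sym oner_eq0.
  have cfi : cintegrable (haar R n) (fun y => (fejer m x y)%:C).
    by split=> //=; exact: integrable0.
  have ufi : cintegrable (haar R n) (fun y => u y * (fejer m x y)%:C).
    apply: (@le_cintegrable _ _ _ _ _ (fun y => M * fejer m x y)).
    - by apply: cmeasurableM => //; exact: cmeasurable_real.
    - by move=> y; rewrite cmodM cmod_real ger0_norm// ler_wpM2r.
    - by rewrite /comp; under eq_fun do rewrite EFinM; exact: integrableZl.
  have Z : cintegral (haar R n) (fun y => u y * (fejer m x y)%:C) = 0.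
    rewrite cintegral_fejer// big1 ?mulr0// => a _; rewrite big1// => b _.
    by rewrite u0 mulr0.
  have E : u x = - cintegral (haar R n) (fun y => (u y - u x) * (fejer m x y)%:C).
    rewrite (_ : (fun y => _) = (fun y => u y * (fejer m x y)%:C - u x * (fejer m x y)%:C)); last first.
      by apply/funext => y; rewrite mulrBl.
    rewrite cintegralB//; last exact: cintegrableZ.
    by rewrite Z sub0r opprK cintegralZ// cintegral_real fejer_int1 mulr1.
  pose W (y : torus R n) i := 1 - cos (2 * pi * ((y : 'rV[R]_n) ord0 i - x ord0 i)).
  have mcos i : measurable_fun setT (fun y : torus R n => cos (2 * pi * ((y : 'rV[R]_n) ord0 i - x ord0 i))).
    have := cmeasurable_expi (_ : measurable_fun setT (fun y : torus R n => (y : 'rV[R]_n) ord0 i - x ord0 i)).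
    move=> /(_ _)[] //.
    by apply: measurable_funB; [exact: measurable_torus_coord|exact: measurable_cst].
  have ci i : (haar R n).-integrable setT (fun y => (cos (2 * pi * ((y : 'rV[R]_n) ord0 i - x ord0 i)) * fejer m x y)%:E).
    apply: (le_integrable _ _ _ fi) => //.
      by apply/measurable_EFinP; exact: measurable_funM.
    by move=> y _; rewrite !abse_EFin lee_fin /= normrM ler_piMl// cos_max.
  have Wi i : (haar R n).-integrable setT (fun y => (W y i * fejer m x y)%:E).
    by under eq_fun do rewrite /W mulrBl mul1r EFinB; exact: integrableB.
  have WI i : \int[haar R n]_y (W y i * fejer m x y) <= m.+1%:R^-1.
    under eq_Rintegral do rewrite /W mulrBl mul1r.
    have -> : \int[haar R n]_y (fejer m x y - cos (2 * pi * ((y : 'rV[R]_n) ord0 i - x ord0 i)) * fejer m x y) =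
        \int[haar R n]_y fejer m x y -
        \int[haar R n]_y (cos (2 * pi * ((y : 'rV[R]_n) ord0 i - x ord0 i)) * fejer m x y).
      exact: (RintegralB measurableT fi (ci i)).
    by rewrite fejer_int1; exact: fejer_int_cos.
  have Si : (haar R n).-integrable setT (fun y => (\sum_i W y i * fejer m x y)%:E).
    under eq_fun do rewrite -sumEFin.
    by apply: (@integrable_sum _ _ _ _ _ measurableT _ _ xpredT (fun i y => (W y i * fejer m x y)%:E)) => i _.
  have dfi : cintegrable (haar R n) (fun y => (u y - u x) * (fejer m x y)%:C).
    rewrite (_ : (fun y => _) = (fun y => u y * (fejer m x y)%:C - u x * (fejer m x y)%:C)); last first.
      by apply/funext => y; rewrite mulrBl.
    by apply: cintegrableB => //; exact: cintegrableZ.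
  have Gi : (haar R n).-integrable setT (fun y => ((e / 2) * fejer m x y + C * (\sum_i W y i * fejer m x y))%:E).
    under eq_fun do rewrite EFinD !EFinM.
    by apply: integrableD => //; exact: integrableZl.
  have e2i : (haar R n).-integrable setT (fun y => ((e / 2) * fejer m x y)%:E).
    by under eq_fun do rewrite EFinM; exact: integrableZl.
  have CSi : (haar R n).-integrable setT (fun y => (C * (\sum_i W y i * fejer m x y))%:E).
    by under eq_fun do rewrite EFinM; exact: integrableZl.
  apply: (@le_trans _ _ (\int[haar R n]_y ((e / 2) * fejer m x y + C * (\sum_i W y i * fejer m x y)))).
    rewrite E cmodN -lee_fin (le_trans (cmod_cintegral_le dfi))//.
    rewrite [leRHS]fineK; last exact: integrable_fin_num Gi.
    apply: ge0_le_integral => //.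
    - by move=> y _; rewrite lee_fin cmod_ge0.
    - by apply: measurable_ecmod; exact: cintegrable_cmeasurable dfi.
    - exact: measurable_int Gi.
    - move=> y _; rewrite lee_fin cmodM cmod_real ger0_norm//.
      have -> : e / 2 * fejer m x y + C * (\sum_i W y i * fejer m x y) =
          (e / 2 + C * \sum_i W y i) * fejer m x y.
        by rewrite -mulr_suml; ring.
      by rewrite ler_wpM2r//; exact: CP.
  have -> : \int[haar R n]_y ((e / 2) * fejer m x y + C * (\sum_i W y i * fejer m x y)) =
      e / 2 + C * \int[haar R n]_y (\sum_i W y i * fejer m x y).
    transitivity (\int[haar R n]_y ((e / 2) * fejer m x y) +
        \int[haar R n]_y (C * (\sum_i W y i * fejer m x y))).
      exact: (RintegralD measurableT e2i CSi).
    congr (_ + _); last by rewrite RintegralZl.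
    transitivity (e / 2 * \int[haar R n]_y fejer m x y); last by rewrite fejer_int1 mulr1.
    by rewrite RintegralZl.
  rewrite lerD2l ler_wpM2l//.
  rewrite (_ : \int[haar R n]_y _ = \sum_i \int[haar R n]_y (W y i * fejer m x y)); last first.
    rewrite /Rintegral; under eq_integral do rewrite -sumEFin.
    rewrite (integral_sum measurableT Wi).
    by rewrite sum_fine // => i _; exact: integrable_fin_num (Wi _).
  rewrite (le_trans (ler_sum _ (fun i _ => WI i)))// sumr_const card_ord.
  by rewrite mulr_natl.
have [m hm] : exists m : nat, C * n%:R / (e / 2) < m.+1%:R.
  by exists (Num.truncn (C * n%:R / (e / 2))); exact: truncnS_gt.
apply: (le_trans (bound m)).
by rewrite [leRHS](splitr e) lerD2l mulrA ler_pdivrMr// -ler_pdivrMl// mulrC ltW.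
Qed.

End fourier_uniqueness.

(** * Tempered distributions *)

Section rapid_expansion.
Context d (I : measurableType d) (R : realType).
Variable nu : {sigma_finite_measure set I -> \bar R}.
Hypothesis dnu : discrete nu.
Variable W : I -> R.
Hypothesis W0 : forall i, 0 <= W i.

(** Weighted l^1 norms replace the suprema of the Schwartz seminorms; on Z^n both describe the same
    sequences. The weight stays abstract to serve Z^n and Z^n x Z^n. *)
Definition crapid (b : I -> R[i]) :=
  forall N, (\int[nu]_i (W i ^+ N * cmod (b i))%:E < +oo)%E.

Definition point_mass (i j : I) : R[i] := (j == i)%:R.

Lemma point_massE i : point_mass i = (fun j => if j == i then 1 else 0).
Proof. by apply/funext => j; rewrite /point_mass; case: eqP. Qed.

Lemma le_crapid (b c : I -> R[i]) : (forall i, cmod (b i) <= cmod (c i)) ->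
  crapid c -> crapid b.
Proof.
move=> bc rc N; apply: le_lt_trans (rc N); apply: ge0_le_integral => //.
- by move=> i _; rewrite lee_fin mulr_ge0 ?exprn_ge0 ?cmod_ge0.
- exact: (discrete_measurable_fun dnu).
- exact: (discrete_measurable_fun dnu).
- by move=> i _; rewrite lee_fin ler_wpM2l ?exprn_ge0.
Qed.

Lemma crapid_cintegrable (b : I -> R[i]) : crapid b -> cintegrable nu b.
Proof.
move=> /(_ 0%N) h; apply/cintegrableP; split; first exact: (discrete_cmeasurable dnu).
rewrite (eq_integral (fun i => (W i ^+ 0 * cmod (b i))%:E)) => [//|i _].
by rewrite expr0 mul1r.
Qed.

Lemma crapid_point_mass i : crapid (point_mass i).
Proof.
move=> N; have /cintegrableP[_] := cintegrable_point dnu (fun=> ((W i ^+ N)%:C : R[i])) i.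
apply: le_lt_trans; apply: ge0_le_integral => //.
- by move=> j _; rewrite lee_fin mulr_ge0 ?exprn_ge0 ?cmod_ge0.
- exact: (discrete_measurable_fun dnu).
- exact: (discrete_measurable_fun dnu).
- move=> j _; rewrite point_massE lee_fin; case: eqP => [->|_].
    by rewrite cmod1 mulr1 cmod_real ger0_norm// exprn_ge0.
  by rewrite cmod0 mulr0.
Qed.

Variable Phi : (I -> R[i]) -> R[i].
Hypothesis Phi_linear : forall (a : R[i]) b c, crapid b -> crapid c ->
  Phi (fun i => a * b i + c i) = a * Phi b + Phi c.
Variables (N0 : nat) (C : R).
Hypothesis Phi_bounded : forall b, crapid b ->
  ((cmod (Phi b))%:E <= C%:E * \int[nu]_i (W i ^+ N0 * cmod (b i))%:E)%E.

Lemma point_mass_bound i : cmod (Phi (point_mass i)) <= `|C| * W i ^+ N0.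
Proof.
rewrite -lee_fin (le_trans (Phi_bounded (crapid_point_mass i)))//.
rewrite (_ : (\int[nu]_j _)%E = (W i ^+ N0)%:E); first by rewrite lee_fin ler_wpM2r ?exprn_ge0 ?ler_norm.
have [_ nu1 _] := dnu.
transitivity (\int[nu]_(j in [set i]) (W j ^+ N0)%:E)%E; last exact: (integral_point dnu).
rewrite [RHS]integral_mkcond; apply: eq_integral => j _.
rewrite patchE point_massE; case: eqP => [->|ji].
  by rewrite cmod1 mulr1 mem_set.
by rewrite cmod0 mulr0 memNset// => ji'; apply: ji.
Qed.

Lemma Phi0 : Phi (fun=> 0) = 0.
Proof.
have r0 : crapid (fun=> 0).
  by move=> N; under eq_integral do rewrite cmod0 mulr0; rewrite integral0.
have /eqP := Phi_linear 0 r0 r0.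
rewrite mul0r add0r => _.
have := Phi_linear 1 r0 r0; rewrite (_ : (fun i => _) = (fun=> 0)); last first.
  by apply/funext => i; rewrite mulr0 addr0.
by rewrite mul1r -[LHS]addr0 => /addrI.
Qed.

(** A linear functional bounded by one weighted l^1 norm is determined by its values on point
    masses. The truncations of [b] are finite combinations of these, and the weighted norm of the
    remaining tail tends to 0. *)
Lemma rapid_expansion (b : I -> R[i]) : crapid b ->
  cintegrable nu (fun i => b i * Phi (point_mass i)) /\
  Phi b = cintegral nu (fun i => b i * Phi (point_mass i)).
Proof.
move=> rb; pose F i := b i * Phi (point_mass i).
have Fi : cintegrable nu F.
  apply/cintegrableP; split; first exact: (discrete_cmeasurable dnu).
  apply: (@le_lt_trans _ _ (\int[nu]_i ((`|C|)%:E * (W i ^+ N0 * cmod (b i))%:E))%E).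
    apply: ge0_le_integral => //.
    - by move=> i _; rewrite lee_fin cmod_ge0.
    - exact: (discrete_measurable_fun dnu).
    - exact: (discrete_measurable_fun dnu).
    - move=> i _; rewrite lee_fin cmodM mulrC mulrA ler_wpM2r ?cmod_ge0//.
      exact: point_mass_bound.
  rewrite ge0_integralZl_EFin//.
  - by apply: lte_mul_pinfty; rewrite ?lee_fin.
  - by move=> i _; rewrite lee_fin mulr_ge0 ?exprn_ge0 ?cmod_ge0.
  - exact: (discrete_measurable_fun dnu).
split=> //; have [_ _ [code code_inj]] := dnu.
pose bt N i : R[i] := if (code i < N)%N then b i else 0.
have rt N : crapid (bt N).
  by apply: (le_crapid _ rb) => i; rewrite /bt; case: ifP; rewrite ?cmod0 ?cmod_ge0.
(* Induction by linearity: raising [N] by one adds at most one point mass. *)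
have E N : Phi (bt N) = cintegral nu (fun i => if (code i < N)%N then F i else 0).
  elim: N => [|N ih]; first by rewrite (_ : bt 0%N = fun=> 0)// Phi0 cintegral0.
  have [[i0 i0N]|no] := pselect (exists i, code i = N); last first.
    have ltE i : (code i < N.+1)%N = (code i < N)%N.
      by rewrite ltnS leq_eqVlt; case: eqP => // iN; case: no; exists i.
    rewrite (_ : bt N.+1 = bt N) ?ih; last by apply/funext => i; rewrite /bt ltE.
    by apply: cintegral_ext => i; rewrite ltE.
  have ltE i (z : R[i]) : (if (code i < N.+1)%N then z else 0) =
      (if i == i0 then z else 0) + (if (code i < N)%N then z else 0).
    rewrite ltnS leq_eqVlt -i0N (inj_eq code_inj).
    by case: eqP => [->|_]; rewrite ?ltnn ?addr0 ?add0r.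
  rewrite (_ : bt N.+1 = fun i => b i0 * point_mass i0 i + bt N i); last first.
    apply/funext => i; rewrite /bt ltE point_massE; congr (_ + _).
    by case: eqP => [->|_]; rewrite ?mulr1 ?mulr0.
  rewrite Phi_linear//; last exact: crapid_point_mass.
  rewrite ih -[b i0 * _]/(F i0) -(cintegral_point dnu F i0) -cintegralD//.
  - by apply: cintegral_ext => i; rewrite ltE.
  - exact: (cintegrable_point dnu).
  - exact: (cintegrable_trunc dnu code_inj).
have rtail N : crapid (fun i => b i - bt N i).
  apply: (le_crapid _ rb) => i.
  by rewrite /bt; case: ifP; rewrite ?subrr ?subr0 ?cmod0 ?cmod_ge0.
apply: (@cmod_cvg_unique _ (fun N => Phi (bt N))); last first.
  rewrite (_ : (fun k => _) = (fun N => cmod (cintegral nu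
      (fun i => if (code i < N)%N then F i else 0) - cintegral nu F))).
    exact: (cintegral_trunc_cvg dnu code Fi).
  by apply/funext => N; rewrite E.
have T0 := integral_tail dnu code (fun i => mulr_ge0 (exprn_ge0 N0 (W0 i)) (cmod_ge0 (b i))) (rb N0).
set T := (fun N => _) in T0.
have Tfin N : T N \is a fin_num.
  rewrite ge0_fin_numE; first apply: le_lt_trans (rb N0).
    apply: ge0_le_integral => //.
    - by move=> i _; case: ifP; rewrite ?lee_fin// mulr_ge0 ?exprn_ge0 ?cmod_ge0.
    - exact: (discrete_measurable_fun dnu).
    - exact: (discrete_measurable_fun dnu).
    - by move=> i _; case: ifP; rewrite ?lee_fin// mulr_ge0 ?exprn_ge0 ?cmod_ge0.
  by apply: integral_ge0 => i _; case: ifP; rewrite ?lee_fin// mulr_ge0 ?exprn_ge0 ?cmod_ge0.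
have bound N : cmod (Phi (bt N) - Phi b) <= C * fine (T N).
  have -> : Phi (bt N) - Phi b = - Phi (fun i => b i - bt N i).
    have := Phi_linear 1 (rtail N) (rt N).
    rewrite (_ : (fun i => _) = b); last by apply/funext => i; rewrite mul1r subrK.
    by move=> ->; rewrite mul1r opprD addrCA subrr addr0.
  rewrite cmodN -lee_fin (le_trans (Phi_bounded (rtail N)))//.
  rewrite EFinM fineK// (_ : (\int[nu]_i _)%E = T N)//; apply: eq_integral => i _.
  by rewrite /bt; case: ifP; rewrite ?subrr ?subr0 ?cmod0 ?mulr0.
apply: (@squeeze_cvgr _ _ _ _ (fun=> 0) (fun N => C * fine (T N))).
- by near=> N; rewrite cmod_ge0 bound.
- exact: cvg_cst.
- rewrite -[X in _ --> X](mulr0 C); apply: cvgMl_tmp.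
  by have /fine_cvgP[] : T N @[N --> \oo] --> (0 : R)%:E by exact: T0.
Unshelve. all: by end_near.
Qed.

End rapid_expansion.

(** * Tempered distributions on Z^n *)

Section schwartz_Z.
Variables (R : realType) (n : nat).
Local Notation cZ := (@countZ R n).
Local Notation wt := (@weight R n).
Let dZ : discrete cZ := discrete_countZ R n.

Lemma weightD (k m : Zn n) : wt (k + m) <= wt k * wt m.
Proof.
rewrite /weight; set a := (\sum_i _)%N; set b := (\sum_i _)%N; set c := (\sum_i _)%N.
have abc : (a <= b + c)%N.
  rewrite -big_split /=; apply: leq_sum => i _; rewrite ZnDE; lia.
have : a%:R <= b%:R + c%:R :> R by rewrite -natrD ler_nat.
have : 0 <= b%:R * c%:R :> R by rewrite -natrM.
nra.
Qed.

Lemma weightN (k : Zn n) : wt (- k) = wt k.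
Proof.
rewrite /weight; congr (1 + _%:R); apply: eq_bigr => i _.
by rewrite ZnNE abszN.
Qed.

(** A supremum seminorm with [n + 2] additional powers of the weight buys summability through
    [integrable_weight]. *)
Lemma schwartzZ_crapid (g : Zn n -> R[i]) : schwartzZ g -> crapid cZ wt g.
Proof.
move=> hg N; have := hg (N + (n + 2))%N.
set M := seminormZ _ _ => Moo.
have gM k : (((wt k ^+ N * cmod (g k))%:E <= M * (wt k ^- (n + 2))%:E)%E).
  rewrite -lee_pdivrMr ?exprn_gt0 ?invr_gt0 ?exprn_gt0 ?weight_gt0// invrK -EFinM.
  rewrite mulrAC -exprD; apply: ereal_sup_ubound; exists k => //.
have M0 : (0 <= M)%E.
  by apply: le_trans (ereal_sup_ubound _); last (by exists 0); rewrite lee_fin mulr_ge0 ?cmod_ge0// exprn_ge0 ?weight_ge0.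
have Mfin : M \is a fin_num by rewrite ge0_fin_numE.
have wi := integrable_weight R n.
apply: (@le_lt_trans _ _ (\int[cZ]_k (M * (wt k ^- (n + 2))%:E))%E).
  apply: ge0_le_integral => //.
  - by move=> k _; rewrite lee_fin mulr_ge0 ?cmod_ge0 ?exprn_ge0 ?weight_ge0.
rewrite ge0_integralZl//.
- apply: lte_mul_pinfty => //.
  case/integrableP: wi => _; apply: le_lt_trans; apply: ge0_le_integral => //.
  + by move=> k _; rewrite lee_fin invr_ge0 exprn_ge0 ?weight_ge0.
  + by move=> k _; exact: lee_abs.
- by move=> k _; rewrite lee_fin invr_ge0 exprn_ge0 ?weight_ge0.
Qed.

Lemma seminormZ_le_integral (b : Zn n -> R[i]) N :
  (seminormZ N b <= \int[cZ]_k (wt k ^+ N * cmod (b k))%:E)%E.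
Proof.
apply: ge_ereal_sup => _ [k _ <-].
apply: (@le_point_integral _ _ _ cZ dZ (fun k => (wt k ^+ N * cmod (b k))%:E) k) => j.
by rewrite lee_fin mulr_ge0 ?cmod_ge0 ?exprn_ge0 ?weight_ge0.
Qed.

Lemma crapid_schwartzZ (b : Zn n -> R[i]) : crapid cZ wt b -> schwartzZ b.
Proof. by move=> rb N; exact: le_lt_trans (seminormZ_le_integral b N) (rb N). Qed.

(** After a shift of the sum this is submultiplicativity of the weight: a translation costs the
    factor [wt m ^+ N]. *)
Lemma crapid_translate (b : Zn n -> R[i]) (m : Zn n) : crapid cZ wt b ->
  crapid cZ wt (fun k => b (k - m)).
Proof.
move=> rb N.
have F0 k : (0 <= (wt (k + m) ^+ N * cmod (b k))%:E)%E.
  by rewrite lee_fin mulr_ge0 ?cmod_ge0 ?exprn_ge0 ?weight_ge0.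
have := integral_countZ_bij (subrK m) (addrK m) F0.
under eq_integral do rewrite subrK.
move=> ->.
apply: (@le_lt_trans _ _ (\int[cZ]_k ((wt m ^+ N)%:E * (wt k ^+ N * cmod (b k))%:E))%E).
  apply: ge0_le_integral => //.
  - move=> k _; rewrite lee_fin mulrA -exprMn ler_wpM2r ?cmod_ge0//.
    by rewrite lerXn2r ?nnegrE ?mulr_ge0 ?weight_ge0// mulrC weightD.
rewrite ge0_integralZl_EFin//.
- by apply: lte_mul_pinfty => //; rewrite lee_fin exprn_ge0 ?weight_ge0.
- by move=> k _; rewrite lee_fin mulr_ge0 ?cmod_ge0 ?exprn_ge0 ?weight_ge0.
- by rewrite exprn_ge0 ?weight_ge0.
Qed.

Lemma crapid_cmod_sqr (b : Zn n -> R[i]) : crapid cZ wt b ->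
  (\int[cZ]_k (cmod (b k) ^+ 2)%:E < +oo)%E.
Proof.
move=> rb; have := crapid_schwartzZ rb 0%N; set M := seminormZ _ _ => Moo.
have bM k : ((cmod (b k))%:E <= M)%E.
  by apply: ereal_sup_ubound; exists k => //; rewrite expr0 mul1r.
have M0 : (0 <= M)%E by apply: le_trans (bM 0); rewrite lee_fin cmod_ge0.
have /cintegrableP[_ boo] := crapid_cintegrable dZ rb.
apply: (@le_lt_trans _ _ (\int[cZ]_k (M * (cmod (b k))%:E))%E).
  apply: ge0_le_integral => //.
  - by move=> k _; rewrite lee_fin sqr_ge0.
  - by move=> k _; rewrite expr2 EFinM lee_wpmul2r// lee_fin cmod_ge0.
rewrite ge0_integralZl//.
- by apply: lte_mul_pinfty => //; rewrite ge0_fin_numE.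
- by move=> k _; rewrite lee_fin cmod_ge0.
Qed.

Variables (g : Zn n -> R[i]) (hg : schwartzZ g).
Variables (u : (Zn n -> R[i]) -> R[i]) (hu : temperedZ u).
Local Notation uk := (fun_of_dist u).

(** For fixed [m], expanding [u] on the shifted and modulated window gives a Fourier series in [w].
    Its frequencies are [- k] because the modulation is conjugated. *)
Lemma dstft_synthesis (m : Zn n) :
  cintegrable cZ (fun k => uk k * ((g (k - m))^*)%R) /\
  forall w, dstft g u (m, w) =
    synthesis cZ (fun k => @character R n (- k)) (fun k => uk k * ((g (k - m))^*)%R) w.
Proof.
have [ulin [N0 [C uC]]] := hu.
have lin (a : R[i]) b c : crapid cZ wt b -> crapid cZ wt c ->
    u (fun i => a * b i + c i) = a * u b + u c.
  by move=> rb rc; apply: ulin; exact: crapid_schwartzZ.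
(* The constant is replaced by its absolute value, so that multiplication by it is monotone, and the
   supremum seminorm by the weighted l^1 norm. *)
have bnd b : crapid cZ wt b -> ((cmod (u b))%:E <=
    `|C|%:E * \int[cZ]_k (wt k ^+ N0 * cmod (b k))%:E)%E.
  move=> rb; apply: (le_trans (uC b (crapid_schwartzZ rb))).
  apply: (@le_trans _ _ (`|C|%:E * seminormZ N0 b)%E).
    apply: lee_wpmul2r; last by rewrite lee_fin ler_norm.
    apply: le_trans (ereal_sup_ubound _); last by exists 0.
    by rewrite lee_fin mulr_ge0 ?cmod_ge0 ?exprn_ge0 ?weight_ge0.
  by apply: lee_wpmul2l; [rewrite lee_fin|exact: seminormZ_le_integral].
pose b (w : torus R n) k := ((g (k - m))^*)%R * expi (- dot k w).
have rb w : crapid cZ wt (b w).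
  apply: (le_crapid dZ (@weight_ge0 R n) _ (crapid_translate m (schwartzZ_crapid hg))) => k.
  by rewrite cmodM cmod_conj cmod_expi mulr1.
have e1 w := rapid_expansion dZ (@weight_ge0 R n) lin bnd (rb w).
split=> [|w].
  have [h _] := e1 0; apply: (le_cintegrable _ _ (cintegrable_cmod h)).
    exact: (discrete_cmeasurable dZ).
  by move=> k; rewrite !cmodM cmod_conj cmod_expi mulr1 mulrC.
rewrite /dstft /= -[u _]/(u (b w)) (proj2 (e1 w)); apply: cintegral_ext => k.
by rewrite /b /character dotNl; rewrite -[u _]/(uk k); ring.
Qed.

Hypothesis hu1 : in_Lp (mu_phase R n) 1%:E (dstft g u).
Hypothesis g_neq0 : exists k, g k != 0.

(** The abstract inequality with exponent 1, [tau] being subtraction in Z^n and the window entering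
    through its conjugate. It makes the distribution a square-summable sequence. *)
Lemma modnormZ_lower_bound :
  ((\int[cZ]_k (cmod (uk k) ^+ 2)%:E) * (\int[cZ]_k (cmod (g k) ^+ 2)%:E) <=
   ((fine (modnormZ g 1%:E u)) ^+ 2)%:E)%E.
Proof.
have [mV Voo] := hu1.
have Nfin : modnormZ g 1%:E u \is a fin_num by rewrite ge0_fin_numE ?cLnorm_ge0.
have chiP : orthonormal_system (haar R n) (fun k : Zn n => @character R n (- k)).
  by apply: orthonormal_system_comp (orthonormal_character R n); exact: oppr_inj.
have cmodg : (\int[cZ]_k (cmod (((g k)^*)%R) ^+ 2)%:E = \int[cZ]_k (cmod (g k) ^+ 2)%:E)%E.
  by apply: eq_integral => k _; rewrite cmod_conj.
rewrite -cmodg.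
apply: (lieb_ineq dZ chiP (tau := fun i x : Zn n => i - x) _ _ _ (p := 1)).
- by move=> i j; rewrite opprB addrC subrK.
- move=> i F F0; apply: (integral_countZ_bij (f := fun j : Zn n => i - j) (g := fun j : Zn n => i - j)) => // j;
    by rewrite opprB addrC subrK.
- by move=> j F F0; apply: (integral_countZ_bij (subrK j) (addrK j)).
- by rewrite lexx ler1n.
- exact: fine_ge0 (cLnorm_ge0 _ _ _).
- by move=> x; have [/cintegrableP[]] := dstft_synthesis x.
- by rewrite cmodg; exact: crapid_cmod_sqr (schwartzZ_crapid hg).
- have [k gk] := g_neq0; exists k; apply: contra gk => /eqP gk0.
  by apply/eqP/cmod_eq0; rewrite -cmod_conj gk0 cmod0.
have m1 : measurable_fun setT (fun z => (cmod (dstft g u z) `^ 1)%:E).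
  by apply/measurable_EFinP; apply: (@measurableT_comp _ _ _ _ _ _ (fun x => x `^ 1)) => //; exact: measurable_cmod.
rewrite -poweR_EFin fineK// cLnorm_powR// (tonelli12 (erefl (mu_phase R n)) m1) => [|z].
  rewrite le_eqVlt; apply/orP; left; apply/eqP; apply: eq_integral => x _; apply: eq_integral => w _.
  by have [_ ->] := dstft_synthesis x.
by rewrite lee_fin powR_ge0.
Qed.

End schwartz_Z.

Section product_counting.
Variables (R : realType) (n : nat).

Definition countZ2 : set (Zn n * Zn n)%type -> \bar R :=
  (@countZ R n \x @countZ R n)%E.

HB.instance Definition _ :=
  Measure.copy countZ2 (@countZ R n \x @countZ R n)%E.
HB.instance Definition _ := Measure_isSigmaFinite.Build _ _ _ countZ2
  (sigma_finite_product (@countZ R n) (@countZ R n)).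

Lemma discrete_countZ2 : discrete countZ2.
Proof.
exact: (discrete_product (discrete_countZ R n) (discrete_countZ R n) (erefl countZ2)).
Qed.

Definition weight2 (i : Zn n * Zn n) : R := weight R i.1 * weight R i.2.

Lemma weight2_ge0 i : 0 <= weight2 i.
Proof. by rewrite mulr_ge0 ?weight_ge0. Qed.

End product_counting.
Arguments countZ2 : clear implicits.
Arguments weight2 : clear implicits.

(** * Schwartz functions on phase space as Fourier series *)

Section trigonometric_expansion.
Variables (R : realType) (n : nat).
Local Notation cZ := (@countZ R n).
Local Notation cZ2 := (countZ2 R n).
Local Notation wt := (@weight R n).
Local Notation wt2 := (weight2 R n).
Let dZ : discrete cZ := discrete_countZ R n.
Let dZ2 : discrete cZ2 := discrete_countZ2 R n.
Let chiP := orthonormal_character R n.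

Definition trigseries (b : Zn n * Zn n -> R[i]) (x : Zn n * torus R n) : R[i] :=
  synthesis cZ (@character R n) (fun l => b (x.1, l)) x.2.

Let tn (b : Zn n * Zn n -> R[i]) N i : (0 <= (wt2 i ^+ N * cmod (b i))%:E)%E.
Proof. by rewrite lee_fin mulr_ge0 ?cmod_ge0 ?exprn_ge0 ?weight2_ge0. Qed.

Let sn (b : Zn n -> R[i]) N l : (0 <= (wt l ^+ N * cmod (b l))%:E)%E.
Proof. by rewrite lee_fin mulr_ge0 ?cmod_ge0 ?exprn_ge0 ?weight_ge0. Qed.

Let row0 (b : Zn n * Zn n -> R[i]) N j :
  (0 <= (wt j ^+ N)%:E * \int[cZ]_l (wt l ^+ N * cmod (b (j, l)))%:E)%E.
Proof.
apply: mule_ge0; first by rewrite lee_fin exprn_ge0 ?weight_ge0.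
by apply: integral_ge0 => l _; exact: (sn (fun l => b (j, l))).
Qed.

Let pullZ (a : R) (f : Zn n -> \bar R) : 0 <= a -> (forall l, 0 <= f l)%E ->
  (a%:E * \int[cZ]_l f l = \int[cZ]_l (a%:E * f l))%E.
Proof. by move=> a0 f0; rewrite ge0_integralZl. Qed.

Lemma integral_weight2 (b : Zn n * Zn n -> R[i]) N :
  (\int[cZ2]_i (wt2 i ^+ N * cmod (b i))%:E =
   \int[cZ]_j ((wt j ^+ N)%:E * \int[cZ]_l (wt l ^+ N * cmod (b (j, l)))%:E))%E.
Proof.
rewrite (tonelli12 (erefl cZ2))//; last exact: (discrete_measurable_fun dZ2).
apply: eq_integral => j _; rewrite pullZ ?exprn_ge0 ?weight_ge0//; last exact: (sn (fun l => b (j, l))).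
by apply: eq_integral => l _; rewrite -EFinM mulrA -exprMn.
Qed.

Lemma row_le_integral (b : Zn n * Zn n -> R[i]) N j :
  ((wt j ^+ N)%:E * \int[cZ]_l (wt l ^+ N * cmod (b (j, l)))%:E <=
   \int[cZ2]_i (wt2 i ^+ N * cmod (b i))%:E)%E.
Proof.
rewrite integral_weight2.
apply: (@le_point_integral _ _ _ cZ dZ
  (fun j => (wt j ^+ N)%:E * \int[cZ]_l (wt l ^+ N * cmod (b (j, l)))%:E)%E j) => k.
exact: (row0 b).
Qed.

Lemma crapid_row (b : Zn n * Zn n -> R[i]) j : crapid cZ2 wt2 b ->
  crapid cZ wt (fun l => b (j, l)).
Proof.
move=> rb N; apply: le_lt_trans (rb N); apply: le_trans (row_le_integral b N j).
rewrite lee_pemull ?lee_fin ?exprn_ege1 ?weight_ge1//.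
by apply: integral_ge0 => l _; exact: (sn (fun l => b (j, l))).
Qed.

Lemma rapid_Re (c : Zn n -> R[i]) : crapid cZ wt c -> rapid (fun l => complex.Re (c l)).
Proof.
move=> rc N; apply/integrableP; split; first exact: (discrete_measurable_fun dZ).
apply: le_lt_trans (rc N); apply: ge0_le_integral => //.
move=> l _; rewrite abse_EFin lee_fin normrM ger0_norm ?exprn_ge0 ?weight_ge0//.
by rewrite ler_wpM2l ?exprn_ge0 ?weight_ge0// Re_le_cmod.
Qed.

Lemma rapid_Im (c : Zn n -> R[i]) : crapid cZ wt c -> rapid (fun l => complex.Im (c l)).
Proof.
move=> rc N; apply/integrableP; split; first exact: (discrete_measurable_fun dZ).
apply: le_lt_trans (rc N); apply: ge0_le_integral => //.
move=> l _; rewrite abse_EFin lee_fin normrM ger0_norm ?exprn_ge0 ?weight_ge0//.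
by rewrite ler_wpM2l ?exprn_ge0 ?weight_ge0// Im_le_cmod.
Qed.

Lemma Re_synthesis (c : Zn n -> R[i]) (y : 'rV[R]_n) :
  complex.Re (synthesis cZ (@character R n) c y) =
  trig (fun l => complex.Re (c l)) (fun l => - complex.Im (c l)) y.
Proof. by apply: eq_Rintegral => l _; rewrite !complexE /character /expi /=; ring. Qed.

Lemma Im_synthesis (c : Zn n -> R[i]) (y : 'rV[R]_n) :
  complex.Im (synthesis cZ (@character R n) c y) =
  trig (fun l => complex.Im (c l)) (fun l => complex.Re (c l)) y.
Proof. by apply: eq_Rintegral => l _; rewrite !complexE /character /expi /=; ring. Qed.

Lemma partials_trig_bound s (al be : Zn n -> R) (c : Zn n -> R[i]) N (x : 'rV[R]_n) :
  crapid cZ wt c -> rapid al -> rapid be ->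
  (forall l, `|al l| + `|be l| <= 2 * cmod (c l)) -> (size s <= N)%N ->
  (`|partials s (trig al be) x|%:E <=
   ((2 * pi) ^+ N * 2)%:E * \int[cZ]_l (wt l ^+ N * cmod (c l))%:E)%E.
Proof.
move=> rc ral rbe abc sN.
apply: le_trans (_ : ((2 * pi) ^+ N * \int[cZ]_k (wt k ^+ N * (`|al k| + `|be k|)))%:E <= _)%E.
  by rewrite lee_fin partials_trig_le.
have pN : 0 <= (2 * pi) ^+ N :> R by rewrite exprn_ge0// mulr_ge0// pi_ge0.
rewrite !EFinM -muleA lee_wpmul2l ?lee_fin//.
rewrite pullZ //; try by move=> l; exact: (sn c).
have ri : cZ.-integrable setT (fun k => (wt k ^+ N * (`|al k| + `|be k|))%:E).
  by apply: (rapidD (rapid_norm ral) (rapid_norm rbe) N).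
rewrite /Rintegral fineK; last exact: integrable_fin_num ri.
apply: ge0_le_integral => //.
  by move=> k _; rewrite lee_fin mulr_ge0 ?exprn_ge0 ?weight_ge0 ?addr_ge0.
by move=> k _; rewrite -EFinM lee_fin mulrCA ler_wpM2l ?exprn_ge0 ?weight_ge0.
Qed.

(** Temperedness is a bound by Schwartz seminorms, and this converts it into the coefficient bound
    of [rapid_expansion]. The 4 collects two components, each with two real families bounded by
    [2 * cmod]. *)
Lemma trigseries_seminorm (b : Zn n * Zn n -> R[i]) N : crapid cZ2 wt2 b ->
  (seminormZT N (trigseries b) <=
   ((2 * pi) ^+ N * 4)%:E * \int[cZ2]_i (wt2 i ^+ N * cmod (b i))%:E)%E.
Proof.
move=> rb; apply: ge_ereal_sup => _ [k [s [x [sN ->]]]].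
have rk := crapid_row k rb.
have pN : 0 <= (2 * pi) ^+ N :> R by rewrite exprn_ge0// mulr_ge0// pi_ge0.
apply: le_trans (_ : (((2 * pi) ^+ N * 4)%:E *
   ((wt k ^+ N)%:E * \int[cZ]_l (wt l ^+ N * cmod (b (k, l)))%:E) <= _)%E); last first.
  by rewrite lee_wpmul2l ?row_le_integral// lee_fin mulr_ge0.
rewrite muleCA EFinM lee_wpmul2l ?lee_fin ?exprn_ge0 ?weight_ge0//.
apply: le_trans (_ : (`|partials s (trig (fun l => complex.Re (b (k, l))) (fun l => - complex.Im (b (k, l)))) x|%:E +
  `|partials s (trig (fun l => complex.Im (b (k, l))) (fun l => complex.Re (b (k, l)))) x|%:E <= _)%E).
  rewrite -EFinD lee_fin (le_trans (cmod_le _))//= /trigseries /=.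
  have -> : (fun y => complex.Re (synthesis cZ (@character R n) (fun l => b (k, l)) y)) =
    trig (fun l => complex.Re (b (k, l))) (fun l => - complex.Im (b (k, l))).
    by apply/funext => y; exact: Re_synthesis.
  have -> : (fun y => complex.Im (synthesis cZ (@character R n) (fun l => b (k, l)) y)) =
    trig (fun l => complex.Im (b (k, l))) (fun l => complex.Re (b (k, l))).
    by apply/funext => y; exact: Im_synthesis.
  by [].
have -> : ((2 * pi) ^+ N * 4 = (2 * pi) ^+ N * 2 + (2 * pi) ^+ N * 2 :> R) by ring.
rewrite EFinD ge0_muleDl ?lee_fin ?mulr_ge0//.
have ReIm (z : R[i]) : `|complex.Re z| + `|complex.Im z| <= 2 * cmod z.
  by rewrite mulr_natl mulr2n lerD ?Re_le_cmod ?Im_le_cmod.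
apply: leeD; apply: partials_trig_bound => //.
- exact: rapid_Re.
- by apply: rapidN; exact: rapid_Im.
- by move=> l; rewrite normrN.
- exact: rapid_Im.
- exact: rapid_Re.
- by move=> l; rewrite addrC.
Qed.

Lemma schwartzZT_trigseries (b : Zn n * Zn n -> R[i]) : crapid cZ2 wt2 b ->
  schwartzZT (trigseries b).
Proof.
move=> rb; split.
- by move=> k x i; apply: cintegral_ext => l /=; rewrite expi_periodic.
- move=> k; rewrite (_ : (fun x => _) = trig (fun l => complex.Re (b (k, l)))
    (fun l => - complex.Im (b (k, l)))); last by apply/funext => y; exact: Re_synthesis.
  have rk := crapid_row k rb.
  by apply: smooth_trig; [exact: rapid_Re|apply: rapidN; exact: rapid_Im].
- move=> k; rewrite (_ : (fun x => _) = trig (fun l => complex.Im (b (k, l)))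
    (fun l => complex.Re (b (k, l)))); last by apply/funext => y; exact: Im_synthesis.
  have rk := crapid_row k rb.
  by apply: smooth_trig; [exact: rapid_Im|exact: rapid_Re].
- move=> N; apply: (le_lt_trans (trigseries_seminorm N rb)).
  apply: lte_mul_pinfty => //.
  by rewrite lee_fin mulr_ge0// exprn_ge0// mulr_ge0// pi_ge0.
Qed.

Variables (F : Zn n * torus R n -> R[i]) (hF : schwartzZT F).

(** The decay estimate is taken with [n + 2] extra powers in each variable, which leaves a product
    of two summable weights. *)
Lemma crapid_fourier : crapid cZ2 wt2 (fun i => fourier F i.1 i.2).
Proof.
move=> N; have [C [C0 CP]] := fourier_decay hF (N + (n + 2)).
have wi := integrable_weight R n.
set S := (\int[cZ]_k (wt k ^- (n + 2))%:E)%E.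
have S0 : (0 <= S)%E by apply: integral_ge0 => k _; rewrite lee_fin invr_ge0 exprn_ge0 ?weight_ge0.
have Sfin : S \is a fin_num by exact: integrable_fin_num wi.
rewrite integral_weight2.
apply: (@le_lt_trans _ _ (\int[cZ]_j ((C%:E * S) * (wt j ^- (n + 2))%:E))%E).
  apply: ge0_le_integral => //.
    by move=> j _; exact: (row0 (fun i => fourier F i.1 i.2)).
  move=> j _.
  have wj : 0 < wt j ^+ N by rewrite exprn_gt0 ?weight_gt0.
  rewrite pullZ ?(ltW wj)//; try by move=> l; exact: (sn (fun l => fourier F j l)).
  rewrite muleAC -EFinM pullZ; last 2 first.
  - by rewrite mulr_ge0// invr_ge0 exprn_ge0 ?weight_ge0.
  - by move=> k; rewrite lee_fin invr_ge0 exprn_ge0 ?weight_ge0.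
  apply: ge0_le_integral => //.
    by move=> l _; rewrite mule_ge0// lee_fin ltW.
  move=> l _; rewrite -!EFinM lee_fin -mulrA -invfM ler_pdivlMr; last first.
    by rewrite mulr_gt0 ?exprn_gt0 ?weight_gt0.
  by apply: le_trans (CP j l); rewrite le_eqVlt !exprD /=; apply/orP; left; apply/eqP; ring.
rewrite ge0_integralZl//.
- by rewrite lte_mul_pinfty ?mule_ge0 ?fin_numM// -ge0_fin_numE.
- by move=> k _; rewrite lee_fin invr_ge0 exprn_ge0 ?weight_ge0.
- by rewrite mule_ge0.
Qed.

Let Fbound : exists M : R, forall j (y : 'rV[R]_n), cmod (F (j, y)) <= M.
Proof.
have [C [C0 CP]] := schwartzZT_bound hF 0.
exists C => j y; have := CP j [::] y (leqnn _); rewrite expr0 mul1r /cpartials /=.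
by case: (F (j, y)).
Qed.

Let Fcont j : continuous (fun y : 'rV[R]_n => complex.Re (F (j, y))) /\
  continuous (fun y : 'rV[R]_n => complex.Im (F (j, y))).
Proof.
by case: hF => _ /(_ j) /(_ [::]) [cre _] /(_ j) /(_ [::]) [cim _] _; split.
Qed.

Lemma cmeasurable_schwartzZT_row j : cmeasurable (fun y : torus R n => F (j, y)).
Proof. by have [? ?] := Fcont j; split; exact: continuous_measurable_torus. Qed.

(** In each row the difference of both sides is continuous, periodic and bounded, and all its
    Fourier coefficients vanish. Equality therefore holds at every point, not merely almost
    everywhere. *)
Lemma fourier_inversion x : F x = trigseries (fun i => fourier F i.1 i.2) x.
Proof.
case: x => j x; apply/eqP; rewrite -subr_eq0; apply/eqP.
have rk := crapid_row j crapid_fourier.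
have bi := crapid_cintegrable dZ rk.
have [M FM] := Fbound; have [cre cim] := Fcont j.
have /cintegrableP[_] := bi; set T := (\int[_]_l _)%E => Too.
have T0 : (0 <= T)%E by apply: integral_ge0 => l _; rewrite lee_fin cmod_ge0.
pose H (y : 'rV[R]_n) := synthesis cZ (@character R n) (fun l => fourier F j l) y.
have HT y : cmod (H y) <= fine T.
  rewrite -lee_fin fineK ?ge0_fin_numE//.
  exact: (cmod_synthesis_le dZ chiP y bi).
apply: (@fourier_uniqueness _ _ (fun y => F (j, y) - H y) (M + fine T)).
- rewrite (_ : (fun y => _) = (fun y => complex.Re (F (j, y)) -
    trig (fun l => complex.Re (fourier F j l)) (fun l => - complex.Im (fourier F j l)) y)).
    apply: continuous_funB => //; apply: continuous_trig; first exact: rapid_Re.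
    by apply: rapidN; exact: rapid_Im.
  by apply/funext => y; rewrite !complexE Re_synthesis.
- rewrite (_ : (fun y => _) = (fun y => complex.Im (F (j, y)) -
    trig (fun l => complex.Im (fourier F j l)) (fun l => complex.Re (fourier F j l)) y)).
    by apply: continuous_funB => //; apply: continuous_trig; [exact: rapid_Im|exact: rapid_Re].
  by apply/funext => y; rewrite !complexE Im_synthesis.
- move=> y i; congr (_ - _); first by case: hF => ->.
  by apply: cintegral_ext => l /=; rewrite expi_periodic.
- by move=> y; rewrite (le_trans (cmodB _ _))// lerD.
move=> k.
have mH : cmeasurable (fun y : torus R n => H y) by exact: (cmeasurable_synthesis dZ chiP).
have mch : cmeasurable (fun y : torus R n => ((character k y)^*)%R).
  by apply: cmeasurable_conj; exact: cmeasurable_character.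
transitivity (cintegral (haar R n) (fun y => F (j, y) * ((character k y)^*)%R) -
  cintegral (haar R n) (fun y => H y * ((character k y)^*)%R)).
  rewrite -cintegralB; first by apply: cintegral_ext => y; rewrite mulrBl.
    apply: (@cintegrable_bounded _ _ _ _ _ M%:E); rewrite ?ltry//.
      by apply: cmeasurableM => //; exact: cmeasurable_schwartzZT_row.
    by move=> y; rewrite lee_fin cmodM cmod_conj cmod_character mulr1.
  apply: (@cintegrable_bounded _ _ _ _ _ (fine T)%:E); rewrite ?ltry//.
    exact: cmeasurableM.
  by move=> y; rewrite lee_fin cmodM cmod_conj cmod_character mulr1.
by rewrite (synthesis_coef dZ chiP k bi) subrr.
Qed.

End trigonometric_expansion.

(** * Integration over the doubled phase space *)

Section phase_space_tonelli.
Variables (R : realType) (n : nat).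
Local Notation cZ := (@countZ R n).
Local Notation cZ2 := (countZ2 R n).
Let dZ : discrete cZ := discrete_countZ R n.
Let dZ2 : discrete cZ2 := discrete_countZ2 R n.

Definition haar2 : probability (torus R n * torus R n)%type R := (haar R n \x haar R n)%E.

(** The four variables are regrouped with both discrete ones outside and both torus ones inside,
    which is the shape of the hypothesis [hN] of [lieb_ineq]. *)
Lemma tonelli_phase2 (f : (Zn n * torus R n) * (torus R n * Zn n) -> \bar R) :
  measurable_fun setT f -> (forall z, (0 <= f z)%E) ->
  (\int[mu_phase2 R n]_z f z =
   \int[cZ2]_x \int[haar2]_t f ((x.1, t.2), (t.1, x.2)))%E.
Proof.
move=> mf f0.
pose h k (z : Zn n * torus R n) := (\int[haar R n]_w f ((z.1, w), (z.2, k)))%E.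
have mpair d1 d2 d3 (X : measurableType d1) (Y : measurableType d2) (Z : measurableType d3)
    (p : X -> Y) (q : X -> Z) : measurable_fun setT p -> measurable_fun setT q ->
    measurable_fun setT (fun x => (p x, q x)) by move=> mp mq; exact: measurable_fun_pair.
have mh k : measurable_fun setT (h k).
  apply: (measurable_fun_discrete_prod dZ) => m.
  apply: (measurable_fun_fubini_tonelli_F (m2 := haar R n)
    (fun xw : torus R n * torus R n => f ((m, xw.2), (xw.1, k)))) => //.
  apply: measurableT_comp => //; apply: (mpair); apply: (mpair) => //.
have h0 k z : (0 <= h k z)%E by apply: integral_ge0.
rewrite (@tonelli21 _ _ _ _ _ (mu_phase R n) (mu_dual_phase R n) _ erefl)//.
rewrite (@tonelli21 _ _ _ _ _ (haar R n) cZ _ erefl); last 2 first.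
- exact: (measurable_fun_fubini_tonelli_G (m1 := mu_phase R n) f mf f0).
- by move=> z; apply: integral_ge0.
rewrite (@tonelli21 _ _ _ _ _ cZ cZ _ erefl); last 2 first.
- exact: (discrete_measurable_fun dZ2).
- by move=> z; apply: integral_ge0.
apply: eq_integral => k _.
transitivity (\int[haar R n]_y \int[cZ]_m h k (m, y))%E.
  apply: eq_integral => y _.
  rewrite (@tonelli12 _ _ _ _ _ cZ (haar R n) (mu_phase R n) erefl)//.
  by apply: measurableT_comp => //; exact: mpair.
rewrite -(@tonelli21 _ _ _ _ _ cZ (haar R n) (mu_phase R n) erefl)//.
rewrite (@tonelli12 _ _ _ _ _ cZ (haar R n) (mu_phase R n) erefl)//.
apply: eq_integral => m _.
rewrite (@tonelli12 _ _ _ _ _ (haar R n) (haar R n) haar2 erefl)//.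
by apply: measurableT_comp => //; apply: (mpair); apply: (mpair).
Qed.

Lemma integral_countZ2_bij (f1 g1 f2 g2 : Zn n -> Zn n) (F : Zn n * Zn n -> \bar R) :
  cancel f1 g1 -> cancel g1 f1 -> cancel f2 g2 -> cancel g2 f2 -> (forall x, 0 <= F x)%E ->
  (\int[cZ2]_x F (f1 x.1, f2 x.2) = \int[cZ2]_x F x)%E.
Proof.
move=> fK1 gK1 fK2 gK2 F0.
rewrite !(@tonelli12 _ _ _ _ _ cZ cZ cZ2 erefl)//; last 2 first.
- exact: (discrete_measurable_fun dZ2).
- exact: (discrete_measurable_fun dZ2).
rewrite -[RHS](integral_countZ_bij fK1 gK1); last by move=> k; apply: integral_ge0.
apply: eq_integral => j _ /=.
by rewrite (integral_countZ_bij (F := fun l => F (f1 j, l)) fK2 gK2).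
Qed.

Lemma cintegral_countZ_bij (f g : Zn n -> Zn n) (F : Zn n -> R[i]) :
  cancel f g -> cancel g f -> cintegral cZ (fun k => F (f k)) = cintegral cZ F.
Proof.
move=> fK gK.
have H (h : Zn n -> R) : \int[cZ]_k h (f k) = \int[cZ]_k h k.
  rewrite /Rintegral; congr fine; rewrite [LHS]integralE [RHS]integralE.
  congr (_ - _)%E.
    rewrite -[RHS](integral_countZ_bij fK gK) ?funepos_ge0//.
    by apply: eq_integral => k _; rewrite !funeposE.
  rewrite -[RHS](integral_countZ_bij fK gK) ?funeneg_ge0//.
  by apply: eq_integral => k _; rewrite !funenegE.
by rewrite /cintegral (H (fun k => complex.Re (F k))) (H (fun k => complex.Im (F k))).
Qed.

End phase_space_tonelli.
Arguments haar2 : clear implicits.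

(** * Tempered distributions on phase space *)

Section distributions_on_phase_space.
Variables (R : realType) (n : nat).
Local Notation cZ := (@countZ R n).
Local Notation cZ2 := (countZ2 R n).
Local Notation wt := (@weight R n).
Local Notation wt2 := (weight2 R n).
Let dZ : discrete cZ := discrete_countZ R n.
Let dZ2 : discrete cZ2 := discrete_countZ2 R n.
Let chiP := orthonormal_character R n.

Variables (sigma : (Zn n * torus R n -> R[i]) -> R[i]) (hsigma : temperedZT sigma).

(** The series of a point mass at [(j, l)] is [delta_j e_l], so these are the coefficients
    [c(j,l)]. *)
Definition dist_coef (i : Zn n * Zn n) : R[i] := sigma (trigseries (point_mass R i)).

Lemma dist_expansion (b : Zn n * Zn n -> R[i]) : crapid cZ2 wt2 b ->
  cintegrable cZ2 (fun i => b i * dist_coef i) /\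
  sigma (trigseries b) = cintegral cZ2 (fun i => b i * dist_coef i).
Proof.
have [slin [N0 [C sC]]] := hsigma.
apply: (rapid_expansion dZ2 (@weight2_ge0 R n) (Phi := fun b => sigma (trigseries b)) _
  (N0 := N0) (C := `|C| * ((2 * pi) ^+ N0 * 4)) _).
- move=> a b' c rb rc; rewrite -slin; try exact: schwartzZT_trigseries.
  congr sigma; apply/funext => x.
  have bi := crapid_cintegrable dZ (crapid_row x.1 rb).
  have ci := crapid_cintegrable dZ (crapid_row x.1 rc).
  rewrite /trigseries /synthesis -cintegralZ; last exact: (cintegrable_synthesis_term dZ chiP).
  rewrite -cintegralD; first by apply: cintegral_ext => l; ring.
    by apply: cintegrableZ; exact: (cintegrable_synthesis_term dZ chiP).
  exact: (cintegrable_synthesis_term dZ chiP).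
- move=> b' rb; apply: (le_trans (sC _ (schwartzZT_trigseries rb))).
  have s0 : (0 <= seminormZT N0 (trigseries b'))%E.
    apply: le_trans (ereal_sup_ubound _); last by exists 0, [::], 0.
    by rewrite lee_fin mulr_ge0 ?cmod_ge0 ?exprn_ge0 ?weight_ge0.
  apply: (@le_trans _ _ (`|C|%:E * seminormZT N0 (trigseries b'))%E).
    by apply: lee_wpmul2r => //; rewrite lee_fin ler_norm.
  by rewrite EFinM -muleA lee_wpmul2l ?lee_fin//; exact: trigseries_seminorm.
Qed.

Lemma dist_schwartz (F : Zn n * torus R n -> R[i]) : schwartzZT F ->
  cintegrable cZ2 (fun i => fourier F i.1 i.2 * dist_coef i) /\
  sigma F = cintegral cZ2 (fun i => fourier F i.1 i.2 * dist_coef i).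
Proof.
move=> hF; have [fi <-] := dist_expansion (crapid_fourier hF); split=> //.
by congr sigma; apply/funext => x; exact: fourier_inversion.
Qed.

Lemma crapid2_cmod_sqr (b : Zn n * Zn n -> R[i]) : crapid cZ2 wt2 b ->
  (\int[cZ2]_i (cmod (b i) ^+ 2)%:E < +oo)%E.
Proof.
move=> rb; have /cintegrableP[_] := crapid_cintegrable dZ2 rb.
set M := (\int[_]_i _)%E => Moo.
have M0 : (0 <= M)%E by apply: integral_ge0 => i _; rewrite lee_fin cmod_ge0.
have bM i : ((cmod (b i))%:E <= M)%E.
  by apply: (@le_point_integral _ _ _ cZ2 dZ2 (fun i => (cmod (b i))%:E) i) => j; rewrite lee_fin cmod_ge0.
apply: (@le_lt_trans _ _ (\int[cZ2]_i (M * (cmod (b i))%:E))%E).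
  apply: ge0_le_integral => //.
  - by move=> i _; rewrite lee_fin sqr_ge0.
  - exact: (discrete_measurable_fun dZ2).
  - exact: (discrete_measurable_fun dZ2).
  - by move=> i _; rewrite expr2 EFinM lee_wpmul2r// lee_fin cmod_ge0.
rewrite ge0_integralZl//.
- by apply: lte_mul_pinfty => //; rewrite ge0_fin_numE.
- exact: (discrete_measurable_fun dZ2).
- by move=> i _; rewrite lee_fin cmod_ge0.
Qed.

Lemma fourier_plancherel (F : Zn n * torus R n -> R[i]) : schwartzZT F ->
  (\int[mu_phase R n]_x (cmod (F x) ^+ 2)%:E =
   \int[cZ2]_i (cmod (fourier F i.1 i.2) ^+ 2)%:E)%E.
Proof.
move=> hF; have mF : cmeasurable F.
  apply: (cmeasurable_discrete_prod dZ) => j; exact: cmeasurable_schwartzZT_row.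
rewrite (@tonelli12 _ _ _ _ _ cZ (haar R n) (mu_phase R n) erefl); last 2 first.
- by apply/measurable_EFinP; apply: measurable_funX; exact: measurable_cmod.
- by move=> z; rewrite lee_fin sqr_ge0.
rewrite (@tonelli12 _ _ _ _ _ cZ cZ cZ2 erefl); last 2 first.
- exact: (discrete_measurable_fun dZ2).
- by move=> z; rewrite lee_fin sqr_ge0.
apply: eq_integral => j _.
have bi := crapid_cintegrable dZ (crapid_row j (crapid_fourier hF)).
rewrite -(parseval_synthesis dZ chiP bi); apply: eq_integral => y _.
by rewrite (fourier_inversion hF).
Qed.

Variables (G : Zn n * torus R n -> R[i]) (hG : schwartzZT G).

(** The conjugated window contributes [e_{-l'}] and the modulation [e_{-k}]; their product is [e_l]
    exactly for [l' = - l - k], which explains the sign in the second component. *)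
Let tau (i x : Zn n * Zn n) : Zn n * Zn n := (i.1 - x.1, - i.2 - x.2).
Let a (i : Zn n * Zn n) : R[i] := ((fourier G i.1 i.2)^*)%R.
Let chi2 (i : Zn n * Zn n) (t : torus R n * torus R n) : R[i] :=
  character (- i.1) t.1 * character (- i.2) t.2.

Let tauK i x : tau i (tau i x) = x.
Proof.
case: i x => i1 i2 [x1 x2]; rewrite /tau /=.
by congr (_, _); rewrite opprB addrC subrK.
Qed.

(** The Fourier coefficients of the shifted and modulated window. The leading phase does not depend
    on [i] and therefore disappears from all moduli of the transform. *)
Let atom (z : (Zn n * torus R n) * (torus R n * Zn n)) (i : Zn n * Zn n) : R[i] :=
  character (- z.2.2) z.1.2 *
  (a (tau i (z.1.1, z.2.2)) * chi2 i (z.2.1, z.1.2)).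

Let W2N i N : 0 <= wt2 i ^+ N.
Proof. by apply: exprn_ge0; exact: (@weight2_ge0 R n). Qed.

Let wt2_le (m k : Zn n) (i : Zn n * Zn n) N (z : R) : 0 <= z ->
  wt2 (i.1 + m, - i.2 - k) ^+ N * z <= (wt m * wt k) ^+ N * (wt2 i ^+ N * z).
Proof.
move=> z0; have H : wt2 (i.1 + m, - i.2 - k) <= (wt m * wt k) * wt2 i.
  rewrite /weight2 /= [leRHS]mulrACA; apply: ler_pM; try exact: weight_ge0.
    by rewrite [leRHS]mulrC; exact: weightD.
  by rewrite -opprD weightN [leRHS]mulrC; exact: weightD.
have HN : wt2 (i.1 + m, - i.2 - k) ^+ N <= (wt m * wt k) ^+ N * wt2 i ^+ N.
  rewrite -exprMn; apply: lerXn2r; rewrite ?nnegrE//; first exact: weight2_ge0.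
  by rewrite !mulr_ge0// ?weight2_ge0 ?weight_ge0.
by rewrite [leRHS]mulrA; exact: ler_wpM2r.
Qed.

Let integral_tau (m k : Zn n) N :
  (\int[cZ2]_i (wt2 i ^+ N * cmod (a (tau i (m, k))))%:E =
   \int[cZ2]_i (wt2 (i.1 + m, - i.2 - k) ^+ N * cmod (a i))%:E)%E.
Proof.
have fK2 : cancel (fun l : Zn n => - l - k) (fun l => - l - k).
  by move=> l; rewrite opprB opprK addrC addKr.
pose H i := (wt2 (i.1 + m, - i.2 - k) ^+ N * cmod (a i))%:E.
have H0 i : (0 <= H i)%E.
  by rewrite lee_fin; apply: mulr_ge0; [exact: W2N|exact: cmod_ge0].
rewrite -[RHS](@integral_countZ2_bij R n _ _ _ _ H (subrK m) (addrK m) fK2 fK2 H0).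
apply: eq_integral => -[j l] _; rewrite /H /tau /=.
by rewrite subrK (fK2 l).
Qed.

Let integral_a N : (\int[cZ2]_i (wt2 i ^+ N * cmod (a i))%:E < +oo)%E.
Proof.
rewrite (eq_integral (fun i => (wt2 i ^+ N * cmod (fourier G i.1 i.2))%:E)).
  exact: (crapid_fourier hG).
by move=> i _; rewrite cmod_conj.
Qed.

Let crapid_a x : crapid cZ2 wt2 (fun i => a (tau i x)).
Proof.
move=> N; case: x => m k; rewrite integral_tau.
have W0 : 0 <= (wt m * wt k) ^+ N by apply: exprn_ge0; apply: mulr_ge0; exact: weight_ge0.
apply: (@le_lt_trans _ _ (\int[cZ2]_i (((wt m * wt k) ^+ N)%:E * (wt2 i ^+ N * cmod (a i))%:E))%E).
  apply: ge0_le_integral.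
  - exact: measurableT.
  - by move=> i _; rewrite lee_fin; apply: mulr_ge0; [exact: W2N|exact: cmod_ge0].
  - exact: (discrete_measurable_fun dZ2).
  - exact: (discrete_measurable_fun dZ2).
  - move=> i _; rewrite lee_fin; apply: wt2_le; exact: cmod_ge0.
rewrite ge0_integralZl_EFin.
- by apply: lte_mul_pinfty; [rewrite lee_fin; exact: W0|by rewrite fin_numE|exact: integral_a].
- exact: measurableT.
- by move=> i _; rewrite lee_fin; apply: mulr_ge0; [exact: W2N|exact: cmod_ge0].
- exact: (discrete_measurable_fun dZ2).
- exact: W0.
Qed.

Let cmod_chi2 i t : cmod (chi2 i t) = 1.
Proof. by rewrite cmodM !cmod_character mulr1. Qed.

Let cmod_atom z i : cmod (atom z i) = cmod (a (tau i (z.1.1, z.2.2))).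
Proof.
rewrite /atom cmodM [cmod (a _ * _)]cmodM cmod_character mul1r.
by rewrite (cmod_chi2 i (z.2.1, z.1.2)) mulr1.
Qed.

Let crapid_atom z : crapid cZ2 wt2 (atom z).
Proof.
apply: (le_crapid dZ2 (@weight2_ge0 R n) _ (crapid_a (z.1.1, z.2.2))) => i.
by rewrite cmod_atom.
Qed.

Let trigseries_atom z y : expi (- dot y.1 z.2.1) * expi (- dot z.2.2 y.2) *
    ((G (y.1 - z.1.1, y.2 - z.1.2))^*)%R = trigseries (atom z) y.
Proof.
case: z => -[m w] [xi k]; case: y => j eta /=.
have Gi := crapid_cintegrable dZ (crapid_row (j - m) (crapid_fourier hG)).
rewrite (fourier_inversion hG) /trigseries /synthesis /=.
have Ti := cintegrable_synthesis_term dZ chiP (eta - w) Gi.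
rewrite -(cintegral_conj Ti) -cintegralZ; last exact: cintegrable_conj.
(* Reindexing by this involution collects the coefficient of [character l] in the variable [eta]. *)
pose f (l : Zn n) := - l - k.
have fK : cancel f f by move=> l; rewrite /f opprB opprK addrC addKr.
rewrite -(cintegral_countZ_bij _ fK fK); apply: cintegral_ext => l.
rewrite /atom /a /tau /chi2 /f /= rmorphM /= -!dotNl.
have e1 : character (- l - k) (eta - w) = character (- l - k) eta * ((character (- l - k) w)^*)%R.
  by rewrite /character -expiN -dotNr -expiD -dotDr.
rewrite e1 rmorphM /= conjCK !characterD !character_conj !rmorphM /= !conjCK.
rewrite -[expi (dot (- j) xi)]/(character (- j) xi) -[expi (dot (- k) eta)]/(character (- k) eta).
rewrite !character_conj.
have e2 : character k eta * ((character k eta)^*)%R = 1.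
  by rewrite mul_conj cmod_character expr1n.
ring: e2.
Qed.

Lemma dstft2_synthesis z : cintegrable cZ2 (fun i => dist_coef i * a (tau i (z.1.1, z.2.2))) /\
  dstft2 G sigma z = character (- z.2.2) z.1.2 *
  synthesis cZ2 chi2 (fun i => dist_coef i * a (tau i (z.1.1, z.2.2))) (z.2.1, z.1.2).
Proof.
have [ai E] := dist_expansion (crapid_atom z).
have bi : cintegrable cZ2 (fun i => dist_coef i * a (tau i (z.1.1, z.2.2))).
  apply: (le_cintegrable _ _ (cintegrable_cmod ai)); first exact: (discrete_cmeasurable dZ2).
  by move=> i; rewrite [cmod (atom z i * _)]cmodM cmod_atom cmodM mulrC.
split=> //; rewrite /dstft2 (_ : (fun y => _) = trigseries (atom z)); last first.
  by apply/funext => y; exact: trigseries_atom.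
rewrite E -cintegralZ; first by apply: cintegral_ext => i; rewrite /atom; ring.
apply: (le_cintegrable _ _ (cintegrable_cmod bi)); first exact: (discrete_cmeasurable dZ2).
by move=> i; rewrite cmodM (cmod_chi2 i (z.2.1, z.1.2)) mulr1.
Qed.

Variables (p : R) (p12 : 1 <= p <= 2).
Hypothesis hV : in_Lp (mu_phase2 R n) p%:E (dstft2 G sigma).
Hypothesis G_neq0 : exists x, G x != 0.

(** The abstract inequality on Z^n x Z^n, with torus variables [(xi, w)]; Plancherel for [G] turns
    the norm of its coefficients into the norm of the window. *)
Lemma modnormZT_lower_bound :
  ((\int[cZ2]_i (cmod (dist_coef i) ^+ 2)%:E) *
   (\int[mu_phase R n]_x (cmod (G x) ^+ 2)%:E) <=
   ((fine (modnormZT G p%:E sigma)) ^+ 2)%:E)%E.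
Proof.
have [mV Voo] := hV.
have p0 : 0 < p by case/andP : p12 => h _; exact: lt_le_trans h.
have Nfin : modnormZT G p%:E sigma \is a fin_num by rewrite ge0_fin_numE ?cLnorm_ge0.
have opp_inj : injective (fun k : Zn n => - k) by exact: oppr_inj.
have chiN := orthonormal_system_comp opp_inj (orthonormal_character R n).
have chi2P : orthonormal_system (haar2 R n) chi2.
  exact: (orthonormal_system_prod (m := haar2 R n) erefl chiN chiN).
have -> : (\int[mu_phase R n]_x (cmod (G x) ^+ 2)%:E = \int[cZ2]_i (cmod (a i) ^+ 2)%:E)%E.
  by rewrite (fourier_plancherel hG); apply: eq_integral => i _; rewrite cmod_conj.
have involN (k : Zn n) : cancel (fun l : Zn n => - l - k) (fun l => - l - k).
  by move=> l; rewrite opprB opprK addrC addKr.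
have involB (k : Zn n) : cancel (fun l : Zn n => k - l) (fun l => k - l).
  by move=> l; rewrite opprB addrC subrK.
apply: (lieb_ineq dZ2 chi2P (tau := tau) tauK _ _ (p := p)) => //.
- move=> i F F0; exact: (integral_countZ2_bij (f1 := fun j : Zn n => i.1 - j)
    (f2 := fun l : Zn n => - i.2 - l) (involB i.1) (involB i.1) (involB (- i.2)) (involB (- i.2)) F0).
- move=> j F F0; exact: (integral_countZ2_bij (f1 := fun i : Zn n => i - j.1)
    (f2 := fun l : Zn n => - l - j.2) (subrK j.1) (addrK j.1) (involN j.2) (involN j.2) F0).
- exact: fine_ge0 (cLnorm_ge0 _ _ _).
- by move=> [m k]; have [/cintegrableP[]] := dstft2_synthesis ((m, 0), (0, k)).
- by under eq_integral do rewrite cmod_conj; exact: crapid2_cmod_sqr (crapid_fourier hG).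
(* A window all of whose Fourier coefficients vanish is zero by inversion. *)
- apply: contrapT => no; case: G_neq0 => x; rewrite (fourier_inversion hG) => /eqP; apply.
  rewrite /trigseries /synthesis (_ : (fun l => _) = fun=> 0) ?cintegral0//.
  apply/funext => l /=; have [->|fl] := eqVneq (fourier G x.1 l) 0; first by rewrite mul0r.
  case: no; exists (x.1, l); apply: contra fl => /eqP al0.
  by apply/eqP/cmod_eq0; rewrite -cmod_conj [X in cmod X]al0 cmod0.
have m1 : measurable_fun setT (fun z => (cmod (dstft2 G sigma z) `^ p)%:E).
  by apply/measurable_EFinP; apply: (@measurableT_comp _ _ _ _ _ _ (fun x => x `^ p)) => //; exact: measurable_cmod.
have -> : ((fine (modnormZT G p%:E sigma) `^ p)%:E =
    \int[cZ2]_x \int[haar2 R n]_t (cmod (dstft2 G sigma ((x.1, t.2), (t.1, x.2))) `^ p)%:E)%E.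
  rewrite -poweR_EFin fineK //; have := cLnorm_powR (mu_phase2 R n) (dstft2 G sigma) p0.
  move=> ->; apply: tonelli_phase2; first exact: m1.
  by move=> z; rewrite lee_fin powR_ge0.
have E x t : cmod (synthesis cZ2 chi2 (fun i => dist_coef i * a (tau i x)) t) =
    cmod (dstft2 G sigma ((x.1, t.2), (t.1, x.2))).
  have [_ ->] := dstft2_synthesis ((x.1, t.2), (t.1, x.2)).
  by rewrite cmodM cmod_character mul1r /=; case: x => ? ?; case: t.
rewrite le_eqVlt; apply/orP; left; apply/eqP.
by apply: eq_integral => x _; apply: eq_integral => t _; rewrite E.
Qed.

Hypothesis c2 : (\int[cZ2]_i (cmod (dist_coef i) ^+ 2)%:E < +oo)%E.

(** Riesz-Fischer is applied to each row of coefficients. The chosen rows form a measurable function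
    because measurability over Z^n is checked row by row, and summing the row bounds gives the
    norm. *)
Lemma dist_symbol : exists s : Zn n * torus R n -> R[i], representsZT sigma s /\
  (\int[mu_phase R n]_x (cmod (s x) ^+ 2)%:E <= \int[cZ2]_i (cmod (dist_coef i) ^+ 2)%:E)%E.
Proof.
pose rw j := (\int[cZ]_l (cmod (dist_coef (j, l)) ^+ 2)%:E)%E.
have rw0 j : (0 <= rw j)%E by apply: integral_ge0 => l _; rewrite lee_fin sqr_ge0.
have rwE : (\int[cZ2]_i (cmod (dist_coef i) ^+ 2)%:E = \int[cZ]_j rw j)%E.
  rewrite (@tonelli12 _ _ _ _ _ cZ cZ cZ2 erefl)//; last 2 first.
  - exact: (discrete_measurable_fun dZ2).
  - by move=> z; rewrite lee_fin sqr_ge0.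
have rwoo j : (rw j < +oo)%E.
  by apply: le_lt_trans c2; rewrite rwE; exact: (le_point_integral dZ j rw0).
have opp_inj : injective (fun k : Zn n => - k) by exact: oppr_inj.
(* The pairing of [s] with a test function involves no conjugation, so [c(j,l)] is the coefficient
   of [s] at frequency [- l]. *)
have chiN := orthonormal_system_comp opp_inj (orthonormal_character R n).
have rf j := riesz_fischer (c := fun l => dist_coef (j, l)) dZ chiN (rwoo j).
have [s_ s_P] := choice rf.
pose s (x : Zn n * torus R n) := s_ x.1 x.2.
have ms : cmeasurable s.
  by apply: (cmeasurable_discrete_prod dZ) => j; have [] := s_P j.
have ms2 : measurable_fun setT (fun x => (cmod (s x) ^+ 2)%:E).
  by apply/measurable_EFinP; apply: measurable_funX; exact: measurable_cmod.
have sle : (\int[mu_phase R n]_x (cmod (s x) ^+ 2)%:E <= \int[cZ2]_i (cmod (dist_coef i) ^+ 2)%:E)%E.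
  rewrite rwE (@tonelli12 _ _ _ _ _ cZ (haar R n) (mu_phase R n) erefl)//; last first.
    by move=> z; rewrite lee_fin sqr_ge0.
  apply: ge0_le_integral => //.
  - by move=> j _; apply: integral_ge0 => y _; rewrite lee_fin sqr_ge0.
  - by move=> j _; have [] := s_P j.
exists s; split=> //; split=> // F hF.
have mF : cmeasurable F.
  apply: (cmeasurable_discrete_prod dZ) => j; exact: cmeasurable_schwartzZT_row.
have mF2 : measurable_fun setT (fun x => (cmod (F x) ^+ 2)%:E).
  by apply/measurable_EFinP; apply: measurable_funX; exact: measurable_cmod.
have msF : cmeasurable (fun x => s x * F x) by exact: cmeasurableM.
have sFi : cintegrable (mu_phase R n) (fun x => s x * F x).
  apply/cintegrableP; split=> //.
  apply: (@le_lt_trans _ _ (\int[mu_phase R n]_x ((cmod (s x) ^+ 2)%:E + (cmod (F x) ^+ 2)%:E))%E).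
    apply: ge0_le_integral => //.
    - by move=> x _; rewrite lee_fin cmod_ge0.
    - exact: measurable_ecmod.
    - exact: emeasurable_funD.
    - move=> x _; rewrite -EFinD lee_fin cmodM.
      have := cmod_ge0 (s x); have := cmod_ge0 (F x).
      have := sqr_ge0 (cmod (s x) - cmod (F x)); nra.
  rewrite ge0_integralD//; last 2 first.
  - by move=> x _; rewrite lee_fin sqr_ge0.
  - by move=> x _; rewrite lee_fin sqr_ge0.
  apply: lte_add_pinfty; first exact: le_lt_trans c2.
  by rewrite fourier_plancherel//; exact: crapid2_cmod_sqr (crapid_fourier hF).
split=> //; have [Fci ->] := dist_schwartz hF.
rewrite (@cfubini12 _ _ _ _ _ cZ cZ cZ2 erefl)//.
rewrite (@cfubini12 _ _ _ _ _ cZ (haar R n) (mu_phase R n) erefl)//.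
apply: cintegral_ext => j.
have bi := crapid_cintegrable dZ (crapid_row j (crapid_fourier hF)).
have [msj sj2 scoef] := s_P j.
have sji : cintegrable (haar R n) (s_ j).
  apply/cintegrableP; split=> //.
  apply: (@le_lt_trans _ _ (\int[haar R n]_y (1%:E + (cmod (s_ j y) ^+ 2)%:E))%E).
    apply: ge0_le_integral => //.
    - by move=> y _; rewrite lee_fin cmod_ge0.
    - exact: measurable_ecmod.
    - by apply: emeasurable_funD => //; apply/measurable_EFinP; apply: measurable_funX; exact: measurable_cmod.
    - by move=> y _; rewrite -EFinD lee_fin; have := sqr_ge0 (cmod (s_ j y) - 1); nra.
  rewrite ge0_integralD//; last 2 first.
  - by move=> y _; rewrite lee_fin sqr_ge0.
  - by apply/measurable_EFinP; apply: measurable_funX; exact: measurable_cmod.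
  rewrite integral_prob_cst; apply: lte_add_pinfty; first exact: ltry.
  exact: le_lt_trans sj2 (rwoo j).
(* Within a row, [F] is replaced by its Fourier series and [synthesis_pairing] moves the integral
   inside the sum. *)
transitivity (cintegral (haar R n) (fun y =>
    synthesis cZ (@character R n) (fun l => fourier F j l) y * s_ j y)).
  rewrite (synthesis_pairing dZ chiP bi sji); apply: cintegral_ext => l /=.
  rewrite -(scoef l); congr (_ * _); apply: cintegral_ext => y.
  by rewrite character_conj conjCK mulrC.
by apply: cintegral_ext => y; rewrite (fourier_inversion hF) mulrC.
Qed.

End distributions_on_phase_space.

(** * The localization operator *)

Section squares.
Context d (T : measurableType d) (R : realType) (mu : {measure set T -> \bar R}).

Lemma le_of_sqr (X : \bar R) (A : R) : (0 <= X)%E -> 0 <= A ->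
  (X ^+ 2 <= (A ^+ 2)%:E)%E -> (X <= A%:E)%E.
Proof.
case: X => [r| |]//; rewrite !lee_fin => r0 A0.
  by rewrite -expr2 ler_pXn2r ?nnegrE.

Qed.

Lemma cauchy_schwarz_le (f g : T -> R) (A B : R) :
  measurable_fun setT f -> measurable_fun setT g ->
  (forall x, 0 <= f x) -> (forall x, 0 <= g x) -> 0 <= A -> 0 <= B ->
  (\int[mu]_x (f x ^+ 2)%:E <= (A ^+ 2)%:E)%E ->
  (\int[mu]_x (g x ^+ 2)%:E <= (B ^+ 2)%:E)%E ->
  (\int[mu]_x (f x * g x)%:E <= (A * B)%:E)%E.
Proof.
move=> mf mg f0 g0 A0 B0 fA gB; apply: le_of_sqr; last first.
- apply: (le_trans (cauchy_schwarz mu mf mg f0 g0)); rewrite exprMn EFinM.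
  by apply: lee_pmul => //; apply: integral_ge0 => x _; rewrite lee_fin sqr_ge0.
- exact: mulr_ge0.
- by apply: integral_ge0 => x _; rewrite lee_fin mulr_ge0.
Qed.

Lemma cLnorm2_le (f : T -> R[i]) (A : R) : 0 <= A ->
  (\int[mu]_x (cmod (f x) ^+ 2)%:E <= (A ^+ 2)%:E)%E -> (cLnorm mu 2%:E f <= A%:E)%E.
Proof. by move=> A0; rewrite -cLnorm_sqr; apply: le_of_sqr => //; exact: cLnorm_ge0. Qed.

Lemma cLnorm2_fin (f : T -> R[i]) : (cLnorm mu 2%:E f < +oo)%E ->
  (\int[mu]_x (cmod (f x) ^+ 2)%:E = (fine (cLnorm mu 2%:E f) ^+ 2)%:E)%E.
Proof.
move=> foo; rewrite -cLnorm_sqr EFin_expe fineK//.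
by rewrite ge0_fin_numE// cLnorm_ge0.
Qed.

Lemma cLnorm2_lty (f : T -> R[i]) : (\int[mu]_x (cmod (f x) ^+ 2)%:E < +oo)%E ->
  (cLnorm mu 2%:E f < +oo)%E.
Proof.
rewrite -cLnorm_sqr; case: (cLnorm mu 2%:E f) => [r _| |]//; exact: ltry.
Qed.

End squares.

(** * The short-time Fourier transform on l^2 *)

Section stft_l2.
Variables (R : realType) (n : nat).
Local Notation cZ := (@countZ R n).
Local Notation cZ2 := (countZ2 R n).
Local Notation mp := (mu_phase R n).
Let dZ : discrete cZ := discrete_countZ R n.
Let dZ2 : discrete cZ2 := discrete_countZ2 R n.

Lemma orthonormal_characterN :
  orthonormal_system (haar R n) (fun k : Zn n => @character R n (- k)).
Proof. by apply: orthonormal_system_comp (orthonormal_character R n); exact: oppr_inj. Qed.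

Let chiN := orthonormal_characterN.

Lemma le_norm2_point (f : Zn n -> R[i]) (A : R) k : 0 <= A ->
  (\int[cZ]_k (cmod (f k) ^+ 2)%:E <= (A ^+ 2)%:E)%E -> cmod (f k) <= A.
Proof.
move=> A0 fA; have : ((cmod (f k) ^+ 2)%:E <= (A ^+ 2)%:E)%E.
  apply: le_trans fA; apply: (@le_point_integral _ _ _ cZ dZ (fun k => (cmod (f k) ^+ 2)%:E) k) => j.
  by rewrite lee_fin sqr_ge0.
by rewrite lee_fin ler_pXn2r ?nnegrE ?cmod_ge0.
Qed.

Lemma integral_translate (u : Zn n -> R[i]) (m : Zn n) :
  (\int[cZ]_k (cmod (u (k - m)) ^+ 2)%:E = \int[cZ]_k (cmod (u k) ^+ 2)%:E)%E.
Proof.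
apply: (@integral_countZ_bij R n (fun k => k - m) (fun k => k + m)
  (fun k => (cmod (u k) ^+ 2)%:E) (subrK m) (addrK m)) => k.
by rewrite lee_fin sqr_ge0.
Qed.

Lemma integral_reflect (u : Zn n -> R[i]) (k : Zn n) :
  (\int[cZ]_m (cmod (u (k - m)) ^+ 2)%:E = \int[cZ]_k (cmod (u k) ^+ 2)%:E)%E.
Proof.
have K : cancel (fun m => k - m) (fun m => k - m).
  by move=> m; rewrite opprB addrC subrK.
apply: (@integral_countZ_bij R n _ _ (fun k => (cmod (u k) ^+ 2)%:E) K K) => m.
by rewrite lee_fin sqr_ge0.
Qed.

Variables (u f : Zn n -> R[i]) (K F : R).
Hypotheses (K0 : 0 <= K) (F0 : 0 <= F).
Hypothesis uK : (\int[cZ]_k (cmod (u k) ^+ 2)%:E <= (K ^+ 2)%:E)%E.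
Hypothesis fF : (\int[cZ]_k (cmod (f k) ^+ 2)%:E <= (F ^+ 2)%:E)%E.

Lemma stftE m w : stft u f (m, w) =
  synthesis cZ (fun k => @character R n (- k)) (fun k => f k * ((u (k - m))^*)%R) w.
Proof. by apply: cintegral_ext => k; rewrite /character dotNl. Qed.

Lemma stft_row_le m : (\int[cZ]_k (cmod (f k * ((u (k - m))^*)%R))%:E <= (F * K)%:E)%E.
Proof.
rewrite (eq_integral (fun k => (cmod (f k) * cmod (u (k - m)))%:E)) => [|k _]; last first.
  by rewrite cmodM cmod_conj.
apply: cauchy_schwarz_le => //; try exact: (discrete_measurable_fun dZ).
- by move=> k; exact: cmod_ge0.
- by move=> k; exact: cmod_ge0.
- by rewrite integral_translate.
Qed.

Lemma stft_row_integrable m : cintegrable cZ (fun k => f k * ((u (k - m))^*)%R).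
Proof.
apply/cintegrableP; split; first exact: (discrete_cmeasurable dZ).
exact: le_lt_trans (stft_row_le m) (ltry _).
Qed.

Lemma cmod_stft_le x : cmod (stft u f x) <= F * K.
Proof.
case: x => m w; rewrite stftE -lee_fin.
exact: le_trans (cmod_synthesis_le dZ chiN w (stft_row_integrable m)) (stft_row_le m).
Qed.

Lemma cmeasurable_stft : cmeasurable (stft u f).
Proof.
apply: (cmeasurable_discrete_prod dZ) => m.
rewrite (_ : (fun t => _) = synthesis cZ (fun k => @character R n (- k))
  (fun k => f k * ((u (k - m))^*)%R)); last by apply/funext => w; exact: stftE.
exact: (cmeasurable_synthesis dZ chiN).
Qed.

(** The upper half of Moyal's identity. Parseval in [w] turns row [m] into the sum of
    [|f k|^2 |u (k - m)|^2], and summing over [m] first yields the full norm of [u] for each [k]. *)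
Lemma stft_l2_le : (\int[mp]_x (cmod (stft u f x) ^+ 2)%:E <= ((F * K) ^+ 2)%:E)%E.
Proof.
rewrite (@tonelli12 _ _ _ _ _ cZ (haar R n) mp erefl); last 2 first.
- by apply/measurable_EFinP; apply: measurable_funX; apply: measurable_cmod; exact: cmeasurable_stft.
- by move=> z; rewrite lee_fin sqr_ge0.
pose H (z : Zn n * Zn n) := (cmod (f z.2) ^+ 2 * cmod (u (z.2 - z.1)) ^+ 2)%:E.
have H0 z : (0 <= H z)%E by rewrite lee_fin mulr_ge0 ?sqr_ge0.
rewrite (eq_integral (fun m => \int[cZ]_k H (m, k))%E) => [|m _]; last first.
  rewrite (eq_integral (fun w => (cmod (synthesis cZ (fun k => @character R n (- k))
    (fun k => f k * ((u (k - m))^*)%R) w) ^+ 2)%:E)) => [|w _]; last by rewrite stftE.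
  rewrite (parseval_synthesis dZ chiN (stft_row_integrable m)).
  by apply: eq_integral => k _; rewrite cmodM cmod_conj exprMn.
rewrite -(@tonelli12 _ _ _ _ _ cZ cZ cZ2 erefl)//; last exact: (discrete_measurable_fun dZ2).
rewrite (@tonelli21 _ _ _ _ _ cZ cZ cZ2 erefl)//; last exact: (discrete_measurable_fun dZ2).
apply: (@le_trans _ _ (\int[cZ]_k ((K ^+ 2)%:E * (cmod (f k) ^+ 2)%:E))%E).
  apply: ge0_le_integral.
  - exact: measurableT.
  - by move=> k _; apply: integral_ge0 => m _; exact: H0.
  - exact: (discrete_measurable_fun dZ).
  - exact: (discrete_measurable_fun dZ).
  move=> k _; rewrite (eq_integral (fun m : Zn n => (cmod (f k) ^+ 2)%:E * (cmod (u (k - m)) ^+ 2)%:E)%E)//.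
  rewrite ge0_integralZl_EFin ?sqr_ge0//.
  - by rewrite integral_reflect muleC; apply: lee_wpmul2r => //; rewrite lee_fin sqr_ge0.
  - by move=> m _; rewrite lee_fin sqr_ge0.
rewrite ge0_integralZl_EFin ?sqr_ge0//.
  rewrite (_ : (F * K) ^+ 2 = K ^+ 2 * F ^+ 2); last by ring.
  by rewrite [leRHS]EFinM; apply: lee_wpmul2l => //; rewrite lee_fin sqr_ge0.
by move=> m _; rewrite lee_fin sqr_ge0.
Qed.

End stft_l2.

(** * Bounded operators on l^2 *)

Section l2_operators.
Variables (R : realType) (n : nat).
Local Notation cZ := (@countZ R n).
Implicit Types (f h : Zn n -> R[i]) (A B : (Zn n -> R[i]) -> (Zn n -> R[i])).
Let dZ : discrete cZ := discrete_countZ R n.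

Lemma l2P f : l2 f <-> (\int[cZ]_k (cmod (f k) ^+ 2)%:E < +oo)%E.
Proof.
split=> [[_ foo]|foo]; first by rewrite cLnorm2_fin// ltry.
by split; [exact: (discrete_cmeasurable dZ)|exact: cLnorm2_lty].
Qed.

Lemma l2_fine f : l2 f ->
  (\int[cZ]_k (cmod (f k) ^+ 2)%:E = (fine (norm2 f) ^+ 2)%:E)%E.
Proof. by case=> _; exact: cLnorm2_fin. Qed.

Lemma norm2_ge0 f : 0 <= fine (norm2 f).
Proof. exact: fine_ge0 (cLnorm_ge0 _ _ _). Qed.

Lemma bounded_on_l2_point A : bounded_on_l2 A -> exists C : R, 0 <= C /\
  forall f k, l2 f -> cmod (A f k) <= C * fine (norm2 f).
Proof.
case=> Al2 _ [C AC]; exists `|C|; split=> // f k fl2.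
apply: (le_norm2_point k (mulr_ge0 (normr_ge0 _) (norm2_ge0 f))).
rewrite (l2_fine (Al2 _ fl2)) lee_fin; apply: lerXn2r; rewrite ?nnegrE ?norm2_ge0//.
  by rewrite mulr_ge0 ?norm2_ge0.
have Nf : norm2 f \is a fin_num by rewrite ge0_fin_numE ?cLnorm_ge0//; case: fl2.
have NA : norm2 (A f) \is a fin_num by rewrite ge0_fin_numE ?cLnorm_ge0//; case: (Al2 _ fl2).
rewrite -lee_fin fineK// (le_trans (AC _ fl2))// EFinM fineK//.
by apply: lee_wpmul2r; [exact: cLnorm_ge0|rewrite lee_fin ler_norm].
Qed.

Section truncation.
Variable code : Zn n -> nat.
Hypothesis code_inj : injective code.

Definition trunc N f k : R[i] := if (code k < N)%N then f k else 0.

Lemma schwartzZ_trunc N f : schwartzZ (trunc N f).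
Proof.
apply: crapid_schwartzZ => M.
have /cintegrableP[_] := cintegrable_trunc dZ code_inj
  (fun k => ((weight R k ^+ M * cmod (f k))%:C : R[i])) N.
apply: le_lt_trans; apply: ge0_le_integral => //.
- by move=> k _; rewrite lee_fin mulr_ge0 ?cmod_ge0 ?exprn_ge0 ?weight_ge0.
- move=> k _; rewrite lee_fin /trunc; case: ifP => _.
    by rewrite cmod_real ler_norm.
  by rewrite cmod0 mulr0.
Qed.

Lemma l2_schwartzZ f : schwartzZ f -> l2 f.
Proof. by move=> hf; apply/l2P; exact: crapid_cmod_sqr (schwartzZ_crapid hf). Qed.

Let tail N f k : R := if (code k < N)%N then 0 else cmod (f k) ^+ 2.

Let tailE N f k : cmod (f k - trunc N f k) ^+ 2 = tail N f k.
Proof.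
by rewrite /trunc /tail; case: ifP => _; rewrite ?subrr ?subr0// cmod0 expr0n.
Qed.

Let tail_l2 N f : l2 f -> l2 (fun k => f k - trunc N f k).
Proof.
move/l2P => foo; apply/l2P; apply: le_lt_trans foo; apply: ge0_le_integral => //.
- by move=> k _; rewrite lee_fin sqr_ge0.
- by move=> k _; rewrite lee_fin tailE /tail; case: ifP => // _; rewrite sqr_ge0.
Qed.

(** Truncations have finite support, hence are Schwartz, and approximate [f] in l^2. As point
    evaluations are bounded on l^2, the two operators can be compared at each [k]. *)
Lemma bounded_on_l2_unique A B : bounded_on_l2 A -> bounded_on_l2 B ->
  (forall f, schwartzZ f -> A f = B f) -> forall f, l2 f -> A f = B f.
Proof.
move=> hA hB AB f fl2; apply/funext => k.
have [CA [CA0 CAP]] := bounded_on_l2_point hA.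
have [CB [CB0 CBP]] := bounded_on_l2_point hB.
apply/eqP; rewrite -subr_eq0; apply/eqP/cmod_eq0/eqP; rewrite -sqrf_eq0; apply/eqP.
set z := A f k - B f k.
have sub D N : bounded_on_l2 D ->
    D (fun k => f k - trunc N f k) k = D f k - D (trunc N f) k.
  case=> _ Dlin _; have := Dlin 1 _ _ (tail_l2 N fl2) (l2_schwartzZ (schwartzZ_trunc N f)).
  rewrite (_ : (fun k => 1 * _ + _) = f); last by apply/funext => j; rewrite mul1r subrK.
  by move=> ->; rewrite mul1r addrK.
pose t N := fine (\int[cZ]_k (tail N f k)%:E)%E.
have bound N : cmod z ^+ 2 <= (CA + CB) ^+ 2 * t N.
  have tE : t N = fine (norm2 (fun k => f k - trunc N f k)) ^+ 2.
    apply/EFin_inj; rewrite -(l2_fine (tail_l2 N fl2)) /t; under eq_integral do rewrite -tailE.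
    by rewrite fineK// (l2_fine (tail_l2 N fl2)).
  rewrite tE -exprMn; apply: lerXn2r; rewrite ?nnegrE ?cmod_ge0//.
    by rewrite mulr_ge0 ?addr_ge0 ?norm2_ge0.
  (* The operators agree on the truncation, so their difference at [f] is already their difference
     at the tail. *)
  have -> : z = A (fun k => f k - trunc N f k) k - B (fun k => f k - trunc N f k) k.
    by rewrite !sub// /z (AB (trunc N f)) ?opprB ?addrA ?subrK//; exact: schwartzZ_trunc.
  rewrite (le_trans (cmodB _ _))// mulrDl lerD//; [apply: CAP|apply: CBP]; exact: tail_l2.
have t0 : t N @[N --> \oo] --> (0 : R).
  have /fine_cvgP[_] : (\int[cZ]_k (tail N f k)%:E)%E @[N --> \oo] --> (0 : R)%:E.
    apply: (integral_tail dZ code (F := fun k => cmod (f k) ^+ 2)); first by move=> j; rewrite sqr_ge0.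
    exact/l2P.
  exact.
have : cmod z ^+ 2 @[N --> \oo] --> (0 : R).
  apply: (@squeeze_cvgr _ _ _ _ (fun=> 0) (fun N => (CA + CB) ^+ 2 * t N)).
  - by near=> N; rewrite sqr_ge0 bound.
  - exact: cvg_cst.
  - by rewrite -[X in _ --> X](mulr0 ((CA + CB) ^+ 2)); exact: cvgMl_tmp.
move=> h; apply: (cvg_unique _ _ h) => //; exact: cvg_cst.
Unshelve. all: by end_near.
Qed.

End truncation.
End l2_operators.

(** * Norm bound and weak form of the operator *)

Section localization_operator.
Variables (R : realType) (n : nat).
Local Notation cZ := (@countZ R n).
Local Notation mp := (mu_phase R n).
Let dZ : discrete cZ := discrete_countZ R n.
Let cMP : {measure set (Zn n * (Zn n * torus R n)) -> \bar R} := (cZ \x mp)%E.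

Variables (s : Zn n * torus R n -> R[i]) (u1 u2 : Zn n -> R[i]) (S K1 K2 : R).
Hypotheses (S0 : 0 <= S) (K10 : 0 <= K1) (K20 : 0 <= K2) (ms : cmeasurable s).
Hypothesis sS : (\int[mp]_x (cmod (s x) ^+ 2)%:E <= (S ^+ 2)%:E)%E.
Hypothesis uK1 : (\int[cZ]_k (cmod (u1 k) ^+ 2)%:E <= (K1 ^+ 2)%:E)%E.
Hypothesis uK2 : (\int[cZ]_k (cmod (u2 k) ^+ 2)%:E <= (K2 ^+ 2)%:E)%E.

Lemma stft_linear (a : R[i]) f h x : l2 f -> l2 h ->
  stft u1 (fun k => a * f k + h k) x = a * stft u1 f x + stft u1 h x.
Proof.
case: x => m w fl2 hl2.
have H v : l2 v -> cintegrable cZ (fun k => v k * ((u1 (k - m))^*)%R).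
  by move=> vl2; apply: (stft_row_integrable K10 (norm2_ge0 v) uK1); rewrite (l2_fine vl2).
have chiN := @orthonormal_characterN R n.
rewrite !stftE /synthesis -cintegralZ; last exact: (cintegrable_synthesis_term dZ chiN _ (H _ fl2)).
rewrite -cintegralD; first by apply: cintegral_ext => k; ring.
  by apply: cintegrableZ; exact: (cintegrable_synthesis_term dZ chiN _ (H _ fl2)).
exact: (cintegrable_synthesis_term dZ chiN _ (H _ hl2)).
Qed.

Section one_function.
Variables (f : Zn n -> R[i]) (fl2 : l2 f).
Let F := fine (norm2 f).
Let F0 : 0 <= F := norm2_ge0 f.
Let fF : (\int[cZ]_k (cmod (f k) ^+ 2)%:E <= (F ^+ 2)%:E)%E.
Proof. by rewrite (l2_fine fl2). Qed.

Let phi x := s x * stft u1 f x.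
Let T := S * (F * K1).
Let T0 : 0 <= T. Proof. by rewrite !mulr_ge0. Qed.

Let mphi : cmeasurable phi.
Proof. by apply: cmeasurableM => //; exact: cmeasurable_stft. Qed.

(** Cauchy-Schwarz for the symbol and the transform, both in L^2. Integrability of [phi] is the
    source of every absolute convergence below. *)
Let phi_le : (\int[mp]_x (cmod (phi x))%:E <= T%:E)%E.
Proof.
rewrite (eq_integral (fun x => (cmod (s x) * cmod (stft u1 f x))%:E)) => [|x _]; last by rewrite cmodM.
apply: cauchy_schwarz_le => //.
- exact: measurable_cmod.
- by apply: measurable_cmod; exact: cmeasurable_stft.
- by move=> x; exact: cmod_ge0.
- by move=> x; exact: cmod_ge0.
- exact: mulr_ge0.
- exact: (stft_l2_le K10 F0 uK1 fF).
Qed.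

Let phi_oo : (\int[mp]_x (cmod (phi x))%:E < +oo)%E.
Proof. exact: le_lt_trans phi_le (ltry _). Qed.

Let bounded_mul (g : Zn n * torus R n -> R[i]) (M : R) : cmeasurable g ->
  (forall x, cmod (g x) <= M) -> cintegrable mp (fun x => phi x * g x).
Proof.
move=> mg gM; apply: (@le_cintegrable _ _ _ _ _ (fun x => M * cmod (phi x))).
- exact: cmeasurableM.
- by move=> x; rewrite cmodM mulrC ler_wpM2r ?cmod_ge0.
- rewrite /comp; under eq_fun do rewrite EFinM.
  apply: integrableZl => //; apply/integrableP; split; first exact: measurable_ecmod.
  by under eq_integral do rewrite abse_EFin ger0_norm ?cmod_ge0//.
Qed.

Let atom k (x : Zn n * torus R n) : R[i] := expi (dot k x.2) * u2 (k - x.1).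

Let matom k : cmeasurable (atom k).
Proof.
apply: (cmeasurable_discrete_prod dZ) => m.
apply: (@cmeasurableM _ _ _ (character k) (fun=> u2 (k - m))); first exact: cmeasurable_character.
exact: cmeasurable_cst.
Qed.

Let cmod_atom k x : cmod (atom k x) = cmod (u2 (k - x.1)).
Proof. by rewrite /atom cmodM cmod_expi mul1r. Qed.

Lemma cintegrable_locop k : cintegrable mp (locop_integrand s u1 u2 f k).
Proof.
apply: (bounded_mul (matom k) (M := K2)) => x.
by rewrite cmod_atom; exact: (le_norm2_point _ K20 uK2).
Qed.

Let Phi2 (z : Zn n * (Zn n * torus R n)) : \bar R :=
  (cmod (phi z.2) * cmod (u2 (z.1 - z.2.1)) ^+ 2)%:E.

Let Phi2_ge0 z : (0 <= Phi2 z)%E.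
Proof. by rewrite lee_fin mulr_ge0 ?cmod_ge0 ?sqr_ge0. Qed.

Let mu2 k : measurable_fun setT (fun x : Zn n * torus R n => cmod (u2 (k - x.1))).
Proof.
rewrite (_ : (fun x => _) = fun x => cmod (atom k x)); first exact: measurable_cmod.
by apply/funext => x; rewrite cmod_atom.
Qed.

Let mPhi2 : measurable_fun setT Phi2.
Proof.
apply: (measurable_fun_discrete_prod dZ) => k; apply/measurable_EFinP.
by apply: measurable_funM; [exact: measurable_cmod|apply: measurable_funX; exact: mu2].
Qed.

(** Summing over [k] first, translation invariance gives [||u2||_2^2] independently of [x], and
    [phi] remains to be integrated. *)
Let Phi2_le : (\int[cZ]_k \int[mp]_x Phi2 (k, x) <= (T * K2 ^+ 2)%:E)%E.
Proof.
rewrite -(@tonelli12 _ _ _ _ _ cZ mp cMP erefl)// (@tonelli21 _ _ _ _ _ cZ mp cMP erefl)//.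
apply: (@le_trans _ _ (\int[mp]_x ((K2 ^+ 2)%:E * (cmod (phi x))%:E))%E).
  apply: ge0_le_integral.
  - exact: measurableT.
  - by move=> x _; apply: integral_ge0 => k _.
  - exact: (measurable_fun_fubini_tonelli_G (m1 := cZ) Phi2).
  - by apply: measurable_funeM; exact: measurable_ecmod.
  move=> x _.
  rewrite (eq_integral (fun k : Zn n => (cmod (phi x))%:E * (cmod (u2 (k - x.1)) ^+ 2)%:E)%E)//.
  rewrite ge0_integralZl_EFin ?cmod_ge0//.
  - by rewrite integral_translate muleC; apply: lee_wpmul2r => //; rewrite lee_fin cmod_ge0.
  - by move=> k _; rewrite lee_fin sqr_ge0.
rewrite ge0_integralZl_EFin ?sqr_ge0//.
- by rewrite mulrC [leRHS]EFinM; apply: lee_wpmul2l => //; rewrite lee_fin sqr_ge0.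
- by move=> x _; rewrite lee_fin cmod_ge0.
- exact: measurable_ecmod.
Qed.

(* Young's inequality: Cauchy-Schwarz for the finite measure [|phi| dx] *)
Let young k : ((cmod (locop s u1 u2 f k) ^+ 2)%:E <= T%:E * \int[mp]_x Phi2 (k, x))%E.
Proof.
set L := (\int[mp]_x (cmod (phi x) * cmod (u2 (k - x.1)))%:E)%E.
have L0 : (0 <= L)%E by apply: integral_ge0 => x _; rewrite lee_fin mulr_ge0 ?cmod_ge0.
have le1 : ((cmod (locop s u1 u2 f k))%:E <= L)%E.
  apply: (le_trans (cmod_cintegral_le (cintegrable_locop k))).
  rewrite le_eqVlt; apply/orP; left; apply/eqP; apply: eq_integral => x _.
  rewrite -(cmod_atom k x) -cmodM; congr (cmod _)%:E.
apply: (@le_trans _ _ (L ^+ 2)%E).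
  by rewrite EFin_expe !expe2; apply: lee_pmul => //; rewrite lee_fin cmod_ge0.
have mroot : measurable_fun setT (fun x => Num.sqrt (cmod (phi x))).
  by apply: (measurableT_comp (continuous_measurable_fun (@sqrt_continuous R))); exact: measurable_cmod.
have -> : L = (\int[mp]_x (Num.sqrt (cmod (phi x)) *
    (Num.sqrt (cmod (phi x)) * cmod (u2 (k - x.1))))%:E)%E.
  by apply: eq_integral => x _; rewrite mulrA -expr2 sqr_sqrtr ?cmod_ge0.
apply: (le_trans (@cauchy_schwarz _ _ _ mp _ _ mroot _ _ _)).
- by apply: measurable_funM => //; exact: mu2.
- by move=> x; exact: sqrtr_ge0.
- by move=> x; rewrite mulr_ge0 ?sqrtr_ge0 ?cmod_ge0.
apply: lee_pmul.
- by apply: integral_ge0 => x _; rewrite lee_fin sqr_ge0.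
- by apply: integral_ge0 => x _; rewrite lee_fin sqr_ge0.
- by under eq_integral do rewrite sqr_sqrtr ?cmod_ge0//; exact: phi_le.
- rewrite le_eqVlt; apply/orP; left; apply/eqP; apply: eq_integral => x _.
  by rewrite exprMn sqr_sqrtr ?cmod_ge0.
Qed.

Lemma locop_l2_le :
  (\int[cZ]_k (cmod (locop s u1 u2 f k) ^+ 2)%:E <= ((S * K1 * K2 * F) ^+ 2)%:E)%E.
Proof.
apply: (@le_trans _ _ (\int[cZ]_k (T%:E * \int[mp]_x Phi2 (k, x)))%E).
  apply: ge0_le_integral => //; first by move=> k _; rewrite lee_fin sqr_ge0.
rewrite ge0_integralZl_EFin//; last by move=> k _; apply: integral_ge0 => x _.
apply: (@le_trans _ _ (T%:E * (T * K2 ^+ 2)%:E)%E); first by apply: lee_wpmul2l; rewrite ?lee_fin.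
by rewrite -EFinM lee_fin le_eqVlt /T; apply/orP; left; apply/eqP; ring.
Qed.

(** Fubini on Z^n times phase space. By [stft_row_le] the sum over [k] is at most [H * K2] uniformly
    in [x], so integrability of [phi] makes the double integrand absolutely integrable. *)
Lemma weak_locop h : l2 h -> cintegrable mp (weak_locop_integrand s u1 u2 f h) /\
  inner2 (locop s u1 u2 f) h = cintegral mp (weak_locop_integrand s u1 u2 f h).
Proof.
move=> hl2; pose H := fine (norm2 h); have H0 : 0 <= H := norm2_ge0 h.
have hH : (\int[cZ]_k (cmod (h k) ^+ 2)%:E <= (H ^+ 2)%:E)%E by rewrite (l2_fine hl2).
have mst : cmeasurable (stft u2 h) by exact: cmeasurable_stft.
split.
  apply: (bounded_mul (M := H * K2)); first exact: cmeasurable_conj.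
  by move=> x; rewrite cmod_conj; exact: (cmod_stft_le K20 H0 uK2 hH).
pose J (z : Zn n * (Zn n * torus R n)) : R[i] := (phi z.2 * atom z.1 z.2) * ((h z.1)^*)%R.
have mJ : cmeasurable J.
  apply: (cmeasurable_discrete_prod dZ) => k.
  apply: (@cmeasurableM _ _ _ (fun x => phi x * atom k x) (fun=> ((h k)^*)%R)).
    exact: cmeasurableM.
  exact: cmeasurable_cst.
have cJ k x : cmod (J (k, x)) = cmod (phi x) * cmod (h k * ((u2 (k - x.1))^*)%R).
  by rewrite /J /= !cmodM cmod_expi !cmod_conj mul1r; ring.
have Ji : cintegrable cMP J.
  apply: (@cintegrable21 _ _ _ _ _ cZ mp cMP erefl) => //.
  apply: (@le_lt_trans _ _ (\int[mp]_x ((H * K2)%:E * (cmod (phi x))%:E))%E).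
    apply: ge0_le_integral.
    - exact: measurableT.
    - by move=> x _; apply: integral_ge0 => k _; rewrite lee_fin cmod_ge0.
    - apply: (measurable_fun_fubini_tonelli_G (m1 := cZ) (fun z => (cmod (J z))%:E)).
        exact: measurable_ecmod.
      by move=> z; rewrite lee_fin cmod_ge0.
    - by apply: measurable_funeM; exact: measurable_ecmod.
    move=> x _; under eq_integral do rewrite cJ EFinM.
    rewrite ge0_integralZl_EFin ?cmod_ge0//.
    + by rewrite muleC; apply: lee_wpmul2r; [rewrite lee_fin cmod_ge0|exact: (stft_row_le K20 H0 uK2 hH)].
    + by move=> k _; rewrite lee_fin cmod_ge0.
  rewrite ge0_integralZl_EFin ?mulr_ge0//.
  - by apply: lte_mul_pinfty => //; rewrite lee_fin mulr_ge0.
  - by move=> x _; rewrite lee_fin cmod_ge0.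
  - exact: measurable_ecmod.
have E12 := @cfubini12 _ _ _ _ _ cZ mp cMP erefl J Ji.
have E21 := @cfubini21 _ _ _ _ _ cZ mp cMP erefl J Ji.
transitivity (cintegral cZ (fun k => cintegral mp (fun x => J (k, x)))).
  apply: cintegral_ext => k; rewrite mulrC -cintegralZ; last exact: cintegrable_locop.
  by apply: cintegral_ext => x; rewrite mulrC.
rewrite -E12 E21; apply: cintegral_ext => -[m w].
have ri := stft_row_integrable K20 H0 uK2 hH m.
have chiN := @orthonormal_characterN R n.
have ti := cintegrable_synthesis_term dZ chiN w ri.
rewrite /weak_locop_integrand -[s _ * _]/(phi (m, w)) stftE /synthesis -(cintegral_conj ti).
rewrite -cintegralZ; last exact: cintegrable_conj.
apply: cintegral_ext => k; rewrite /J /atom /= !rmorphM /= conjCK.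
rewrite -[character (- k) w]/(expi (dot (- k) w)) dotNl expiN conjCK; ring.
Qed.

End one_function.

Lemma locop_bounded : bounded_on_l2 (locop s u1 u2) /\
  (opnorm2 (locop s u1 u2) <= (S * K1 * K2)%:E)%E.
Proof.
have SK0 : 0 <= S * K1 * K2 by rewrite !mulr_ge0.
have le f : l2 f -> (norm2 (locop s u1 u2 f) <= (S * K1 * K2)%:E * norm2 f)%E.
  move=> fl2; have Nf : norm2 f \is a fin_num by rewrite ge0_fin_numE ?cLnorm_ge0//; case: fl2.
  rewrite -[norm2 f]fineK// -EFinM; apply: cLnorm2_le; first by rewrite mulr_ge0 ?norm2_ge0.
  exact: locop_l2_le.
split; first split.
- by move=> f fl2; apply/l2P; exact: le_lt_trans (locop_l2_le fl2) (ltry _).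
- move=> a f h fl2 hl2; apply/funext => k.
  rewrite /locop -cintegralZ; last exact: cintegrable_locop.
  rewrite -cintegralD; last 2 first.
  + by apply: cintegrableZ; exact: cintegrable_locop.
  + exact: cintegrable_locop.
  by apply: cintegral_ext => x; rewrite /locop_integrand stft_linear//; ring.
- by exists (S * K1 * K2).
apply: ge_ereal_sup => _ [f [fl2 f1] <-].
apply: (le_trans (le f fl2)); rewrite -[leRHS]mule1.
by apply: lee_wpmul2l; rewrite ?lee_fin.
Qed.

End localization_operator.

Theorem theorem4p5 (R : realType) (n : nat)
  (g : Zn n -> R[i]) (G : Zn n * torus R n -> R[i])
  (hg : schwartzZ g) (g_neq0 : exists k, g k != 0)
  (hG : schwartzZT G) (G_neq0 : exists x, G x != 0)
  (p : R) (hp : 1 < p < 2)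
  (sigma : (Zn n * torus R n -> R[i]) -> R[i])
  (hsigma : modspaceZT G p%:E sigma)
  (g1 g2 : (Zn n -> R[i]) -> R[i])
  (hg1 : modspaceZ g 1%:E g1) (hg2 : modspaceZ g 1%:E g2) :
  exists s : Zn n * torus R n -> R[i],
  representsZT sigma s /\
  exists A : (Zn n -> R[i]) -> (Zn n -> R[i]),
  [/\ bounded_on_l2 A,
      forall f, l2 f -> forall k,
        cintegrable (mu_phase R n)
          (locop_integrand s (fun_of_dist g1) (fun_of_dist g2) f k) /\
        A f k = locop s (fun_of_dist g1) (fun_of_dist g2) f k,
      forall f h, l2 f -> l2 h ->
        cintegrable (mu_phase R n)
          (weak_locop_integrand s (fun_of_dist g1) (fun_of_dist g2) f h) /\
        inner2 (A f) h =
          cintegral (mu_phase R n)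
            (weak_locop_integrand s (fun_of_dist g1) (fun_of_dist g2) f h),
      forall B : (Zn n -> R[i]) -> (Zn n -> R[i]), bounded_on_l2 B ->
        (forall f, schwartzZ f -> forall k,
          B f k = locop s (fun_of_dist g1) (fun_of_dist g2) f k) ->
        forall f, l2 f -> B f = A f &
      (opnorm2 A <= (window_const g G)%:E *
        (modnormZT G p%:E sigma * modnormZ g 1%:E g1 * modnormZ g 1%:E g2))%E].
Proof.
have p12 : 1 <= p <= 2 by case/andP: hp => h1 h2; rewrite !ltW.
have [hg1t hg1V] := hg1; have [hg2t hg2V] := hg2; have [hst hsV] := hsigma.
have dZ := discrete_countZ R n.
pose ga := fine (cLnorm (@countZ R n) 2%:E g).
pose Ga := fine (cLnorm (mu_phase R n) 2%:E G).
pose Ns := fine (modnormZT G p%:E sigma).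
pose N1 := fine (modnormZ g 1%:E g1).
pose N2 := fine (modnormZ g 1%:E g2).
have g2E : (\int[@countZ R n]_k (cmod (g k) ^+ 2)%:E = (ga ^+ 2)%:E)%E.
  exact: cLnorm2_fin (cLnorm2_lty (crapid_cmod_sqr (schwartzZ_crapid hg))).
have GE : (\int[mu_phase R n]_x (cmod (G x) ^+ 2)%:E = (Ga ^+ 2)%:E)%E.
  apply: cLnorm2_fin; apply: cLnorm2_lty; rewrite fourier_plancherel//.
  exact: crapid2_cmod_sqr (crapid_fourier hG).
have ga0 : 0 < ga.
  have [k gk] := g_neq0; apply: lt_le_trans (cmod_gt0 gk) _.
  apply: le_norm2_point; first exact: fine_ge0 (cLnorm_ge0 _ _ _).
  by rewrite g2E.
(* If the norm of [G] were 0, Plancherel would make all Fourier coefficients vanish and inversion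
   would make [G] zero at every point. *)
have Ga0 : 0 < Ga.
  rewrite lt_neqAle fine_ge0 ?cLnorm_ge0// andbT; apply/eqP => Ga0.
  have := fourier_plancherel hG; rewrite GE -Ga0 expr0n /= => /esym F0.
  have [x /eqP[]] := G_neq0; rewrite (fourier_inversion hG).
  rewrite /trigseries /synthesis (_ : (fun l => _) = fun=> 0) ?cintegral0//.
  apply/funext => l /=; rewrite (_ : fourier G x.1 l = 0) ?mul0r//.
  apply: cmod_eq0; apply/eqP; rewrite -sqrf_eq0 eq_le sqr_ge0 andbT -lee_fin.
  have := @le_point_integral _ _ _ (countZ2 R n) (discrete_countZ2 R n)
    (fun i => (cmod (fourier G i.1 i.2) ^+ 2)%:E) (x.1, l).
  by rewrite F0; apply => i; rewrite lee_fin sqr_ge0.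
have Ns0 : 0 <= Ns by exact: fine_ge0 (cLnorm_ge0 _ _ _).
have N10 : 0 <= N1 by exact: fine_ge0 (cLnorm_ge0 _ _ _).
have N20 : 0 <= N2 by exact: fine_ge0 (cLnorm_ge0 _ _ _).
(* Moves the norm of a window to the right-hand side; it is used once with [Ga] and twice with
   [ga]. *)
have divide (X : \bar R) (a N : R) : (0 <= X)%E -> 0 < a ->
    (X * (a ^+ 2)%:E <= (N ^+ 2)%:E)%E -> (X <= ((N / a) ^+ 2)%:E)%E.
  move=> X0 a0 XN; rewrite exprMn exprVn EFinM lee_pdivlMr ?exprn_gt0//.
have sq0 d (T : measurableType d) (mu : {measure set T -> \bar R}) (f : T -> R[i]) :
    (0 <= \int[mu]_x (cmod (f x) ^+ 2)%:E)%E.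
  by apply: integral_ge0 => x _; rewrite lee_fin sqr_ge0.
have c2 : (\int[countZ2 R n]_i (cmod (dist_coef sigma i) ^+ 2)%:E <= ((Ns / Ga) ^+ 2)%:E)%E.
  apply: divide => //; rewrite -GE.
  exact: (modnormZT_lower_bound hst hG p12 hsV G_neq0).
have u12 : (\int[@countZ R n]_k (cmod (fun_of_dist g1 k) ^+ 2)%:E <= ((N1 / ga) ^+ 2)%:E)%E.
  by apply: divide => //; rewrite -g2E; exact: modnormZ_lower_bound.
have u22 : (\int[@countZ R n]_k (cmod (fun_of_dist g2 k) ^+ 2)%:E <= ((N2 / ga) ^+ 2)%:E)%E.
  by apply: divide => //; rewrite -g2E; exact: modnormZ_lower_bound.
have [s [hs s2]] := dist_symbol hst (le_lt_trans c2 (ltry _)).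
have sS := le_trans s2 c2; have [ms _] := hs.
have S0 : 0 <= Ns / Ga by rewrite divr_ge0 ?(ltW Ga0).
have K10 : 0 <= N1 / ga by rewrite divr_ge0 ?(ltW ga0).
have K20 : 0 <= N2 / ga by rewrite divr_ge0 ?(ltW ga0).
have [Abd Aop] := locop_bounded S0 K10 K20 ms sS u12 u22.
exists s; split=> //; exists (locop s (fun_of_dist g1) (fun_of_dist g2)); split=> //.
- move=> f fl2 k; split=> //.
  exact: (cintegrable_locop S0 K10 K20 ms sS u12 u22 fl2).
- move=> f h fl2 hl2; exact: (weak_locop S0 K10 K20 ms sS u12 u22 fl2 hl2).
(* Agreement with the formula on Schwartz functions alone already determines a bounded operator. *)
- move=> B hB Bs; have [_ _ [code code_inj]] := dZ.
  apply: (bounded_on_l2_unique code_inj hB Abd) => f hf.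
  by apply/funext => k; exact: Bs.
(* All three modulation norms are finite, and [Ns / Ga * (N1 / ga) * (N2 / ga)] equals the claimed
   bound, so only an identity of real numbers remains. *)
- apply: (le_trans Aop); rewrite /window_const -/ga -/Ga.
  have fin (X : \bar R) : (0 <= X)%E -> (X < +oo)%E -> X = (fine X)%:E.
    by move=> X0 Xoo; rewrite fineK// ge0_fin_numE.
  rewrite (fin (modnormZT G p%:E sigma)) ?cLnorm_ge0//; last by case: hsV.
  rewrite (fin (modnormZ g 1%:E g1)) ?cLnorm_ge0//; last by case: hg1V.
  rewrite (fin (modnormZ g 1%:E g2)) ?cLnorm_ge0//; last by case: hg2V.
  rewrite -!EFinM lee_fin le_eqVlt; apply/orP; left; apply/eqP.
  rewrite -/Ns -/N1 -/N2; field.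
  by rewrite (gt_eqF ga0) (gt_eqF Ga0).
Qed.
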